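(* Let $\theta_1 \in (0,\pi/2]$, $\theta_2 \in [0,\pi/2]$, $p \in\mathcal{C}^2([0,1])$ with $p > 0$, and $\tilde{q} \in\mathcal{C}^0([0,1])$. Let $k_\varphi > 0$, $\Delta k_\varphi \in (0,k_\varphi)$, and $M_\varphi > 0$. Let $q \in\mathcal{C}^0([0,1])$ and $q_c \in\mathbb{R}$ be such that $\tilde q(x) = q(x) - q_c$ and $q(x)>0$ for all $x\in[0,1]$. Let $\delta > 0$ and $N_0 \geq 1$ be such that $-\lambda_n + q_c < - \delta$ for all $n \geq N_0 + 1$. Let $K\in\mathbb{R}^{1 \times N_0}$ and $L\in\mathbb{R}^{N_0}$ be such that $A_0 + k_\varphi \mathfrak{B}_0 K$ and $A_0 - L C_0$ are Hurwitz with eigenvalues that have a real part strictly less than $-\delta<0$. For symmetric $P\in\mathbb{R}^{2N\times 2N}$ and $\alpha,\beta,\gamma,\tau>0$ define $$\Theta_1(P,\alpha,\beta,\gamma,\tau) = \begin{bmatrix} \Theta_{1,1} & P\mathcal{L} & P\mathcal{L}_\psi \\ \mathcal{L}^\top P & - \beta & 0 \\ \mathcal{L}_\psi^\top P & 0 & \alpha\gamma \Vert \mathcal{R}_N a \Vert_{L^2}^2 - \tau \end{bmatrix} + \alpha\gamma \Vert \mathcal{R}_N b \Vert_{L^2}^2 M_\varphi^2 E^\top E ,$$ $$\Theta_{1,1} = F^\top P + P F + 2 \delta P + \left\{ \alpha\gamma k_\varphi^2 \Vert \mathcal{R}_N a \Vert_{L^2}^2 + \tau \Delta k_\varphi^2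 \right\} \tilde{K}^\top \tilde{K} .$$ Assume that $N \geq N_0 +1$ is such that both of the following hold: (i) there exist $P \succ 0$, $\alpha>3/2$, and $\beta,\gamma,\tau > 0$ such that $\Theta_1(P,\alpha,\beta,\gamma,\tau) \preceq 0$ and $$2\gamma\left\{ - \left( 1 - \frac{3}{2\alpha} \right) \lambda_{N+1}+q_c + \delta \right\} + \beta M_\phi\le 0,\qquad M_\phi = \sum_{n \geq N+1} \frac{\vert \phi_n(0) \vert^2}{\lambda_n} < +\infty;$$ (ii) there exist $P' \succ 0$ and $\alpha',\beta',\gamma',\tau' > 0$ such that $\Theta_1(P',\alpha',\beta',\gamma',\tau') \preceq 0$, $\Theta_2'\le0$ and $\Theta_3'\ge0$, where $$\Theta_2' = 2\gamma'\left\{ -\lambda_{N+1}+q_c + \delta + \frac{3}{2\alpha'} \right\} + \beta' M_\phi' \lambda_{N+1}^{3/4},\qquad \Theta_3' = 2\gamma' - \frac{\beta' M_\phi'}{\lambda_{N+1}^{1/4}},$$ with $M_\phi' = \sum_{n \geq N+1} \frac{\vert \phi_n(0) \vert^2}{\lambda_n^{3/4}} < +\infty$. Then there exists a constant $M' > 0$ such that for any $\varphi \in\mathcal{C}^1(\mathbb{R})$ satisfying $$(k_\varphi - \Delta k_\varphi) \vert x \vert \leq \mathrm{sign}(x) \varphi(x) \leq (k_\varphi + \Delta k_\varphi) \vert x \vert \quad\text{for all } x\in\mathbb{R},$$ with $\varphi'$ locally Lipschitz continuous and $\Vert \varphi' \Vert_{L^\infty} \leq M_\varphi$, and for any initial conditions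 $z_0 \in H^2(0,1)$ and $\hat{z}_n(0)\in\mathbb{R}$ ($1\le n\le N$) such that $\cos(\theta_1) z_0(0) - \sin(\theta_1) z_0'(0) = 0$ and $\cos(\theta_2) z_0(1) + \sin(\theta_2) z_0'(1) = \varphi(K \hat{Z}^{N_0}(0))$, where $\hat Z^{N_0}=[\hat z_1,\ldots,\hat z_{N_0}]^\top$, the trajectories of the closed-loop system composed of the plant (P) and the controller (C) described in the context satisfy $$\Vert z(t,\cdot) \Vert_{L^2}^2 + \sum_{n = 1}^{N} \hat{z}_n(t)^2 \leq M' e^{-2\delta t} \left( \Vert z_0 \Vert_{L^2}^2 + \sum_{n = 1}^{N} \hat{z}_n(0)^2 \right)$$ for all $t \geq 0$. Moreover, for any given $k_\varphi,M_\varphi > 0$, there exists $\Delta k_\varphi \in (0,k_\varphi)$ such that both sets of constraints (i) and (ii) are always feasible when selecting $N$ to be large enough.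
   Context: All functions are real valued. $\langle f,g\rangle=\int_0^1 fg\,dx$ is the inner product of $L^2(0,1)$. For symmetric matrices, $P\succ0$ (resp. $\succeq 0$, $\preceq 0$) means positive definite (resp. positive semi-definite, negative semi-definite). Sturm-Liouville operator: $\mathcal{A}f=-(pf')'+qf$ on $D(\mathcal{A})=\{f\in H^2(0,1): \cos(\theta_1)f(0)-\sin(\theta_1)f'(0)=0,\ \cos(\theta_2)f(1)+\sin(\theta_2)f'(1)=0\}$. Its eigenvalues $\lambda_1<\lambda_2<\cdots$ are simple, positive (as $q>0$) and tend to $+\infty$; $\phi_n$ are associated unit-norm eigenvectors, forming a Hilbert basis of $L^2(0,1)$. For $f\in L^2(0,1)$, $\mathcal{R}_Nf=\sum_{n\ge N+1}\langle f,\phi_n\rangle\phi_n$. Plant (P): for $t>0$, $x\in(0,1)$, $z_t=(p(x)z_x)_x-\tilde q(x)z$, $\ \cos(\theta_1)z(t,0)-\sin(\theta_1)z_x(t,0)=0$, $\ \cos(\theta_2)z(t,1)+\sin(\theta_2)z_x(t,1)=u_\varphi(t):=\varphi(u(t))$, $\ y(t)=z(t,0)$, $\ z(0,x)=z_0(x)$, with input $u$ and measurement $y$. Let $a(x)=\frac{2p(x)+2xp'(x)-x^2\tilde q(x)}{\cos(\theta_2)+2\sin(\theta_2)}$, $b(x)=-\frac{x^2}{\cos(\theta_2)+2\sin(\theta_2)}$, $a_n=\langle a,\phi_n\rangle$, $b_n=\langle b,\phi_n\rangle$, and $\beta_n=a_n+(-\lambda_n+q_c)b_n=p(1)\{-\cos(\theta_2)\phi_n'(1)+\sin(\theta_2)\phi_n(1)\}$.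 Controller (C), with $K=[k_1,\ldots,k_{N_0}]$ and $L=[l_1,\ldots,l_{N_0}]^\top$: $\hat w_n=\hat z_n+b_nu_\varphi$ for $1\le n\le N$; $\dot{\hat z}_n=(-\lambda_n+q_c)\hat z_n+\beta_nu_\varphi-l_n\{\sum_{k=1}^N\hat w_k\phi_k(0)-y\}$ for $1\le n\le N_0$; $\dot{\hat z}_n=(-\lambda_n+q_c)\hat z_n+\beta_nu_\varphi$ for $N_0+1\le n\le N$; $u=\sum_{k=1}^{N_0}k_k\hat z_k$. Trajectories are understood as classical solutions on a maximal interval $[0,T)$, $0<T\le+\infty$: with $w(t,x)=z(t,x)+b(x)u_\varphi(t)$ (so that $w_t=(pw_x)_x-\tilde qw+a\,u_\varphi+b\,\dot u_\varphi$ with homogeneous boundary conditions, $\dot u_\varphi=\varphi'(u)\dot u$, $y(t)=w(t,0)$, and $w(0,\cdot)\in D(\mathcal A)$) and $\hat z=(\hat z_1,\ldots,\hat z_N)$, one has $(w,\hat z)\in\mathcal{C}^0([0,T);L^2(0,1)\times\mathbb{R}^N)\cap\mathcal{C}^1((0,T);L^2(0,1)\times\mathbb{R}^N)$, $w(t,\cdot)\in D(\mathcal{A})$ for all $t\in(0,T)$, $\mathcal{A}w\in\mathcal{C}^0((0,T);L^2(0,1))$ and $\mathcal{A}^{1/2}w\in\mathcal{C}^0([0,T);L^2(0,1))$. By standard semigroup theory such solutions exist for the initial conditions considered, and if $T<+\infty$ then $\Vert\mathcal{A}^{1/2}w(t,\cdot)\Vert_{L^2}^2+\Vert\hat z(t)\Vert^2=\sum_{n\ge1}\lambda_n\langle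 w(t,\cdot),\phi_n\rangle^2+\Vert\hat z(t)\Vert^2$ is unbounded on $[0,T)$. An estimate ''for all $t\ge0$'' includes the assertion $T=+\infty$. Matrices: $A_0=\mathrm{diag}(-\lambda_1+q_c,\ldots,-\lambda_{N_0}+q_c)$, $A_1=\mathrm{diag}(-\lambda_{N_0+1}+q_c,\ldots,-\lambda_N+q_c)$, $\mathfrak{B}_0=[\beta_1,\ldots,\beta_{N_0}]^\top$, $\tilde{\mathfrak{B}}_1=\left[\frac{\beta_{N_0+1}}{\lambda_{N_0+1}},\ldots,\frac{\beta_N}{\lambda_N}\right]^\top$, $C_0=[\phi_1(0),\ldots,\phi_{N_0}(0)]$, $\tilde C_1=\left[\frac{\phi_{N_0+1}(0)}{\sqrt{\lambda_{N_0+1}}},\ldots,\frac{\phi_N(0)}{\sqrt{\lambda_N}}\right]$, $$F=\begin{bmatrix}A_0+k_\varphi\mathfrak{B}_0K&LC_0&0&L\tilde C_1\\0&A_0-LC_0&0&-L\tilde C_1\\k_\varphi\tilde{\mathfrak{B}}_1K&0&A_1&0\\0&0&0&A_1\end{bmatrix},\quad\mathcal{L}=\begin{bmatrix}L\\-L\\0\\0\end{bmatrix},\quad\mathcal{L}_\psi=\begin{bmatrix}\mathfrak{B}_0\\0\\\tilde{\mathfrak{B}}_1\\0\end{bmatrix},$$ $\tilde K=[K\ 0\ 0\ 0]\in\mathbb{R}^{1\times 2N}$, and $E=K\,[A_0+k_\varphi\mathfrak{B}_0K\ \ LC_0\ \ 0\ \ L\tilde C_1\ \ L\ \ \mathfrak{B}_0]\in\mathbb{R}^{1\times(2N+2)}$,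 with block sizes $N_0,N_0,N-N_0,N-N_0$ (and two last blocks of size $1$ for $E$). In the final ''Moreover'' assertion, $\theta_1,\theta_2,p,\tilde q,q,q_c,\delta,N_0,K,L$ are given and satisfy the hypotheses stated in the claim, and $\Delta k_\varphi$ does not depend on $N$. *)

(* Defs.v *)
From HB Require Import structures.
From mathcomp Require Import all_boot all_order all_algebra.
From mathcomp Require Import complex.
From mathcomp Require Import all_classical all_reals all_analysis.

Set Implicit Arguments.
Unset Strict Implicit.
Unset Printing Implicit Defensive.

Import Order.TTheory GRing.Theory Num.Theory.
Import numFieldNormedType.Exports.

Local Open Scope classical_set_scope.
Local Open Scope ring_scope.

(* A function on [0,1] is represented by a total function R -> R of which only
   the restriction to [0,1] is ever used; an element of L^2(0,1) is represented
   by any member of its class. *)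

Section FunctionSpaces.
Context {R : realType}.
Local Notation mu := (@lebesgue_measure R).
Implicit Types f g : R -> R.

Definition L2 f : Prop :=
  measurable_fun (`[0, 1] : set R) f /\
  mu.-integrable `[0, 1] (fun x => (f x ^+ 2)%:E).

Definition ip f g : R := \int[mu]_(x in `[0, 1]) (f x * g x).

Definition normL2 f : R := Num.sqrt (ip f f).

Definition L2_series_cvg (s : nat -> R -> R) f : Prop :=
  L2 f /\
  normL2 (fun x => \sum_(k < n) s k x - f x) @[n --> \oo] --> (0 : R).

(* A representative of the L^2-sum of the series with general term s (and 0 if
   the series does not converge in L^2). *)
Definition L2_series (s : nat -> R -> R) : R -> R :=
  xget (fun=> 0) [set f | L2_series_cvg s f].

(* Difference quotients stay inside [0,1], so the derivative is one-sided at
   the end points. *)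
Definition diffq01 f (x y : R) : R := (f y - f x) / (y - x).

Definition derivable01 f (x : R) : Prop :=
  cvg (diffq01 f x y @[y --> within `[0, 1] x^']).

Definition deriv01 f (x : R) : R :=
  lim (diffq01 f x y @[y --> within `[0, 1] x^']).

Definition C0_01 f : Prop := {within `[0, 1], continuous f}.

Definition C1_01 f : Prop :=
  (forall x, x \in `[0, 1] -> derivable01 f x) /\ C0_01 (deriv01 f).

Definition C2_01 f : Prop := C1_01 f /\ C1_01 (deriv01 f).

(* f belongs to H^1(0,1) (f being the continuous representative) and g is its
   weak derivative. *)
Definition is_wderiv f g : Prop :=
  L2 g /\
  forall x, x \in `[0, 1] -> f x = f 0 + \int[mu]_(s in `[0, x]) g s.

(* A representative of the weak derivative of f. *)
Definition wderiv f : R -> R := xget (fun=> 0) [set g | is_wderiv f g].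

(* f belongs to H^2(0,1), f being the C^1 representative: boundary values of
   f and of deriv01 f are the traces. *)
Definition H2 f : Prop := C1_01 f /\ exists g, is_wderiv (deriv01 f) g.

Definition L2_continuous_on (D : set R) (v : R -> R -> R) : Prop :=
  (forall t, D t -> L2 (v t)) /\
  (forall t, D t ->
     normL2 (fun x => v s x - v t x) @[s --> within D (nbhs t)] --> (0 : R)).

Definition is_L2_deriv (v : R -> R -> R) (t : R) g : Prop :=
  L2 g /\
  normL2 (fun x => (v s x - v t x) / (s - t) - g x) @[s --> t^'] --> (0 : R).

(* For D open. *)
Definition L2_C1_on (D : set R) (v : R -> R -> R) : Prop :=
  exists v' : R -> R -> R,
    (forall t, D t -> is_L2_deriv v t (v' t)) /\ L2_continuous_on D v'.

End FunctionSpaces.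

Section Matrices.
Context {R : realType}.

Definition posdefmx n (M : 'M[R]_n) : Prop :=
  M^T = M /\ forall v : 'cV[R]_n, v != 0 -> 0 < (v^T *m M *m v) 0 0.

Definition negsemidefmx n (M : 'M[R]_n) : Prop :=
  M^T = M /\ forall v : 'cV[R]_n, (v^T *m M *m v) 0 0 <= 0.

(* Every complex eigenvalue of M has a real part strictly less than - delta. *)
Definition hurwitz_margin n (M : 'M[R]_n) (delta : R) : Prop :=
  forall l : R[i],
    eigenvalue (map_mx (real_complex R) M) l -> complex.Re l < - delta.

End Matrices.

Section SturmLiouville.
Context {R : realType}.
Context (th1 th2 : R) (p q : R -> R).
Local Notation mu := (@lebesgue_measure R).

Definition bc_left (f : R -> R) : R := cos th1 * f 0 - sin th1 * deriv01 f 0.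
Definition bc_right (f : R -> R) : R := cos th2 * f 1 + sin th2 * deriv01 f 1.

Definition domA (f : R -> R) : Prop := H2 f /\ bc_left f = 0 /\ bc_right f = 0.

Definition opA (f : R -> R) : R -> R :=
  fun x => - wderiv (fun y => p y * deriv01 f y) x + q x * f x.

Definition eigenpair (l : R) (f : R -> R) : Prop :=
  domA f /\ opA f = (fun x => l * f x) %[ae mu in `[0, 1]%classic].

Definition is_eigenvalue (l : R) : Prop :=
  exists f, eigenpair l f /\ ~ (f = (fun=> 0) %[ae mu in `[0, 1]%classic]).

(* Indices are shifted by one: lam n and phi n stand for lambda_(n+1) and
   phi_(n+1).  The existence of such a system is the classical spectral theorem
   for regular Sturm-Liouville operators; the eigenvalues are simple, by
   eig_increasing, eig_pair and the last two fields. *)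
Record sl_eigenbasis (lam : nat -> R) (phi : nat -> R -> R) : Prop := {
  eig_spectrum : forall l, is_eigenvalue l <-> exists n, l = lam n ;
  eig_increasing : forall n, lam n < lam n.+1 ;
  eig_positive : forall n, 0 < lam n ;
  eig_unbounded : lam @ \oo --> +oo ;
  eig_pair : forall n, eigenpair (lam n) (phi n) ;
  eig_orthonormal : forall m n, ip (phi m) (phi n) = (m == n)%:R ;
  eig_complete : forall f, L2 f ->
    L2_series_cvg (fun n x => ip f (phi n) * phi n x) f }.

End SturmLiouville.

Section Spectral.
Context {R : realType}.
Context (lam : nat -> R) (phi : nat -> R -> R).

(* The square root of the positive self-adjoint operator A, meaningful on its
   form domain; only used on elements of D(A). *)
Definition opA_sqrt (f : R -> R) : R -> R :=
  L2_series (fun n x => Num.sqrt (lam n) * ip f (phi n) * phi n x).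

(* With the shifted indices, the modes n >= N+1 are phi N, phi (N+1), ... *)
Definition resid (N : nat) (f : R -> R) : R -> R :=
  L2_series (fun n x => ip f (phi (N + n)%N) * phi (N + n)%N x).

Definition M_phi (N : nat) : \bar R :=
  (\sum_(N <= n <oo) (`|phi n 0| ^+ 2 / lam n)%:E)%E.

Definition M_phi' (N : nat) : \bar R :=
  (\sum_(N <= n <oo) (`|phi n 0| ^+ 2 / lam n `^ (3 / 4))%:E)%E.

End Spectral.

Section Observer.
Context {R : realType}.
Context (th2 : R) (p qt : R -> R) (qc : R).
Context (lam : nat -> R) (phi : nat -> R -> R).

Definition coefa (x : R) : R :=
  (2 * p x + 2 * x * deriv01 p x - x ^+ 2 * qt x) / (cos th2 + 2 * sin th2).

Definition coefb (x : R) : R := - (x ^+ 2 / (cos th2 + 2 * sin th2)).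

Definition an (n : nat) : R := ip coefa (phi n).
Definition bn (n : nat) : R := ip coefb (phi n).
Definition betan (n : nat) : R := an n + (- lam n + qc) * bn n.

Section Dimensions.
Context (N0 N : nat).

Definition A0 : 'M[R]_N0 := diag_mx (\row_(i < N0) (- lam i + qc)).
Definition A1 : 'M[R]_(N - N0) :=
  diag_mx (\row_(i < N - N0) (- lam (N0 + i)%N + qc)).
Definition B0 : 'cV[R]_N0 := \col_(i < N0) betan i.
Definition B1 : 'cV[R]_(N - N0) :=
  \col_(i < N - N0) (betan (N0 + i)%N / lam (N0 + i)%N).
Definition C0 : 'rV[R]_N0 := \row_(i < N0) phi i 0.
Definition C1 : 'rV[R]_(N - N0) :=
  \row_(i < N - N0) (phi (N0 + i)%N 0 / Num.sqrt (lam (N0 + i)%N)).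

Context (kphi dkphi Mphi : R) (K : 'rV[R]_N0) (L : 'cV[R]_N0) (delta : R).

(* Equal to 2N when N0 <= N. *)
Definition dimF : nat := (N0 + N0 + ((N - N0) + (N - N0)))%N.

Definition matF : 'M[R]_dimF :=
  block_mx
    (block_mx (A0 + kphi *: (B0 *m K)) (L *m C0)
              0                        (A0 - L *m C0))
    (block_mx 0 (L *m C1)
              0 (- (L *m C1)))
    (block_mx (kphi *: (B1 *m K)) 0
              0                   0)
    (block_mx A1 0
              0  A1).

Definition calL : 'cV[R]_dimF := col_mx (col_mx L (- L)) (col_mx 0 0).
Definition calLpsi : 'cV[R]_dimF := col_mx (col_mx B0 0) (col_mx B1 0).
Definition Ktilde : 'rV[R]_dimF := row_mx (row_mx K 0) (row_mx 0 0).

Definition matE : 'rV[R]_(dimF + 1 + 1) :=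
  K *m row_mx (row_mx (row_mx (row_mx (A0 + kphi *: (B0 *m K)) (L *m C0))
                              (row_mx 0 (L *m C1)))
                      L)
              B0.

Definition Theta11 (P : 'M[R]_dimF) (alpha gamma tau : R) : 'M[R]_dimF :=
  matF^T *m P + P *m matF + (2 * delta) *: P
  + (alpha * gamma * kphi ^+ 2 * normL2 (resid phi N coefa) ^+ 2
     + tau * dkphi ^+ 2) *: (Ktilde^T *m Ktilde).

Definition Theta1 (P : 'M[R]_dimF) (alpha beta gamma tau : R)
    : 'M[R]_(dimF + 1 + 1) :=
  block_mx
    (block_mx (Theta11 P alpha gamma tau) (P *m calL)
              (calL^T *m P)               (- beta)%:M)
    (col_mx (P *m calLpsi) 0)
    (row_mx (calLpsi^T *m P) 0)
    (alpha * gamma * normL2 (resid phi N coefa) ^+ 2 - tau)%:M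
  + (alpha * gamma * normL2 (resid phi N coefb) ^+ 2 * Mphi ^+ 2)
      *: (matE^T *m matE).

(* lam N is lambda_(N+1). *)
Definition constraints_i : Prop :=
  (M_phi lam phi N < +oo)%E /\
  exists (P : 'M[R]_dimF) (alpha beta gamma tau : R),
    [/\ posdefmx P, 3 / 2 < alpha, 0 < beta, 0 < gamma & 0 < tau] /\
    negsemidefmx (Theta1 P alpha beta gamma tau) /\
    2 * gamma * (- (1 - 3 / (2 * alpha)) * lam N + qc + delta)
      + beta * fine (M_phi lam phi N) <= 0.

Definition constraints_ii : Prop :=
  (M_phi' lam phi N < +oo)%E /\
  exists (P : 'M[R]_dimF) (alpha beta gamma tau : R),
    [/\ posdefmx P, 0 < alpha, 0 < beta, 0 < gamma & 0 < tau] /\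
    negsemidefmx (Theta1 P alpha beta gamma tau) /\
    2 * gamma * (- lam N + qc + delta + 3 / (2 * alpha))
      + beta * fine (M_phi' lam phi N) * lam N `^ (3 / 4) <= 0 /\
    0 <= 2 * gamma - beta * fine (M_phi' lam phi N) / lam N `^ (1 / 4).

End Dimensions.
End Observer.

Section Nonlinearity.
Context {R : realType}.
Local Notation mu := (@lebesgue_measure R).

Record admissible_nonlinearity (kphi dkphi Mphi : R) (vphi : R -> R) : Prop := {
  nl_derivable : forall x, derivable vphi x 1 ;
  nl_C1 : continuous (derive1 vphi) ;
  nl_sector : forall x,
    (kphi - dkphi) * `|x| <= Num.sg x * vphi x <= (kphi + dkphi) * `|x| ;
  nl_locally_lipschitz : forall x, exists2 r : R, 0 < r &
    [lipschitz derive1 vphi y | y in ball x r] ;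
  nl_slope : ('N[mu]_+oo [EFin \o derive1 vphi] <= Mphi%:E)%E }.

End Nonlinearity.

Section ClosedLoop.
Context {R : realType}.
Context (th1 th2 : R) (p qt q : R -> R) (qc : R).
Context (lam : nat -> R) (phi : nat -> R -> R).
Context (N0 N : nat) (K : 'rV[R]_N0) (L : 'cV[R]_N0) (vphi : R -> R).

(* The state is (z, zh) with z t x the plant state and zh n t (n < N) standing
   for the observer component of index n+1. *)

Definition uphi (zh : nat -> R -> R) (t : R) : R :=
  vphi (\sum_(k < N0) K 0 k * zh k t).

Definition hom_state (z : R -> R -> R) (zh : nat -> R -> R) (t x : R) : R :=
  z t x + coefb th2 x * uphi zh t.

Definition hatw (zh : nat -> R -> R) (n : nat) (t : R) : R :=
  zh n t + bn th2 phi n * uphi zh t.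

Definition open_loop_rhs (zh : nat -> R -> R) (n : nat) (t : R) : R :=
  (- lam n + qc) * zh n t + betan th2 p qt qc lam phi n * uphi zh t.

Definition output_error (z : R -> R -> R) (zh : nat -> R -> R) (t : R) : R :=
  \sum_(k < N) hatw zh k t * phi k 0 - z t 0.

(* [0, T) and (0, T), where T may be +oo. *)
Definition Ico (T : \bar R) : set R := [set t | 0 <= t /\ (t%:E < T)%E].
Definition Ioo (T : \bar R) : set R := [set t | 0 < t /\ (t%:E < T)%E].

Record classical_solution (T : \bar R) (z : R -> R -> R) (zh : nat -> R -> R)
    : Prop := {
  cs_horizon : (0 < T)%E ;
  cs_w_C0 : L2_continuous_on (Ico T) (hom_state z zh) ;
  cs_w_C1 : L2_C1_on (Ioo T) (hom_state z zh) ;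
  cs_w_dom : forall t, Ico T t -> domA th1 th2 (hom_state z zh t) ;
  cs_Aw_C0 : L2_continuous_on (Ioo T) (fun t => opA p q (hom_state z zh t)) ;
  cs_sqrtAw_C0 :
    L2_continuous_on (Ico T) (fun t => opA_sqrt lam phi (hom_state z zh t)) ;
  cs_zh_C0 : forall n, (n < N)%N -> {within Ico T, continuous (zh n)} ;
  cs_zh_C1 : forall n, (n < N)%N -> {within Ioo T, continuous (derive1 (zh n))} ;
  cs_plant : forall t, Ioo T t ->
    is_L2_deriv z t
      (fun x => wderiv (fun y => p y * deriv01 (z t) y) x - qt x * z t x) ;
  cs_bc_left : forall t, Ioo T t -> bc_left th1 (z t) = 0 ;
  cs_bc_right : forall t, Ioo T t -> bc_right th2 (z t) = uphi zh t ;
  cs_observer_low : forall (n : 'I_N0) t, Ioo T t ->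
    is_derive t 1 (zh n)
      (open_loop_rhs zh n t - L n 0 * output_error z zh t) ;
  cs_observer_high : forall n t, (N0 <= n < N)%N -> Ioo T t ->
    is_derive t 1 (zh n) (open_loop_rhs zh n t) }.

Definition energy (z : R -> R -> R) (zh : nat -> R -> R) (t : R) : R :=
  normL2 (opA_sqrt lam phi (hom_state z zh t)) ^+ 2
  + \sum_(n < N) zh n t ^+ 2.

Definition extends (T : \bar R) (z : R -> R -> R) (zh : nat -> R -> R)
    (z' : R -> R -> R) (zh' : nat -> R -> R) : Prop :=
  forall t, Ico T t ->
    (forall x, x \in `[0, 1] -> z' t x = z t x) /\
    (forall n, (n < N)%N -> zh' n t = zh n t).

(* A maximal classical solution.  The field tr_blowup is the blow-up
   alternative satisfied by every maximal solution, part of the standard local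
   well-posedness theory of semilinear parabolic equations. *)
Record trajectory (z0 : R -> R) (zh0 : nat -> R)
    (T : \bar R) (z : R -> R -> R) (zh : nat -> R -> R) : Prop := {
  tr_solution : classical_solution T z zh ;
  tr_init_z : forall x, x \in `[0, 1] -> z 0 x = z0 x ;
  tr_init_zh : forall n, (n < N)%N -> zh n 0 = zh0 n ;
  tr_maximal : forall T' z' zh', (T < T')%E ->
    classical_solution T' z' zh' -> ~ extends T z zh z' zh' ;
  tr_blowup : (T < +oo)%E ->
    forall B : R, exists2 t, Ico T t & B < energy z zh t }.

End ClosedLoop.

(* Main.v *)
(* Setting w = z + b u_phi makes the boundary conditions homogeneous.  Projecting
   on the first N modes gives X' = F X + zeta L + psi L_psi, where X gathers the
   observer modes and the rescaled estimation errors, zeta is the contribution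
   of the modes n > N to the measurement and psi = phi(u) - k_phi u, so that
   |psi| <= (Delta k_phi) |u|.  For V = X^T P X + gamma sum_(n > N) <w, phi_n>^2,
   the quantity V' + 2 delta V is bounded by the quadratic form Theta_1 at
   (X, zeta, psi) plus a multiple of the tail of w, and both are nonpositive
   under (ii); this is the L^2 estimate.  Weighting the tail by lambda_n
   instead, (i) gives the decay of an energy equivalent to the one in the
   blow-up alternative, whence T = +oo.

   For the feasibility, P = diag(P_K, m P_L, eps, mu), where P_K and P_L are
   Lyapunov matrices of A_0 + k_phi B_0 K and A_0 - L C_0, obtained from a Schur
   triangularisation.  The blocks of F outside the first N_0 modes are bounded
   uniformly in N by Bessel's inequality and by the trace inequality
   f(0)^2 <= C <A f, f>, so m, mu, eps, beta, tau and then Delta k_phi are chosen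
   before N, and the residuals R_N a, R_N b tend to 0. *)
Require Import Defs.
From HB Require Import structures.
From mathcomp Require Import all_boot all_order all_algebra.
From mathcomp Require Import complex ring lra spectral.
From mathcomp Require Import all_classical all_reals all_analysis.
From mathcomp Require Import measurable_realfun ess_sup_inf.

Set Implicit Arguments.
Unset Strict Implicit.
Unset Printing Implicit Defensive.

Import Order.TTheory GRing.Theory Num.Theory.
Import numFieldNormedType.Exports.

Local Open Scope classical_set_scope.
Local Open Scope ring_scope.

(** * Square-integrable functions on (0,1) *)

Section SquareIntegrable.
Context {R : realType}.
Local Notation mu := (@lebesgue_measure R).
Implicit Types (D : set R) (f g h : R -> R).

(** Neither Lyapunov function can do the work of the other. The norm of A^(1/2) w in the blow-up
    alternative is not controlled by an L^2 estimate, and a decay of the energy is not bounded in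
    terms of the L^2 norm of z_0.

    Two gaps in regularity shape the analysis. No time derivative of A w is available, so the energy
    is differentiated through the symmetry of A; and A w is continuous on the open time interval
    only, so the energy estimate starts at a positive time.

    A tail over n > N is written as a full inner product minus N terms: time derivatives then never
    meet an infinite series, while inequalities between tails are checked mode by mode through
    Parseval.

    The measurement w(t, 0) is a trace, which is not continuous in L^2. The convergence of the
    expansion at 0 and the finiteness of M_phi and M_phi' come from trace inequalities for the form
    of A, tested on remainders and on combinations of eigenfunctions whose coefficients are built
    from phi_n(0). *)

Definition L2on D f : Prop :=
  measurable_fun D f /\ mu.-integrable D (fun x => (f x ^+ 2)%:E).

Lemma integrable_dominated D f g : measurable D -> measurable_fun D f ->
  mu.-integrable D (EFin \o g) -> (forall x, D x -> `|f x| <= g x) ->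
  mu.-integrable D (EFin \o f).
Proof.
move=> mD mf ig fg; apply: (@le_integrable _ _ _ mu D mD _ _ _ _ ig).
  exact/measurable_EFinP.
by move=> x Dx /=; rewrite lee_fin (le_trans (fg _ Dx))// ler_norm.
Qed.

Lemma RintegrableD D f g : measurable D ->
  mu.-integrable D (EFin \o f) -> mu.-integrable D (EFin \o g) ->
  mu.-integrable D (EFin \o (fun x => f x + g x)).
Proof.
move=> mD h k; rewrite (_ : EFin \o _ = (EFin \o f) \+ (EFin \o g))%E//.
exact: integrableD.
Qed.

Lemma RintegrableZ D (c : R) f : measurable D ->
  mu.-integrable D (EFin \o f) -> mu.-integrable D (EFin \o (fun x => c * f x)).
Proof.
move=> mD h.
rewrite (_ : EFin \o _ = (fun x : R => c%:E * (EFin \o f) x))%E//; first last.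
exact: integrableZl.
Qed.

Lemma RintegrableB D f g : measurable D ->
  mu.-integrable D (EFin \o f) -> mu.-integrable D (EFin \o g) ->
  mu.-integrable D (EFin \o (fun x => f x - g x)).
Proof.
move=> mD h k; rewrite (_ : EFin \o _ = (EFin \o f) \- (EFin \o g))%E//.
exact: integrableB.
Qed.

Lemma Rintegrable_cst D (c : R) : measurable D -> (mu D < +oo)%E ->
  mu.-integrable D (EFin \o (fun=> c)).
Proof.
move=> mD muD; apply/integrableP; split; first exact: measurable_cst.
rewrite (_ : \int[mu]_(x in D) _ = \int[mu]_(x in D) cst (`|c|%:E) x)%E//.
by rewrite integral_cst// lte_mul_pinfty// ?lee_fin ?fin_numE.
Qed.

Lemma RintD D f g : measurable D ->
  mu.-integrable D (EFin \o f) -> mu.-integrable D (EFin \o g) ->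
  \int[mu]_(x in D) (f x + g x) = \int[mu]_(x in D) f x + \int[mu]_(x in D) g x.
Proof. by move=> mD h k; exact (@RintegralD _ _ _ mu D f g mD h k). Qed.

Lemma RintB D f g : measurable D ->
  mu.-integrable D (EFin \o f) -> mu.-integrable D (EFin \o g) ->
  \int[mu]_(x in D) (f x - g x) = \int[mu]_(x in D) f x - \int[mu]_(x in D) g x.
Proof. by move=> mD h k; exact (@RintegralB _ _ _ mu D f g mD h k). Qed.

Lemma RintZ D (c : R) f : measurable D -> mu.-integrable D (EFin \o f) ->
  \int[mu]_(x in D) (c * f x) = c * \int[mu]_(x in D) f x.
Proof. by move=> *; exact: RintegralZl. Qed.

Lemma L2on_mul D f g : measurable D -> L2on D f -> L2on D g ->
  mu.-integrable D (EFin \o (f \* g)).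
Proof.
move=> mD [mf if2] [mg ig2].
apply: (@integrable_dominated _ _ (fun x => f x ^+ 2 + g x ^+ 2)) => //.
- exact: measurable_funM.
- exact: RintegrableD.
- move=> x _ /=; rewrite ler_norml; apply/andP; split; nra.
Qed.

Lemma L2onS D D' f : measurable D -> measurable D' -> D' `<=` D ->
  L2on D f -> L2on D' f.
Proof.
move=> mD mD' sD [mf if2]; split; first exact: measurable_funS mf.
exact: integrableS if2.
Qed.

Lemma L2on_norm D f : measurable D -> L2on D f -> L2on D (fun x => `|f x|).
Proof.
move=> mD [mf if2]; split; first exact: measurableT_comp.
by under eq_fun do rewrite real_normK ?num_real//.
Qed.

Lemma L2onD D f g : measurable D -> L2on D f -> L2on D g ->
  L2on D (fun x => f x + g x).
Proof.
move=> mD Lf Lg; split; first exact: measurable_funD Lf.1 Lg.1.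
apply: (@integrable_dominated _ _ (fun x => 2 * f x ^+ 2 + 2 * g x ^+ 2)) => //.
- by apply: measurable_funX; apply: measurable_funD Lf.1 Lg.1.
- apply: RintegrableD => //; apply: RintegrableZ => //; [exact: Lf.2|exact: Lg.2].
- move=> x _; rewrite ger0_norm ?sqr_ge0//.
  have := sqr_ge0 (f x - g x); nra.
Qed.

Lemma L2onZ D (c : R) f : measurable D -> L2on D f -> L2on D (fun x => c * f x).
Proof.
move=> mD Lf; split; first by apply: measurable_funM => //; exact: Lf.1.
under eq_fun do rewrite exprMn.
exact: (RintegrableZ (c ^+ 2) mD Lf.2).
Qed.

Lemma L2on0 D : measurable D -> L2on D (fun=> 0).
Proof.
move=> mD; split; first exact: measurable_cst.
under eq_fun do rewrite expr0n/=; exact: integrable0.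
Qed.

Lemma L2onB D f g : measurable D -> L2on D f -> L2on D g ->
  L2on D (fun x => f x - g x).
Proof.
move=> mD Lf Lg; under eq_fun do rewrite -mulN1r.
by apply: L2onD => //; exact: L2onZ.
Qed.

Lemma L2on_sum D (n : nat) (F : nat -> R -> R) : measurable D ->
  (forall k, (k < n)%N -> L2on D (F k)) -> L2on D (fun x => \sum_(k < n) F k x).
Proof.
move=> mD; elim: n => [|n IH] LF.
  by under eq_fun do rewrite big_ord0; exact: L2on0.
under eq_fun do rewrite big_ord_recr/=.
by apply: L2onD => //; [apply: IH => k kn; apply: LF; exact: ltnW|exact: LF].
Qed.

Lemma L2on_integrable D f : measurable D -> (mu D < +oo)%E -> L2on D f ->
  mu.-integrable D (EFin \o f).
Proof.
move=> mD muD Lf.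
apply: (@integrable_dominated _ _ (fun x => 1 + f x ^+ 2)) => //.
- exact: Lf.1.
- apply: RintegrableD => //; [exact: Rintegrable_cst|exact: Lf.2].
- move=> x _ /=; rewrite ler_norml; apply/andP; split; nra.
Qed.

(** The quadratic is evaluated at its minimiser b / c. When c = 0 it is affine in t and equals -1 at
    (a + 1) / (2 b), unless b = 0. Every Cauchy-Schwarz inequality below, for integrals, finite
    sums, vectors and semi-definite forms, comes from here. *)
Lemma discriminant_le (a b c : R) : 0 <= a -> 0 <= c ->
  (forall t, 0 <= a - 2 * t * b + t ^+ 2 * c) -> b ^+ 2 <= a * c.
Proof.
move=> a0 c0 H; have [c_eq0|cN0] := eqVneq c 0.
  subst c; rewrite mulr0; have [->|bN0] := eqVneq b 0; first by rewrite expr0n.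
  have := H ((a + 1) / (2 * b)).
  have -> : 2 * ((a + 1) / (2 * b)) * b = a + 1 by field.
  lra.
have cp : 0 < c by rewrite lt_def cN0.
have := H (b / c); rewrite -(pmulr_lge0 _ cp).
have -> : (a - 2 * (b / c) * b + (b / c) ^+ 2 * c) * c = a * c - b ^+ 2 by field.
by rewrite subr_ge0.
Qed.

Lemma Rintegral_CS D f g : measurable D -> L2on D f -> L2on D g ->
  (\int[mu]_(x in D) (f x * g x)) ^+ 2 <=
  (\int[mu]_(x in D) (f x ^+ 2)) * (\int[mu]_(x in D) (g x ^+ 2)).
Proof.
move=> mD Lf Lg; apply: discriminant_le.
- by apply: Rintegral_ge0 => x _; exact: sqr_ge0.
- by apply: Rintegral_ge0 => x _; exact: sqr_ge0.
move=> t.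
have -> : \int[mu]_(x in D) (f x ^+ 2) - 2 * t * \int[mu]_(x in D) (f x * g x)
    + t ^+ 2 * \int[mu]_(x in D) (g x ^+ 2) = \int[mu]_(x in D) (f x - t * g x) ^+ 2.
  have ifg := L2on_mul mD Lf Lg.
  have iff : mu.-integrable D (EFin \o (fun x => f x ^+ 2)) := Lf.2.
  have igg : mu.-integrable D (EFin \o (fun x => g x ^+ 2)) := Lg.2.
  rewrite -(RintZ (2 * t) mD ifg) -(RintZ (t ^+ 2) mD igg) -RintB//; last first.
    exact: RintegrableZ.
  rewrite -RintD//; last 2 first.
  - by apply: RintegrableB => //; exact: RintegrableZ.
  - exact: RintegrableZ.
  by apply: eq_Rintegral => x _; rewrite /=; ring.
by apply: Rintegral_ge0 => x _; exact: sqr_ge0.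
Qed.

End SquareIntegrable.

(** * Inner product and norm on the unit interval *)

Section UnitInterval.
Context {R : realType}.
Local Notation mu := (@lebesgue_measure R).
Local Notation I01 := (`[0, 1]%classic : set R).
Implicit Types f g h : R -> R.

Lemma measurable01 : measurable I01. Proof. exact: measurable_itv. Qed.

Lemma mu_itv_lty (a b : R) : (mu `[a, b] < +oo)%E.
Proof. by rewrite lebesgue_measure_itv/=; case: ifP => // _; rewrite ltry. Qed.

Lemma mu01 : mu I01 = 1%E.
Proof. by rewrite lebesgue_measure_itv/= lte_fin ltr01 oppr0 adde0. Qed.

Lemma L2D f g : L2 f -> L2 g -> L2 (fun x => f x + g x).
Proof. exact: L2onD measurable01. Qed.

Lemma L2B f g : L2 f -> L2 g -> L2 (fun x => f x - g x).
Proof. exact: L2onB measurable01. Qed.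

Lemma L2Z (c : R) f : L2 f -> L2 (fun x => c * f x).
Proof. exact: L2onZ measurable01. Qed.

Lemma L2_sum (n : nat) (F : nat -> R -> R) :
  (forall k, (k < n)%N -> L2 (F k)) -> L2 (fun x => \sum_(k < n) F k x).
Proof. exact: L2on_sum measurable01. Qed.

Lemma integrable_L2M f g : L2 f -> L2 g ->
  mu.-integrable I01 (EFin \o (fun x => f x * g x)).
Proof. exact: L2on_mul measurable01. Qed.

Lemma ipC f g : ip f g = ip g f.
Proof. by apply: eq_Rintegral => x _; rewrite mulrC. Qed.

Lemma ipDl f g h : L2 f -> L2 g -> L2 h ->
  ip (fun x => f x + g x) h = ip f h + ip g h.
Proof.
move=> Lf Lg Lh; rewrite /ip -(RintD measurable01); first last.
- exact: integrable_L2M.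
- exact: integrable_L2M.
by apply: eq_Rintegral => x _; rewrite mulrDl.
Qed.

Lemma ipZl (c : R) f g : L2 f -> L2 g -> ip (fun x => c * f x) g = c * ip f g.
Proof.
move=> Lf Lg; rewrite /ip -(RintZ _ measurable01); last exact: integrable_L2M.
by apply: eq_Rintegral => x _; rewrite mulrA.
Qed.

Lemma ipDr f g h : L2 f -> L2 g -> L2 h ->
  ip h (fun x => f x + g x) = ip h f + ip h g.
Proof. by move=> *; rewrite ipC ipDl// !(ipC h). Qed.

Lemma ipZr (c : R) f g : L2 f -> L2 g -> ip g (fun x => c * f x) = c * ip g f.
Proof. by move=> *; rewrite ipC ipZl// (ipC g). Qed.

Lemma ipBl f g h : L2 f -> L2 g -> L2 h ->
  ip (fun x => f x - g x) h = ip f h - ip g h.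
Proof.
move=> Lf Lg Lh; under [X in ip X _]eq_fun do rewrite -mulN1r.
by rewrite ipDl ?ipZl//; [rewrite mulN1r|exact: L2Z].
Qed.

Lemma ipBr f g h : L2 f -> L2 g -> L2 h ->
  ip h (fun x => f x - g x) = ip h f - ip h g.
Proof. by move=> *; rewrite ipC ipBl// !(ipC h). Qed.

Lemma ip0l g : ip (fun=> 0) g = 0.
Proof.
rewrite /ip; under eq_Rintegral do rewrite mul0r.
by rewrite Rintegral_cst ?mul0r//; exact: measurable01.
Qed.

Lemma ip_suml (n : nat) (F : nat -> R -> R) g :
  (forall k, (k < n)%N -> L2 (F k)) -> L2 g ->
  ip (fun x => \sum_(k < n) F k x) g = \sum_(k < n) ip (F k) g.
Proof.
move=> + Lg; elim: n => [|n IH] LF.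
  by rewrite big_ord0; under [X in ip X _]eq_fun do rewrite big_ord0; exact: ip0l.
under [X in ip X _]eq_fun do rewrite big_ord_recr/=.
have LF' k : (k < n)%N -> L2 (F k) by move=> kn; apply: LF; exact: ltnW.
by rewrite ipDl ?IH ?big_ord_recr//=; [exact: L2_sum|exact: LF].
Qed.

Lemma ip_ge0 f : 0 <= ip f f.
Proof. by apply: Rintegral_ge0 => x _; rewrite -expr2 sqr_ge0. Qed.

Lemma normL2_ge0 f : 0 <= normL2 f. Proof. exact: sqrtr_ge0. Qed.

Lemma normL2_sqr f : normL2 f ^+ 2 = ip f f.
Proof. by rewrite sqr_sqrtr// ip_ge0. Qed.

Lemma ip_CS f g : L2 f -> L2 g -> `|ip f g| <= normL2 f * normL2 g.
Proof.
move=> Lf Lg.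
have sq h : \int[mu]_(x in I01) (h x ^+ 2) = ip h h.
  by apply: eq_Rintegral => x _; rewrite expr2.
have := Rintegral_CS measurable01 Lf Lg; rewrite !sq -!normL2_sqr -exprMn => H.
rewrite -ler_sqr ?nnegrE ?mulr_ge0 ?normL2_ge0 ?normr_ge0//.
by rewrite real_normK ?num_real.
Qed.

Lemma ip_expand (a b : R) f g : L2 f -> L2 g ->
  ip (fun x => a * f x + b * g x) (fun x => a * f x + b * g x) =
  a ^+ 2 * ip f f + 2 * a * b * ip f g + b ^+ 2 * ip g g.
Proof.
move=> Lf Lg; have La := L2Z a Lf; have Lb := L2Z b Lg; have Lab := L2D La Lb.
rewrite ipDl// !ipDr// !ipZl// !ipZr// (ipC g f); ring.
Qed.

Lemma normL2_triangle f g : L2 f -> L2 g ->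
  normL2 (fun x => f x + g x) <= normL2 f + normL2 g.
Proof.
move=> Lf Lg; rewrite -ler_sqr ?nnegrE ?addr_ge0 ?normL2_ge0// normL2_sqr.
have -> : ip (fun x => f x + g x) (fun x => f x + g x) =
    ip f f + 2 * ip f g + ip g g.
  rewrite !ipDl ?ipDr// ?(ipC g f); [ring|exact: L2D..].
have := le_trans (ler_norm _) (ip_CS Lf Lg); rewrite -!normL2_sqr.
set u := normL2 f; set v := normL2 g; nra.
Qed.

Lemma normL2Z (c : R) f : L2 f -> normL2 (fun x => c * f x) = `|c| * normL2 f.
Proof.
move=> Lf; rewrite /normL2 ipZl ?ipZr//; last exact: L2Z.
by rewrite mulrA -expr2 sqrtrM ?sqr_ge0// sqrtr_sqr.
Qed.

Lemma normL2BC f g : normL2 (fun x => f x - g x) = normL2 (fun x => g x - f x).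
Proof.
by rewrite /normL2; congr Num.sqrt; apply: eq_Rintegral => x _; ring.
Qed.

Lemma eq_ip f f' g g' : (forall x, x \in I01 -> f x = f' x) ->
  (forall x, x \in I01 -> g x = g' x) -> ip f g = ip f' g'.
Proof. by move=> ff gg; apply: eq_Rintegral => x x01; rewrite ff// gg. Qed.

Lemma C0_L2 f : C0_01 f -> L2 f.
Proof.
move=> cf; have mf : measurable_fun I01 f.
  exact: (subspace_continuous_measurable_fun measurable01 cf).
split=> //.
apply: (continuous_compact_integrable (f := fun x => f x ^+ 2)).
  exact: segment_compact.
by move=> x; apply: cvgM; exact: cf.
Qed.

Lemma L2_C0M f g : C0_01 f -> L2 g -> L2 (fun x => f x * g x).
Proof.
move=> cf [mg ig]; have [mf _] := C0_L2 cf.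
have cf2 : {within I01, continuous (fun x => f x ^+ 2)}.
  by move=> x; apply: cvgM; exact: cf.
have [c _ fc] := EVT_max ler01 cf2.
split; first exact: measurable_funM.
apply: (@integrable_dominated _ _ _ (fun x => (f c ^+ 2) * g x ^+ 2)).
- exact: measurable01.
- by apply: measurable_funX; apply: measurable_funM.
- exact: (RintegrableZ (f c ^+ 2) measurable01 ig).
- move=> x x01; rewrite ger0_norm ?sqr_ge0// exprMn ler_wpM2r ?sqr_ge0//.
  exact: fc.
Qed.

End UnitInterval.

(** * One-sided derivatives and weak derivatives *)

Section OneSidedDerivative.
Context {R : realType}.
Local Notation mu := (@lebesgue_measure R).
Implicit Types f g : R -> R.

(** A point at most 1/2 is approached from the right inside [0,1], the others from the left.
    Properness makes the limit defining [deriv01] unique, end points included. *)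
Lemma within01_proper (x : R) : x \in `[0, 1] ->
  ProperFilter (within `[0, 1] x^').
Proof.
rewrite in_itv/= => /andP[x0 x1]; split; last exact: within_filter.
move=> /nbhs_ballP[e /= e0 xe].
set d := Num.min e 1 / 2.
have d0 : 0 < d by rewrite divr_gt0// lt_min e0 ltr01.
have d1 : d <= 1 / 2 by rewrite ler_pM2r ?invr_gt0// ge_min lexx orbT.
have de : d < e.
  apply: (@lt_le_trans _ _ (Num.min e 1)); last by rewrite ge_min lexx.
  by rewrite ltr_pdivrMr// ltr_pMr ?ltr1n// lt_min e0 ltr01.
have [xl|xr] := leP x (1 / 2).
  apply: (xe (x + d)).
  - by rewrite /ball/= opprD addNKr normrN gtr0_norm.
  - by rewrite -subr_eq0 addrAC subrr add0r gt_eqF.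
  - rewrite /= in_itv/=; lra.
apply: (xe (x - d)).
- by rewrite /ball/= opprB addrC subrK gtr0_norm.
- by rewrite -subr_eq0 addrAC subrr add0r oppr_eq0 gt_eqF.
- rewrite /= in_itv/=; lra.
Qed.

Definition is_deriv01 f (x l : R) : Prop :=
  diffq01 f x y @[y --> within `[0, 1] x^'] --> l.

Lemma is_deriv01_derivable f x l : is_deriv01 f x l -> derivable01 f x.
Proof. by move=> H; apply/cvg_ex; exists l. Qed.

Lemma is_deriv01_eq f x l : x \in `[0, 1] -> is_deriv01 f x l -> deriv01 f x = l.
Proof.
move=> x01 H; have := within01_proper x01 => PF.
exact: (cvg_lim (@Rhausdorff R) H).
Qed.

Lemma derivable01_is_deriv01 f x : derivable01 f x -> is_deriv01 f x (deriv01 f x).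
Proof. by []. Qed.

Lemma is_deriv01_lin (a b : R) f g (x l m : R) :
  is_deriv01 f x l -> is_deriv01 g x m ->
  is_deriv01 (fun y => a * f y + b * g y) x (a * l + b * m).
Proof.
move=> Hf Hg; rewrite /is_deriv01.
have -> : diffq01 (fun y => a * f y + b * g y) x =
    (fun y => a * diffq01 f x y + b * diffq01 g x y).
  by apply/funext => y; rewrite /diffq01; ring.
by apply: cvgD; apply: cvgMr.
Qed.

Lemma deriv01_lin (a b : R) f g (x : R) : x \in `[0, 1] -> C1_01 f -> C1_01 g ->
  deriv01 (fun y => a * f y + b * g y) x = a * deriv01 f x + b * deriv01 g x.
Proof.
move=> x01 [df _] [dg _]; apply: is_deriv01_eq => //.
by apply: is_deriv01_lin; [exact: df|exact: dg].
Qed.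

Lemma C0_01P f : C0_01 f <->
  forall x : R, x \in `[0, 1] -> f y @[y --> within `[0, 1] (nbhs x)] --> f x.
Proof. exact: subspace_continuousP. Qed.

Lemma eq_C0_01 f g : (forall x : R, x \in `[0, 1] -> f x = g x) -> C0_01 f -> C0_01 g.
Proof.
move=> fg /C0_01P cf; apply/C0_01P => x x01; rewrite -fg//.
apply: cvg_trans (cf x x01); apply: near_eq_cvg; rewrite near_withinE.
by apply: nearW => y y01; rewrite fg.
Qed.

Lemma C0_01_lin (a b : R) f g : C0_01 f -> C0_01 g ->
  C0_01 (fun y => a * f y + b * g y).
Proof.
move=> cf cg x.
by apply: cvgD; apply: cvgMr; [exact: cf|exact: cg].
Qed.

Lemma C0_01M f g : C0_01 f -> C0_01 g -> C0_01 (fun y => f y * g y).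
Proof. by move=> cf cg x; apply: cvgM; [exact: cf|exact: cg]. Qed.

Lemma C1_01_lin (a b : R) f g : C1_01 f -> C1_01 g ->
  C1_01 (fun y => a * f y + b * g y).
Proof.
move=> Cf Cg; split.
  move=> x x01; apply: is_deriv01_derivable.
  by apply: is_deriv01_lin; [exact: Cf.1|exact: Cg.1].
have := @C0_01_lin a b _ _ Cf.2 Cg.2; apply: eq_C0_01 => x x01.
by rewrite deriv01_lin.
Qed.

Lemma derivable01_cvg f (x : R) : x \in `[0, 1] -> derivable01 f x ->
  f y @[y --> within `[0, 1] (nbhs x)] --> f x.
Proof.
move=> x01 df; have H := derivable01_is_deriv01 df.
have PF := within01_proper x01.
have K : f y @[y --> within `[0, 1] x^'] --> f x.
  have : (diffq01 f x y * (y - x) + f x) @[y --> within `[0, 1] x^'] --> deriv01 f x * (x - x) + f x.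
    apply: cvgD; last exact: cvg_cst.
    apply: cvgM => //; apply: cvgB; last exact: cvg_cst.
    by apply: cvg_within_filter; apply: cvg_within_filter; exact: cvg_id.
  rewrite subrr mulr0 add0r; apply: cvg_trans; apply: near_eq_cvg.
  near=> y; rewrite /diffq01 mulfVK ?subrK// subr_eq0.
  near: y. rewrite near_withinE. near=> y => _. near: y.
  exact: nbhs_dnbhs_neq.
apply/cvgrPdist_le => e e0; move/cvgrPdist_le : K => /(_ e e0).
move=> H1; have {}H1 : \forall t \near nbhs x, t != x -> t \in `[0, 1] -> `|f x - f t| <= e by exact: H1.
rewrite near_withinE; apply: filterS H1 => y H1 y01.
have [->|yx] := eqVneq y x; first by rewrite subrr normr0 ltW.
exact: H1.
Unshelve. all: by end_near. Qed.

Lemma C1_C0_01 f : C1_01 f -> C0_01 f.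
Proof.
by move=> [df _]; apply/C0_01P => x x01; apply: derivable01_cvg => //; exact: df.
Qed.

(** At interior points the restriction to [0,1] is invisible, which opens the way to the fundamental
    theorem of calculus for [derive1]. *)
Lemma derivable01_derive1 f (x : R) : x \in `]0, 1[ -> derivable01 f x ->
  derivable f x 1 /\ derive1 f x = deriv01 f x.
Proof.
move=> x01 df.
have H : (fun h : R => h^-1 *: (f (h *: 1 + x) - f x)) h @[h --> 0^'] --> deriv01 f x.
  have xN : \forall y \near x, y \in `[0, 1].
    by have := near_in_itvoo x01; apply: filterS => y; exact: subset_itv_oo_cc.
  have xN' : diffq01 f x y @[y --> x^'] --> deriv01 f x.
    apply: cvg_trans df => A /= dA; rewrite /nbhs/= in dA *.
    have {}dA : \forall y \near nbhs x, y != x -> y \in `[0, 1] -> A (diffq01 f x y) by exact: dA.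
    change (\forall y \near nbhs x, y != x -> A (diffq01 f x y)).
    by near=> y => yx; apply: (near dA y) => //; near: y; exact: xN.
  have -> : (fun h => h^-1 *: (f (h *: 1 + x) - f x)) = (fun h => diffq01 f x (h + x)).
    by apply/funext => h; rewrite /diffq01 addrK /GRing.scale/= mulr1 mulrC.
  apply/cvgrPdist_le => e e0; move/cvgrPdist_le : xN' => /(_ e e0).
  move=> /nbhs_ballP[d /= d0 H]; apply/nbhs_ballP; exists d => //= h.
  rewrite /ball/= sub0r normrN => hd h0; apply: H.
    by rewrite /ball/= opprD addrCA subrr addr0 normrN.
  by rewrite -subr_eq0 addrK.
split; first by apply/cvg_ex; exists (deriv01 f x).
by rewrite derive1E; exact: (cvg_lim (@Rhausdorff R) H).
Unshelve. all: by end_near. Qed.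

Lemma continuous_subinterval (a b : R) f : 0 <= a -> b <= 1 -> C0_01 f ->
  {within `[a, b], continuous f}.
Proof.
move=> a0 b1; apply: continuous_subspaceW => y /=; rewrite !in_itv/= => /andP[ay yb].
by rewrite (le_trans a0)//= (le_trans yb).
Qed.

Lemma C1_FTC f (x : R) : x \in `[0, 1] -> C1_01 f ->
  f x = f 0 + \int[mu]_(s in `[0, x]) deriv01 f s.
Proof.
rewrite in_itv/= => /andP[x0 x1] Cf.
move: x0; rewrite le_eqVlt => /predU1P[<-|x0].
  by rewrite set_itv1 Rintegral_set1 addr0.
have cf := C1_C0_01 Cf.
have cont := continuous_subinterval (lexx 0) x1 cf.
have sub (y : R) : y \in `]0, x[ -> y \in `]0, 1[.
  by rewrite !in_itv/= => /andP[-> /lt_le_trans ->].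
have sub' (y : R) : y \in `]0, 1[ -> y \in `[0, 1].
  by rewrite !in_itv/= => /andP[/ltW -> /ltW ->].
have d1 (y : R) : y \in `]0, x[ -> derivable f y 1 /\ derive1 f y = deriv01 f y.
  by move=> yx; apply: derivable01_derive1; [exact: sub|apply: Cf.1; apply: sub'; exact: sub].
have := @continuous_FTC2 R (deriv01 f) f 0 x x0.
move=> /(_ (continuous_subinterval (lexx 0) x1 Cf.2)) H.
rewrite /Rintegral H/=.
- ring.
- have /continuous_within_itvP : {within `[0, x], continuous f} by [].
  move=> /(_ x0)[_ ? ?]; split => // y yx.
  exact: (d1 y yx).1.
- by move=> y yx; exact: (d1 y yx).2.
Qed.

Lemma C1_wderiv f : C1_01 f -> is_wderiv f (deriv01 f).
Proof. by move=> Cf; split=> [|x x01]; [exact: C0_L2 Cf.2|exact: C1_FTC]. Qed.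

Lemma wderiv_C0 f g : is_wderiv f g -> C0_01 f.
Proof.
move=> [Lg fE]; have ig : mu.-integrable `[0, 1] (EFin \o g).
  by apply: L2on_integrable Lg => //; exact: mu_itv_lty.
have := parameterized_integral_continuous ler01 ig => cI.
apply: (@eq_C0_01 (fun x => f 0 + \int[mu]_(s in `[0, x]) g s)).
  by move=> x x01; rewrite -fE.
by move=> x; apply: cvgD; [exact: cvg_cst|exact: cI].
Qed.

Lemma L2on_itv (a b : R) f : 0 <= a -> b <= 1 -> L2 f -> L2on `[a, b] f.
Proof.
move=> a0 b1; apply: L2onS => // y /=; rewrite !in_itv/= => /andP[ay yb].
by rewrite (le_trans a0)//= (le_trans yb).
Qed.

Lemma Rintegral_split f (a b c : R) : a <= b <= c ->
  mu.-integrable `[a, c] (EFin \o f) ->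
  \int[mu]_(s in `[a, c]) f s =
  \int[mu]_(s in `[a, b]) f s + \int[mu]_(s in `[b, c]) f s.
Proof.
move=> /andP[ab bc] fi.
have := @Rintegral_itvB R f (BLeft a) (BRight c) b fi.
rewrite !bnd_simp => /(_ ab bc) H.
rewrite [X in _ = _ + X](_ : _ = \int[mu]_(s in `]b, c]) f s).
  by rewrite -H addrC subrK.
rewrite Rintegral_itv_obnd_cbnd//; apply: integrableS fi => //.
by move=> y /=; rewrite !in_itv/= => /andP[/(le_lt_trans ab)/ltW -> ->].
Qed.

(** On the uniform subdivision of [0, x] into n + 1 pieces, the increments of D add up to at most
    the mesh times the total increment of Q, which tends to 0 as n grows. *)
Lemma telescope_zero (D Q : R -> R) (x : R) : 0 <= x ->
  (forall a b : R, 0 <= a -> a <= b -> b <= x ->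
     `|D b - D a| <= (b - a) * (Q b - Q a)) -> D x = D 0.
Proof.
move=> x0 H; apply/eqP; rewrite -subr_eq0 -normr_le0.
have key n : `|D x - D 0| <= x / n.+1%:R * (Q x - Q 0).
  pose t i := x * i%:R / n.+1%:R.
  have -> : D x - D 0 = \sum_(0 <= i < n.+1) (D (t i.+1) - D (t i)).
    by rewrite telescope_sumr// /t mulr0 mul0r mulfK// pnatr_eq0.
  have -> : Q x - Q 0 = \sum_(0 <= i < n.+1) (Q (t i.+1) - Q (t i)).
    by rewrite telescope_sumr// /t mulr0 mul0r mulfK// pnatr_eq0.
  rewrite mulr_sumr; apply: (le_trans (ler_norm_sum _ _ _)).
  rewrite big_nat [leRHS]big_nat; apply: ler_sum => i /andP[_ ni].
  have tS : t i.+1 - t i = x / n.+1%:R.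
    by rewrite /t -mulrBl -mulrBr -natrB ?subSnn ?mulr1.
  have ti : 0 <= t i by rewrite /t divr_ge0 ?mulr_ge0.
  have := H (t i) (t i.+1) ti; rewrite tS; apply.
    by rewrite -subr_ge0 tS divr_ge0.
  by rewrite /t ler_pdivrMr ?ltr0n// ler_wpM2l// ler_nat.
apply/ler_addgt0Pr => e e0; rewrite add0r.
set c := x * (Q x - Q 0) in key *.
have {}key n : `|D x - D 0| <= `|c| / n.+1%:R.
  apply: le_trans (key n) _; rewrite mulrAC ler_wpM2r ?invr_ge0//.
  exact: ler_norm.
apply: le_trans (key (Num.truncn (`|c| / e))) _.
rewrite ler_pdivrMr ?ltr0n// mulrC -ler_pdivrMr// ltW// real_truncnS_gt//.
exact: num_real.
Qed.

Lemma Rintegral_itv_diff f (x y : R) : 0 <= x -> x <= y -> y <= 1 -> L2 f ->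
  \int[mu]_(s in `[0, y]) f s - \int[mu]_(s in `[0, x]) f s =
  \int[mu]_(s in `[x, y]) f s.
Proof.
move=> x0 xy y1 Lf; rewrite (@Rintegral_split f 0 x y); first by rewrite addrAC subrr add0r.
  by rewrite x0 xy.
apply: L2on_integrable => //; first exact: mu_itv_lty.
exact: L2on_itv.
Qed.

Lemma mu_itv (a b : R) : a <= b -> mu `[a, b] = (b - a)%:E.
Proof.
move=> ab; rewrite lebesgue_measure_itv/= lte_fin; case: ltP => [_|ba].
  by rewrite EFinB.
by have -> : b = a by [apply/le_anti; rewrite ba ab]; rewrite subrr.
Qed.

Lemma Rint_subset_le h (a b c d : R) : 0 <= a -> a <= b -> b <= c -> c <= d -> d <= 1 ->
  L2 h -> (forall x, 0 <= h x) ->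
  \int[mu]_(s in `[b, c]) h s <= \int[mu]_(s in `[a, d]) h s.
Proof.
move=> a0 ab bc cd d1 Lh h0.
have I x y : 0 <= x -> y <= 1 -> mu.-integrable `[x, y] (EFin \o h).
  move=> x0 y1; apply: L2on_integrable => //; first exact: mu_itv_lty.
  exact: L2on_itv.
have P x y : 0 <= \int[mu]_(s in `[x, y]) h s by exact: Rintegral_ge0.
rewrite (@Rintegral_split _ a b d) ?ab ?(le_trans bc)//; last exact: I.
rewrite (@Rintegral_split _ b c d) ?bc//; last by apply: I => //; exact: le_trans ab.
by rewrite ler_wpDl// ler_wpDr.
Qed.

(** * The product rule for weak derivatives *)

Section ProductRule.
Context (F f G g : R -> R) (Ff : is_wderiv F f) (Gg : is_wderiv G g).

Let cF : C0_01 F := wderiv_C0 Ff.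
Let cG : C0_01 G := wderiv_C0 Gg.
Let h x := `|f x| + `|g x|.

Let Lf : L2 f := Ff.1.
Let Lg : L2 g := Gg.1.
Let Lh : L2 h.
Proof. by apply: L2D; exact: L2on_norm. Qed.

Lemma L2_product_rule : L2 (fun x => f x * G x + F x * g x).
Proof.
apply: L2D; last exact: L2_C0M.
by under eq_fun do rewrite mulrC; exact: L2_C0M.
Qed.

Let Lfg := L2_product_rule.

Lemma wderiv_diff U u (x y : R) : is_wderiv U u -> 0 <= x -> x <= y -> y <= 1 ->
  U y - U x = \int[mu]_(s in `[x, y]) u s.
Proof.
move=> [Lu UE] x0 xy y1; rewrite -Rintegral_itv_diff// UE ?[U x]UE ?in_itv/=; first ring.
  by rewrite x0 (le_trans xy).
by rewrite y1 (le_trans x0).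
Qed.

Let D x := F x * G x - \int[mu]_(s in `[0, x]) (f s * G s + F s * g s).

Let D_bound (x y : R) : 0 <= x -> x <= y -> y <= 1 ->
  `|D y - D x| <= (y - x) * (\int[mu]_(s in `[0, y]) (h s ^+ 2) -
                             \int[mu]_(s in `[0, x]) (h s ^+ 2)).
Proof.
move=> x0 xy y1.
have mD : measurable (`[x, y]%classic : set R) by exact: measurable_itv.
have I u : L2 u -> mu.-integrable `[x, y] (EFin \o u).
  move=> Lu; apply: L2on_integrable => //; first exact: mu_itv_lty.
  exact: L2on_itv.
have Lhxy : L2on `[x, y] h by exact: L2on_itv.
set A := \int[mu]_(s in `[x, y]) h s.
have h0 s : 0 <= h s by rewrite addr_ge0.
have A0 : 0 <= A by exact: Rintegral_ge0.
have LfGy : L2 (fun s => f s * (G y - G s)).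
  under eq_fun do rewrite mulrBr mulrC [X in _ - X]mulrC.
  by apply: L2B; [exact: L2Z|exact: L2_C0M].
have LgFx : L2 (fun s => g s * (F x - F s)).
  under eq_fun do rewrite mulrBr mulrC [X in _ - X]mulrC.
  by apply: L2B; [exact: L2Z|exact: L2_C0M].
(* The increment of F G is (F y - F x) G y + F x (G y - G x). With both increments written as
   integrals over [x, y], the defect only involves the variations G y - G s and F x - F s. *)
have DE : D y - D x = \int[mu]_(s in `[x, y]) (f s * (G y - G s) + g s * (F x - F s)).
  have -> : D y - D x = (F y - F x) * G y + F x * (G y - G x)
      - \int[mu]_(s in `[x, y]) (f s * G s + F s * g s).
    by rewrite -(Rintegral_itv_diff x0 xy y1 Lfg) /D; ring.
  rewrite (wderiv_diff Ff)// (wderiv_diff Gg)//.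
  rewrite [_ * G y]mulrC -!(RintZ _ mD); [|exact: I..].
  rewrite -RintD -?RintB//.
  - by apply: eq_Rintegral => s _ /=; ring.
  - by apply: I; apply: L2D; exact: L2Z.
  - exact: I.
  - by apply: I; exact: L2Z.
  - by apply: I; exact: L2Z.
have bound U u s : is_wderiv U u -> (forall s, `|u s| <= h s) -> s \in `[x, y] ->
    `|U y - U s| <= A /\ `|U x - U s| <= A.
  move=> Uu uh; rewrite in_itv/= => /andP[xs sy].
  have P a b : x <= a -> a <= b -> b <= y -> `|U b - U a| <= A.
    move=> xa ab yb; have a0 := le_trans x0 xa; have b1 := le_trans yb y1.
    have Lab v : L2 v -> L2on `[a, b] v by exact: L2on_itv.
    have Iab v : L2 v -> mu.-integrable `[a, b] (EFin \o v).
      by move=> Lv; apply: L2on_integrable; [|exact: mu_itv_lty|exact: Lab].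
    rewrite (wderiv_diff Uu)//; apply: (le_trans (le_normr_Rintegral _ _)) => //.
      exact: Iab Uu.1.
    apply: (@le_trans _ _ (\int[mu]_(s in `[a, b]) h s)).
      apply: le_Rintegral => //; last exact: Iab.
      by apply: Iab; apply: L2on_norm => //; exact: Uu.1.
    exact: Rint_subset_le.
  by split; [exact: P|rewrite distrC; exact: P].
have fh s : `|f s| <= h s by rewrite ler_wpDr.
have gh s : `|g s| <= h s by rewrite ler_wpDl.
have step : `|D y - D x| <= A * A.
  rewrite DE; apply: (le_trans (le_normr_Rintegral _ _)) => //.
    by apply: I; exact: L2D.
  rewrite -[X in _ <= X * _]/(\int[mu]_(s in `[x, y]) h s) mulrC -RintZ//; last exact: I.
  apply: le_Rintegral => //.
  - by apply: I; apply: L2on_norm => //; exact: L2D.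
  - by apply: I; exact: L2Z.
  move=> s sxy; have [B1 _] := bound _ _ s Gg gh sxy; have [_ B2] := bound _ _ s Ff fh sxy.
  apply: (le_trans (ler_normD _ _)); rewrite !normrM /h mulrDr mulrC.
  by rewrite lerD// ?ler_wpM2r// mulrC ler_wpM2r.
apply: (le_trans step); rewrite -expr2.
have Lone : L2on `[x, y] (fun=> 1 : R).
  apply: (L2on_itv x0 y1); split; first exact: measurable_cst.
  by apply: Rintegrable_cst => //; exact: mu_itv_lty.
have := Rintegral_CS mD Lone Lhxy.
have -> : \int[mu]_(s in `[x, y]) (1 * h s) = A.
  by apply: eq_Rintegral => s _; rewrite mul1r.
have -> : \int[mu]_(s in `[x, y]) (1 ^+ 2 : R) = y - x.
  rewrite expr1n Rintegral_cst// mul1r.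
  by transitivity (fine (y - x)%:E) => //; congr fine; exact: mu_itv.
have -> : \int[mu]_(s in `[0, y]) (h s ^+ 2) - \int[mu]_(s in `[0, x]) (h s ^+ 2) =
    \int[mu]_(s in `[x, y]) (h s ^+ 2); last by [].
rewrite (@Rintegral_split _ 0 x y); first by rewrite addrAC subrr add0r.
  by rewrite x0 xy.
exact: (L2on_itv (lexx 0) y1 Lh).2.
Qed.

(* The defect of the product rule between x and y is at most the square of the
   integral of |f| + |g| over [x, y], hence at most (y - x) times the integral
   of its square; summing over a subdivision of mesh x / n makes it vanish. *)
Lemma wderivM : is_wderiv (fun x => F x * G x) (fun x => f x * G x + F x * g x).
Proof.
split=> // x; rewrite in_itv/= => /andP[x0 x1].
have : D x = D 0.
  apply: (@telescope_zero D (fun x => \int[mu]_(s in `[0, x]) (h s ^+ 2)) x x0).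
  by move=> a b a0 ab bx; apply: D_bound => //; exact: le_trans x1.
rewrite /D set_itv1 Rintegral_set1 subr0 => <-; ring.
Qed.

End ProductRule.

End OneSidedDerivative.

(** * The Sturm-Liouville form *)

Section SturmLiouvilleForm.
Context {R : realType}.
Context (th1 th2 : R) (p q : R -> R).
Local Notation mu := (@lebesgue_measure R).
Context (hth1 : 0 < th1 <= pi / 2) (hth2 : 0 <= th2 <= pi / 2).
Context (hp : C2_01 p) (hp0 : forall x, x \in `[0, 1] -> 0 < p x).
Context (hq : C0_01 q) (hq0 : forall x, x \in `[0, 1] -> 0 < q x).
Implicit Types f g : R -> R.

Lemma C0_pos_lb f : C0_01 f -> (forall x : R, x \in `[0, 1] -> 0 < f x) ->
  exists2 m : R, 0 < m & forall x : R, x \in `[0, 1] -> m <= f x.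
Proof.
move=> cf f0; have [c c01 fc] := EVT_min ler01 cf.
by exists (f c); [exact: f0|exact: fc].
Qed.

Definition flux f : R -> R := fun x => p x * deriv01 f x.

(** The bilinear form of A with its boundary terms kept: in this shape <A f, g> = [slform f g] for f
    in H^2 and any g of class C^1, whatever the boundary values. This matters for [coefb], which
    does not satisfy the right boundary condition. *)
Definition slform f g : R :=
  ip (flux f) (deriv01 g) + ip (fun x => q x * f x) g
  - flux f 1 * g 1 + flux f 0 * g 0.

(** The regularity at which symmetry, coercivity and the trace bounds of the form are proved;
    stability under linear combinations involves no second derivative. *)
Definition form_dom f : Prop := [/\ C1_01 f, bc_left th1 f = 0 & bc_right th2 f = 0].

Let Cp : C0_01 p := C1_C0_01 hp.1.

Lemma wderiv_spec f g : is_wderiv f g -> is_wderiv f (wderiv f).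
Proof. by move=> fg; apply: (xgetPex (fun=> 0) (P := [set g | is_wderiv f g])); exists g. Qed.

Lemma flux_wderiv f : H2 f -> is_wderiv (flux f) (wderiv (flux f)).
Proof.
move=> [_ [g fg]]; exact: (wderiv_spec (wderivM (C1_wderiv hp.1) fg)).
Qed.

Lemma L2_flux f : C1_01 f -> L2 (flux f).
Proof. by move=> Cf; apply: C0_L2; apply: C0_01M => //; exact: Cf.2. Qed.

Lemma L2_C1 f : C1_01 f -> L2 f.
Proof. by move=> Cf; apply: C0_L2; exact: C1_C0_01. Qed.

Lemma L2_q f : L2 f -> L2 (fun x => q x * f x).
Proof. exact: L2_C0M. Qed.

Lemma opAE f : opA p q f = (fun x => q x * f x - wderiv (flux f) x).
Proof. by apply/funext => x; rewrite /opA addrC. Qed.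

Lemma L2_opA f : H2 f -> L2 (opA p q f).
Proof.
move=> Hf; rewrite opAE; apply: L2B; last exact: (flux_wderiv Hf).1.
by apply: L2_q; apply: L2_C1; exact: Hf.1.
Qed.

(** Integration by parts is the weak product rule for (p f') g, read at x = 1. *)
Lemma flux_by_parts f W g : C1_01 f -> is_wderiv (flux f) W -> C1_01 g ->
  ip W g = flux f 1 * g 1 - flux f 0 * g 0 - ip (flux f) (deriv01 g).
Proof.
move=> Cf Wf Cg; have Wg := C1_wderiv Cg.
have [_ /(_ 1)] := wderivM Wf Wg.
rewrite in_itv/= ler01 lexx => /(_ isT) ->.
rewrite RintD; last 3 first.
- exact: measurable01.
- by apply: integrable_L2M; [exact: Wf.1|exact: L2_C1].
- by apply: integrable_L2M; [exact: L2_flux|exact: Wg.1].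
by rewrite /ip; ring.
Qed.

Lemma flux_form f W g : C1_01 f -> is_wderiv (flux f) W -> C1_01 g ->
  ip W g = ip (fun x => q x * f x) g - slform f g.
Proof. by move=> Cf Wf Cg; rewrite (flux_by_parts Cf Wf Cg) /slform; ring. Qed.

Lemma opA_form f g : H2 f -> C1_01 g -> ip (opA p q f) g = slform f g.
Proof.
move=> Hf Cg; have Wf := flux_wderiv Hf; rewrite opAE ipBl; last 3 first.
- by apply: L2_q; apply: L2_C1; exact: Hf.1.
- exact: Wf.1.
- exact: L2_C1.
by rewrite (flux_form Hf.1 Wf Cg); ring.
Qed.

Lemma domA_form_dom f : domA th1 th2 f -> form_dom f.
Proof. by move=> [[Cf _] [? ?]]. Qed.

Lemma flux_lin (a b : R) f g x : x \in `[0, 1] -> C1_01 f -> C1_01 g ->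
  flux (fun y => a * f y + b * g y) x = a * flux f x + b * flux g x.
Proof. by move=> x01 Cf Cg; rewrite /flux deriv01_lin//; ring. Qed.

Let i0 : (0 : R) \in `[0, 1]. Proof. by rewrite in_itv/= lexx ler01. Qed.
Let i1 : (1 : R) \in `[0, 1]. Proof. by rewrite in_itv/= lexx ler01. Qed.

Lemma form_dom_lin (a b : R) f g : form_dom f -> form_dom g ->
  form_dom (fun y => a * f y + b * g y).
Proof.
move=> [Cf lf rf] [Cg lg rg]; split; first exact: C1_01_lin.
- rewrite /bc_left deriv01_lin//; rewrite /bc_left in lf lg.
  transitivity (a * (cos th1 * f 0 - sin th1 * deriv01 f 0) +
    b * (cos th1 * g 0 - sin th1 * deriv01 g 0)); first ring.
  by rewrite lf lg !mulr0 addr0.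
- rewrite /bc_right deriv01_lin//; rewrite /bc_right in rf rg.
  transitivity (a * (cos th2 * f 1 + sin th2 * deriv01 f 1) +
    b * (cos th2 * g 1 + sin th2 * deriv01 g 1)); first ring.
  by rewrite rf rg !mulr0 addr0.
Qed.

Lemma slform_linl (a b : R) f g h : C1_01 f -> C1_01 g -> C1_01 h ->
  slform (fun y => a * f y + b * g y) h = a * slform f h + b * slform g h.
Proof.
move=> Cf Cg Ch; rewrite /slform !flux_lin//.
have Lh' : L2 (deriv01 h) := C0_L2 Ch.2.
have Lh := L2_C1 Ch; have Lf := L2_C1 Cf; have Lg := L2_C1 Cg.
have Ff := L2_flux Cf; have Fg := L2_flux Cg.
have -> : ip (flux (fun y => a * f y + b * g y)) (deriv01 h) =
    a * ip (flux f) (deriv01 h) + b * ip (flux g) (deriv01 h).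
  rewrite -!ipZl// -ipDl//; [|exact: L2Z..].
  by apply: eq_ip => // x x01; rewrite flux_lin// -inE.
have -> : ip (fun x => q x * (a * f x + b * g x)) h =
    a * ip (fun x => q x * f x) h + b * ip (fun x => q x * g x) h.
  have Lqf := L2_q Lf; have Lqg := L2_q Lg.
  rewrite -!ipZl// -ipDl//; [|exact: L2Z..].
  by apply: eq_ip => // x x01; rewrite mulrDr !(mulrCA (q x)).
move: (ip (flux f) _) (ip (flux g) _) (ip (fun x => q x * f x) h) (ip (fun x => q x * g x) h).
move: (flux f 0) (flux f 1) (flux g 0) (flux g 1) (h 0) (h 1) => *; ring.
Qed.

(** As sin th1 > 0, the derivatives of f and g at 0 are the same multiple of their values there. *)
Lemma bc_left_sym f g : form_dom f -> form_dom g ->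
  flux f 0 * g 0 = flux g 0 * f 0.
Proof.
move=> [_ lf _] [_ lg _]; rewrite /flux -!mulrA; congr (_ * _).
have s0 : sin th1 != 0.
  have /andP[a b] := hth1; rewrite gt_eqF// sin_gt0_pi//.
  by rewrite a/= (le_lt_trans b)// ltr_pdivrMr// mulr_natr mulr2n ltrDr pi_gt0.
apply: (mulfI s0).
by move: lf lg => /eqP; rewrite subr_eq0 mulrA => /eqP <- /eqP; rewrite subr_eq0 mulrA => /eqP <-; ring.
Qed.

(** If sin th2 = 0 the condition is of Dirichlet type and both values at 1 vanish; otherwise the
    argument is the one used at 0. *)
Lemma bc_right_sym f g : form_dom f -> form_dom g ->
  flux f 1 * g 1 = flux g 1 * f 1.
Proof.
move=> [_ _ rf] [_ _ rg]; rewrite /flux -!mulrA; congr (_ * _).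
move: rf rg; rewrite /bc_right => rf rg.
have [s0|s0] := eqVneq (sin th2) 0.
  have c0 : cos th2 != 0 by have := norm_sin_eq1; have := cos2Dsin2 th2; rewrite s0 expr0n/= addr0; case: eqP => // ->; rewrite expr0n/= => /esym/eqP; rewrite oner_eq0.
  move: rf rg => /eqP; rewrite s0 !mul0r !addr0 mulf_eq0 (negPf c0)/= => /eqP -> /eqP.
  by rewrite mulf_eq0 (negPf c0)/= => /eqP ->; rewrite !mulr0.
apply: (mulfI s0).
have -> : sin th2 * (deriv01 f 1 * g 1) = - cos th2 * f 1 * g 1.
  transitivity ((cos th2 * f 1 + sin th2 * deriv01 f 1) * g 1 - cos th2 * f 1 * g 1); first ring.
  by rewrite rf; ring.
transitivity (sin th2 * (deriv01 g 1 * f 1) - (cos th2 * g 1 + sin th2 * deriv01 g 1) * f 1); first ring.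
by rewrite rg; ring.
Qed.

Lemma slform_sym f g : form_dom f -> form_dom g -> slform f g = slform g f.
Proof.
move=> df dg; rewrite /slform (bc_left_sym df dg) (bc_right_sym df dg).
have -> : ip (flux f) (deriv01 g) = ip (flux g) (deriv01 f).
  by apply: eq_Rintegral => x _; rewrite /flux mulrAC.
have -> : ip (fun x => q x * f x) g = ip (fun x => q x * g x) f.
  by apply: eq_Rintegral => x _; rewrite mulrAC.
by [].
Qed.

(** Both angles lie in the first quadrant, so f(0) f'(0) >= 0 and f(1) f'(1) <= 0: each boundary
    term has the favourable sign. *)
Lemma slform_coercive_boundary f : form_dom f ->
  ip (flux f) (deriv01 f) + ip (fun x => q x * f x) f <= slform f f.
Proof.
move=> [_ lf rf]; rewrite /slform -addrA lerDl.
have /andP[a1 b1] := hth1; have /andP[a2 b2] := hth2.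
have pi2 : pi / 2 < pi :> R by rewrite ltr_pdivrMr// mulr_natr mulr2n ltrDr pi_gt0.
have s1 : 0 < sin th1 by rewrite sin_gt0_pi// a1/= (le_lt_trans b1).
have c1 : 0 <= cos th1 by rewrite cos_ge0_pihalf// b1 andbT (le_trans _ (ltW a1))// oppr_le0 divr_ge0// pi_ge0.
have s2 : 0 <= sin th2 by rewrite sin_ge0_pi// a2/= (le_trans b2)// ltW.
have c2 : 0 <= cos th2 by rewrite cos_ge0_pihalf// b2 andbT (le_trans _ a2)// oppr_le0 divr_ge0// pi_ge0.
have F0 : 0 <= flux f 0 * f 0.
  rewrite /flux -mulrA mulr_ge0 ?(ltW (hp0 _))//.
  rewrite -(pmulr_rge0 _ s1) mulrA; move: lf => /eqP; rewrite subr_eq0 => /eqP <-.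
  by rewrite -mulrA -expr2 mulr_ge0// sqr_ge0.
have F1 : flux f 1 * f 1 <= 0.
  rewrite /flux -mulrA pmulr_rle0 ?hp0//; move: rf; rewrite /bc_right => rf.
  move: s2; rewrite le_eqVlt => /predU1P[s0|s2].
    have c0 : cos th2 != 0.
      apply/eqP => c0; have := cos2Dsin2 th2; rewrite -s0 c0 expr0n/= addr0.
      by move/esym/eqP; rewrite oner_eq0.
    move: rf => /eqP; rewrite -s0 mul0r addr0 mulf_eq0 (negPf c0)/= => /eqP ->.
    by rewrite mulr0.
  rewrite -(pmulr_rle0 _ s2) mulrA; move: rf => /eqP; rewrite addrC addr_eq0 => /eqP ->.
  by rewrite mulNr oppr_le0 -mulrA -expr2 mulr_ge0// sqr_ge0.
by rewrite addr_ge0// oppr_ge0.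
Qed.

Lemma ip_weight_ge (w f : R -> R) (m : R) : C0_01 w -> L2 f ->
  (forall x : R, x \in `[0, 1] -> m <= w x) -> m * ip f f <= ip (fun x => w x * f x) f.
Proof.
move=> cw Lf mw; rewrite /ip -RintZ; last 2 first.
- exact: measurable01.
- exact: integrable_L2M.
apply: le_Rintegral; first exact: measurable01.
- apply: RintegrableZ; first exact: measurable01.
  exact: integrable_L2M.
- by apply: integrable_L2M => //; exact: L2_C0M.
move=> x x01; rewrite -mulrA ler_wpM2r ?mw//.
by rewrite -expr2 sqr_ge0.
Qed.

Lemma slform_coercive : exists2 m : R, 0 < m & forall f, form_dom f ->
  m * (ip (deriv01 f) (deriv01 f) + ip f f) <= slform f f.
Proof.
have [mp mp0 pm] := C0_pos_lb Cp hp0; have [mq mq0 qm] := C0_pos_lb hq hq0.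
exists (Num.min mp mq); first by rewrite lt_min mp0.
move=> f df; have [Cf _ _] := df; apply: le_trans (slform_coercive_boundary df).
rewrite mulrDr; apply: lerD.
  apply: (ip_weight_ge Cp (C0_L2 Cf.2)) => x x01.
  by rewrite (le_trans _ (pm x x01))// ge_min lexx.
apply: (ip_weight_ge hq (L2_C1 Cf)) => x x01.
by rewrite (le_trans _ (qm x x01))// ge_min lexx orbT.
Qed.

(** For every x, f(0)^2 is f(x)^2 minus the integral of 2 f f' over [0, x], hence at most f(x)^2 + 2
    |f| |f'|; the average over x in [0,1] gives the claim. The product of norms, rather than a sum
    of squares, is what the growth estimate of the traces relies on. *)
Lemma trace_le f : C1_01 f ->
  f 0 ^+ 2 <= ip f f + 2 * (normL2 f * normL2 (deriv01 f)).
Proof.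
move=> Cf; have Wf := C1_wderiv Cf; have Lf := L2_C1 Cf; have Lf' : L2 (deriv01 f) := C0_L2 Cf.2.
have Lff' : mu.-integrable `[0, 1] (EFin \o (fun x => deriv01 f x * f x + f x * deriv01 f x)).
  by apply: RintegrableD; [exact: measurable01|exact: integrable_L2M..].
set c := normL2 f * normL2 (deriv01 f).
have Labs g : L2 g -> L2 (fun x => `|g x|).
  by move=> Lg; apply: L2on_norm => //; exact: measurable01.
have nabs g : normL2 (fun x => `|g x|) = normL2 g.
  by congr Num.sqrt; apply: eq_Rintegral => x _; rewrite -normrM ger0_norm// -expr2 sqr_ge0.
have norm2 (a b : R) : `|b * a + a * b| <= 2 * (`|a| * `|b|).
  by rewrite (mulrC b) -normrM; have := ler_normD (a * b) (a * b); lra.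
have key (x : R) : x \in `[0, 1] -> f 0 ^+ 2 <= f x * f x + 2 * c.
  move=> x01; have [LM /(_ x x01)] := wderivM Wf Wf; rewrite -expr2 => fx.
  have : `|\int[mu]_(s in `[0, x]) (deriv01 f s * f s + f s * deriv01 f s)| <= 2 * c.
    have /andP[x0 x1] : 0 <= x <= 1 by rewrite in_itv/= in x01.
    apply: (@le_trans _ _ (\int[mu]_(s in `[0, x]) (2 * (`|f s| * `|deriv01 f s|)))).
      apply: (le_trans (le_normr_Rintegral _ _)) => //.
        by apply: L2on_integrable => //; [exact: mu_itv_lty|exact: L2on_itv].
      apply: le_Rintegral => //.
      - apply: L2on_integrable => //; first exact: mu_itv_lty.
        by apply: L2on_norm => //; exact: L2on_itv.
      - apply: RintegrableZ => //; apply: integrableS (integrable_L2M (Labs _ Lf) (Labs _ Lf')) => //.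
        by move=> y /=; rewrite !in_itv/= => /andP[-> /le_trans ->].
    rewrite RintZ//; last first.
      apply: integrableS (integrable_L2M (Labs _ Lf) (Labs _ Lf')) => //.
      by move=> y /=; rewrite !in_itv/= => /andP[-> /le_trans ->].
    rewrite ler_pM2l//; apply: (@le_trans _ _ (ip (fun x => `|f x|) (fun x => `|deriv01 f x|))).
      rewrite /ip (@Rintegral_split _ _ 0 x 1) ?x0//; last exact: integrable_L2M (Labs _ Lf) (Labs _ Lf').
      by rewrite lerDl Rintegral_ge0// => y _; rewrite mulr_ge0.
    apply: (le_trans (ler_norm _)); apply: (le_trans (ip_CS _ _)); [exact: Labs..|].
    by rewrite !nabs.
  rewrite ler_norml => /andP[H _]; move: H fx.
  by move: (\int[mu]_(s in _) _) => J H fx; lra.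
have I1 c' : mu.-integrable `[0, 1] (EFin \o (fun=> c' : R)).
  by apply: Rintegrable_cst; [exact: measurable01|exact: mu_itv_lty].
have Ic c' : \int[mu]_(x in `[0, 1]) (c' : R) = c'.
  rewrite Rintegral_cst; last exact: measurable01.
  by transitivity (c' * fine (1 : \bar R)); [congr (_ * fine _); exact: mu01|rewrite mulr1].
rewrite -[leLHS]Ic -[X in _ + X]Ic -RintD; [|exact: measurable01|exact: integrable_L2M|exact: I1].
apply: le_Rintegral; [exact: measurable01|exact: I1| |exact: key].
by apply: RintegrableD; [exact: measurable01|exact: integrable_L2M|exact: I1].
Qed.

(** The first bound controls the trace by the energy and serves for remainders and for M_phi. The
    second, multiplicative one is sharper on low modes and serves for M_phi'. With m the coercivity
    constant, 2 / m suffices for the first and 2 / sqrt m for the second. *)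
Lemma trace_bounded : exists2 C : R, 0 < C & forall f, form_dom f ->
  f 0 ^+ 2 <= C * slform f f /\
  f 0 ^+ 2 <= ip f f + C * (normL2 f * Num.sqrt (slform f f)).
Proof.
have [m m0 mP] := slform_coercive.
have C0 : 0 < 2 / m + 2 / Num.sqrt m by rewrite addr_gt0// divr_gt0// sqrtr_gt0.
exists (2 / m + 2 / Num.sqrt m) => // f df; have H := mP _ df; have [Cf _ _] := df.
have := trace_le Cf; set a := normL2 f; set b := normL2 (deriv01 f); rewrite -!normL2_sqr -/a => T.
rewrite -!normL2_sqr -/a -/b in H.
have a0 : 0 <= a by exact: normL2_ge0.
have b0 : 0 <= b by exact: normL2_ge0.
have s0 : 0 <= slform f f by apply: le_trans H; rewrite mulr_ge0 ?(ltW m0)// addr_ge0// sqr_ge0.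
have e : 0 <= 2 / Num.sqrt m by rewrite divr_ge0// sqrtr_ge0.
split.
  apply: (@le_trans _ _ (2 / m * slform f f)); last by rewrite ler_wpM2r// lerDl.
  rewrite mulrAC ler_pdivlMr//.
  apply: (@le_trans _ _ ((2 * (a ^+ 2 + b ^+ 2)) * m)); last by nra.
  rewrite ler_pM2r//; nra.
apply: (le_trans T); rewrite lerD2l.
apply: (@le_trans _ _ (2 / Num.sqrt m * (a * Num.sqrt (slform f f)))); last first.
  by rewrite ler_wpM2r ?mulr_ge0 ?sqrtr_ge0// lerDr divr_ge0// ltW.
have bb : Num.sqrt m * b <= Num.sqrt (slform f f).
  have -> : Num.sqrt m * b = Num.sqrt (m * b ^+ 2) by rewrite sqrtrM ?ltW// sqrtr_sqr ger0_norm.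
  by rewrite ler_wsqrtr//; nra.
rewrite -mulrA ler_pM2l// [leRHS]mulrCA ler_wpM2l//.
by rewrite ler_pdivlMl ?sqrtr_gt0.
Qed.

End SturmLiouvilleForm.

(** * Expansions in an orthonormal basis *)

Section HilbertLimits.
Context {R : realType}.
Local Notation mu := (@lebesgue_measure R).
Implicit Types f g : R -> R.

Lemma le_cvg0 {T : Type} {F : set_system T} {FF : Filter F} (u b : T -> R) (l : R) :
  (\forall t \near F, `|u t - l| <= b t) -> b t @[t --> F] --> (0 : R) ->
  u t @[t --> F] --> l.
Proof.
move=> ub b0; apply: (@squeeze_cvgr _ _ FF R (fun t => l - b t) (fun t => l + b t)).
- by apply: filterS ub => t; rewrite ler_norml => /andP[? ?]; apply/andP; split; lra.
- by rewrite -[X in _ --> X]subr0; apply: cvgB => //; exact: cvg_cst.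
- by rewrite -[X in _ --> X]addr0; apply: cvgD => //; exact: cvg_cst.
Qed.

Lemma le_cvg_to (u v : nat -> R) (l m : R) :
  u n @[n --> \oo] --> l -> v n @[n --> \oo] --> m -> (forall n, u n <= v n) -> l <= m.
Proof.
move=> ul vm uv; have H : \forall n \near \oo, u n <= v n by exact: nearW.
exact: (ler_cvg_to ul vm H).
Qed.

Lemma cvg_ip {T : Type} {F : set_system T} {FF : Filter F} (f g : T -> R -> R) f0 g0 :
  (\forall t \near F, L2 (f t)) -> (\forall t \near F, L2 (g t)) -> L2 f0 -> L2 g0 ->
  normL2 (fun x => f t x - f0 x) @[t --> F] --> (0 : R) ->
  normL2 (fun x => g t x - g0 x) @[t --> F] --> (0 : R) ->
  ip (f t) (g t) @[t --> F] --> ip f0 g0.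
Proof.
move=> Lf Lg Lf0 Lg0 cf cg.
pose a t := normL2 (fun x => f t x - f0 x); pose b t := normL2 (fun x => g t x - g0 x).
apply: (@le_cvg0 _ _ _ _ (fun t => a t * (b t + normL2 g0) + normL2 f0 * b t)).
  apply: filterS2 Lf Lg => t Lf Lg.
  have Lff := L2B Lf Lf0; have Lgg := L2B Lg Lg0.
  have -> : ip (f t) (g t) - ip f0 g0 =
      ip (fun x => f t x - f0 x) (g t) + ip f0 (fun x => g t x - g0 x).
    rewrite ipBl// ipBr//; move: (ip _ (g t)) (ip f0 _) (ip _ _) => *; ring.
  apply: (le_trans (ler_normD _ _)); apply: lerD; last exact: ip_CS.
  apply: (le_trans (ip_CS _ _)) => //; apply: ler_wpM2l; first exact: normL2_ge0.
  have := normL2_triangle Lgg Lg0.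
  by under [X in normL2 X]eq_fun do rewrite subrK.
rewrite -[X in _ --> X](_ : 0 * (0 + normL2 g0) + normL2 f0 * 0 = 0); last by ring.
apply: cvgD; apply: cvgM => //; try exact: cvg_cst.
by apply: cvgD => //; exact: cvg_cst.
Qed.

Lemma cvg_normL2 {T : Type} {F : set_system T} {FF : Filter F} (f : T -> R -> R) f0 :
  (\forall t \near F, L2 (f t)) -> L2 f0 ->
  normL2 (fun x => f t x - f0 x) @[t --> F] --> (0 : R) ->
  normL2 (f t) @[t --> F] --> normL2 f0.
Proof.
move=> Lf Lf0 cf; apply: (@le_cvg0 _ _ _ _ (fun t => normL2 (fun x => f t x - f0 x))) => //.
apply: filterS Lf => t Lf; rewrite ler_norml; apply/andP; split.
  have := normL2_triangle (L2B Lf0 Lf) Lf.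
  under [X in normL2 X]eq_fun do rewrite subrK.
  by rewrite normL2BC; lra.
have := normL2_triangle (L2B Lf Lf0) Lf0.
by under [X in normL2 X]eq_fun do rewrite subrK; lra.
Qed.

Lemma cst_cvgL2 {T : Type} {F : set_system T} {FF : Filter F} f :
  normL2 (fun x => f x - f x) @[t --> F] --> (0 : R).
Proof.
rewrite (_ : normL2 _ = 0); first exact: cvg_cst.
by under [X in normL2 X]eq_fun do rewrite subrr; rewrite /normL2 ip0l sqrtr0.
Qed.

Lemma sum_CS (a b : nat -> R) (m n : nat) :
  (\sum_(m <= k < n) a k * b k) ^+ 2 <=
  (\sum_(m <= k < n) a k ^+ 2) * (\sum_(m <= k < n) b k ^+ 2).
Proof.
apply: discriminant_le; [by apply: sumr_ge0 => k _; exact: sqr_ge0..|] => t.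
have -> : \sum_(m <= k < n) a k ^+ 2 - 2 * t * (\sum_(m <= k < n) a k * b k)
   + t ^+ 2 * \sum_(m <= k < n) b k ^+ 2 = \sum_(m <= k < n) (a k - t * b k) ^+ 2.
  rewrite !mulr_sumr -sumrB -big_split/=; apply: eq_bigr => k _; ring.
by apply: sumr_ge0 => k _; exact: sqr_ge0.
Qed.

Lemma ae_eq_ip f f' g : L2 f -> L2 f' -> L2 g ->
  (f = f' %[ae mu in `[0, 1]%classic]) -> ip f g = ip f' g.
Proof.
move=> Lf Lf' Lg ff'; congr fine.
apply: ae_eq_integral.
- exact: measurable01.
- by apply/measurable_EFinP; apply: measurable_funM; [exact: Lf.1|exact: Lg.1].
- by apply/measurable_EFinP; apply: measurable_funM; [exact: Lf'.1|exact: Lg.1].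
have FF : Filter (nbhs (almost_everywhere mu)) := ae_filter_ringOfSetsType mu.
by apply: filterS ff' => x + x01 => /(_ x01) ->.
Qed.

End HilbertLimits.

(** * Parseval identity and spectral tails *)

Section OrthonormalBasis.
Context {R : realType} (phi : nat -> R -> R).
Local Notation mu := (@lebesgue_measure R).
Context (Lphi : forall n, L2 (phi n)).
Context (orth : forall m n, ip (phi m) (phi n) = (m == n)%:R).
Context (compl : forall f, L2 f ->
  L2_series_cvg (fun n x => ip f (phi n) * phi n x) f).
Implicit Types f g : R -> R.

Definition lcomb (c : nat -> R) (n : nat) : R -> R := fun x => \sum_(k < n) c k * phi k x.

Lemma L2_lcomb c n : L2 (lcomb c n).
Proof. by apply: (@L2_sum _ n (fun k x => c k * phi k x)) => k _; exact: L2Z. Qed.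

Lemma ip_lcomb c n g : L2 g -> ip (lcomb c n) g = \sum_(k < n) c k * ip (phi k) g.
Proof.
move=> Lg; rewrite (@ip_suml _ n (fun k x => c k * phi k x))//; last by move=> *; exact: L2Z.
by apply: eq_bigr => k _; rewrite ipZl.
Qed.

Lemma ip_lcomb_phi c n k : ip (lcomb c n) (phi k) = if (k < n)%N then c k else 0.
Proof.
rewrite ip_lcomb//; under eq_bigr do rewrite orth.
case: ifPn => [kn|]; last first.
  rewrite -leqNgt => nk; apply: big1 => i _; rewrite (_ : (i == k :> nat) = false) ?mulr0//.
  by apply/negbTE; rewrite neq_ltn (leq_trans (ltn_ord i)).
rewrite (bigD1 (Ordinal kn))//= eqxx mulr1 big1 ?addr0// => i.
by rewrite -val_eqE/= => /negbTE ->; rewrite mulr0.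
Qed.

(** By Parseval this is the sum of the products of coefficients over k >= N. Subtracting a finite
    sum makes it differentiable in time without exchanging a limit. *)
Definition tail (N : nat) f g : R :=
  ip f g - \sum_(k < N) ip f (phi k) * ip g (phi k).

Lemma parseval f g : L2 f -> L2 g ->
  \sum_(k < n) ip f (phi k) * ip g (phi k) @[n --> \oo] --> ip f g.
Proof.
move=> Lf Lg; have [_ H] := compl Lf.
have Ll n : L2 (lcomb (fun k => ip f (phi k)) n) by exact: L2_lcomb.
have : ip (lcomb (fun k => ip f (phi k)) n) g @[n --> \oo] --> ip f g.
  by apply: (cvg_ip _ _ Lf Lg H (cst_cvgL2 g)); exact: nearW.
apply: cvg_trans; apply: near_eq_cvg; apply: nearW => n.
by rewrite ip_lcomb//; apply: eq_bigr => k _; rewrite (ipC g).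
Qed.

Lemma sum_ord_shift (F : nat -> R) N n : (N <= n)%N ->
  \sum_(N <= k < n) F k = \sum_(k < n) F k - \sum_(k < N) F k.
Proof. by move=> Nn; rewrite -!(big_mkord xpredT F) [X in _ = X - _](@big_cat_nat _ _ _ N 0%N n)//= addrAC subrr add0r. Qed.

Lemma tail_cvg N f g : L2 f -> L2 g ->
  \sum_(N <= k < n) ip f (phi k) * ip g (phi k) @[n --> \oo] --> tail N f g.
Proof.
move=> Lf Lg.
have : (\sum_(k < n) ip f (phi k) * ip g (phi k) - \sum_(k < N) ip f (phi k) * ip g (phi k))
   @[n --> \oo] --> tail N f g by apply: cvgB; [exact: parseval|exact: cvg_cst].
apply: cvg_trans; apply: near_eq_cvg; near=> n; rewrite sum_ord_shift//.
by near: n; exact: nbhs_infty_ge.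
Unshelve. all: by end_near. Qed.

Lemma tail_le N f g f' g' : L2 f -> L2 g -> L2 f' -> L2 g' ->
  (forall k, (N <= k)%N ->
    ip f (phi k) * ip g (phi k) <= ip f' (phi k) * ip g' (phi k)) ->
  tail N f g <= tail N f' g'.
Proof.
move=> Lf Lg Lf' Lg' H;
have c1 := @tail_cvg N _ _ Lf Lg; have c2 := @tail_cvg N _ _ Lf' Lg'.
apply: (le_cvg_to c1 c2) => n; rewrite big_nat [leRHS]big_nat; apply: ler_sum => k /andP[Nk _].
exact: H.
Qed.

Lemma tail_linl N (a b : R) f g h : L2 f -> L2 g -> L2 h ->
  tail N (fun x => a * f x + b * g x) h = a * tail N f h + b * tail N g h.
Proof.
move=> Lf Lg Lh; have La := L2Z a Lf; have Lb := L2Z b Lg.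
rewrite /tail ipDl ?ipZl//.
under eq_bigr do rewrite ipDl// !ipZl// mulrDl -!mulrA.
by rewrite big_split/= -!mulr_sumr; move: (ip f h) (ip g h) => A B; ring.
Qed.

Lemma tailC N f g : tail N f g = tail N g f.
Proof. by rewrite /tail ipC; congr (_ - _); apply: eq_bigr => k _; rewrite mulrC. Qed.

Lemma tail_ge0 N f : L2 f -> 0 <= tail N f f.
Proof.
move=> Lf; have L0 : L2 (fun=> 0 : R) by apply: L2on0; exact: measurable01.
have <- : tail N (fun=> 0) (fun=> 0) = 0.
  by rewrite /tail ip0l big1 ?subrr// => k _; rewrite ip0l mul0r.
by apply: tail_le => // k _; rewrite ip0l mul0r -expr2 sqr_ge0.
Qed.

Lemma tail_young N (a : R) f g : 0 < a -> L2 f -> L2 g ->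
  2 * tail N f g <= a^-1 * tail N f f + a * tail N g g.
Proof.
move=> a0 Lf Lg; have Lfg : L2 (fun x => 1 * f x + - a * g x) by apply: L2D; exact: L2Z.
have := tail_ge0 N Lfg; rewrite tail_linl// (tailC N f) (tailC N g) !tail_linl// (tailC N g f) => H.
move: (tail N f f) (tail N f g) (tail N g g) H => A B C H; rewrite -(ler_pM2l a0).
have -> : a * (a^-1 * A + a * C) = A + a * a * C by field; rewrite gt_eqF.
by move: H; rewrite !mul1r; lra.
Qed.

Lemma tail_lcomb_norm N f : L2 f ->
  ip (fun x => f x - lcomb (fun k => ip f (phi k)) N x)
     (fun x => f x - lcomb (fun k => ip f (phi k)) N x) = tail N f f.
Proof.
move=> Lf; have Ll := L2_lcomb (fun k => ip f (phi k)) N.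
have Lr := L2B Lf Ll.
rewrite ipBl// (ipC f) (ipC (lcomb _ _)) !ipBl// (ipC f (lcomb _ _)).
rewrite !ip_lcomb// /tail.
have -> : \sum_(k < N) ip f (phi k) * ip (phi k) (lcomb (fun k0 => ip f (phi k0)) N) =
    \sum_(k < N) ip f (phi k) * ip f (phi k).
  by apply: eq_bigr => k _; rewrite [ip (phi k) _]ipC ip_lcomb_phi ltn_ord.
have -> : \sum_(k < N) ip f (phi k) * ip (phi k) f = \sum_(k < N) ip f (phi k) * ip f (phi k).
  by apply: eq_bigr => k _; rewrite (ipC _ f).
by move: (ip f f) => A; ring.
Qed.

(* The value of an L^2 series is only defined up to a null set, but its norm is
   determined. *)
Lemma normL2_series_unique (s : nat -> R -> R) h h' :
  (forall n, L2 (s n)) -> L2_series_cvg s h -> L2_series_cvg s h' ->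
  normL2 h = normL2 h'.
Proof.
move=> Ls [Lh ch] [Lh' ch'].
have LS n : L2 (fun x => \sum_(k < n) s k x) by apply: (@L2_sum _ n s).
pose S n x := \sum_(k < n) s k x.
have H : normL2 (S n) @[n --> \oo] --> normL2 h by apply: cvg_normL2 => //; exact: nearW.
have H' : normL2 (S n) @[n --> \oo] --> normL2 h' by apply: cvg_normL2 => //; exact: nearW.
exact: (cvg_unique (@Rhausdorff R) H H').
Qed.

(** [resid] is an arbitrary representative of the sum of a series. The explicit remainder f minus
    its first N modes is another sum of that series, and the norm is the same for both. *)
Lemma normL2_resid N f : L2 f -> normL2 (resid phi N f) ^+ 2 = tail N f f.
Proof.
move=> Lf; have Ll := L2_lcomb (fun k => ip f (phi k)) N.
pose s n x := ip f (phi (N + n)%N) * phi (N + n)%N x.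
have Ls n : L2 (s n) by exact: L2Z.
have Hc : L2_series_cvg s (fun x => f x - lcomb (fun k => ip f (phi k)) N x).
  split; first exact: L2B.
  have [_ H] := compl Lf.
  have : normL2 (fun x => \sum_(k < (n + N)%N) ip f (phi k) * phi k x - f x) @[n --> \oo] --> (0 : R).
    by apply: (cvg_comp (fun n => (n + N)%N) _ (cvg_addnr N) H).
  apply: cvg_trans; apply: near_eq_cvg; apply: nearW => n.
  congr normL2; apply/funext => x; rewrite addnC big_split_ord/= /lcomb /s.
  by move: (\sum_(i < N) _) (\sum_(i < n) _) => A B; ring.
rewrite -tail_lcomb_norm// -normL2_sqr; congr (_ ^+ 2).
apply: (normL2_series_unique Ls) => //.
apply: (xgetPex (fun=> 0) (P := [set f | L2_series_cvg s f])).
by exists (fun x => f x - lcomb (fun k => ip f (phi k)) N x).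
Qed.

Lemma tail_cvg0 f : L2 f -> tail N f f @[N --> \oo] --> (0 : R).
Proof.
move=> Lf; rewrite -[X in _ --> X](subrr (ip f f)); apply: cvgB; first exact: cvg_cst.
exact: parseval.
Qed.

End OrthonormalBasis.

(** * Spectral estimates for the Sturm-Liouville operator *)

Section BoundedSeries.
Context {R : realType}.
Implicit Types (u : nat -> R) (N n : nat).

Lemma nneseries_fine_ge u N n : (forall k, 0 <= u k) ->
  (\sum_(N <= k <oo) (u k)%:E < +oo)%E ->
  \sum_(N <= k < n) u k <= fine (\sum_(N <= k <oo) (u k)%:E)%E.
Proof.
move=> u0 uoo; rewrite -lee_fin fineK; last first.
  by rewrite ge0_fin_numE// nneseries_ge0// => k _ _; rewrite lee_fin.
rewrite -sumEFin; apply: nneseries_lim_ge => k _ _.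
by rewrite lee_fin.
Qed.

Lemma nneseries_bounded u N (C : R) : (forall k, 0 <= u k) ->
  (forall n, \sum_(k < n) u k <= C) ->
  (\sum_(N <= k <oo) (u k)%:E < +oo)%E /\
  0 <= fine (\sum_(N <= k <oo) (u k)%:E)%E <= C.
Proof.
move=> u0 uC.
have s0 : (0 <= \sum_(N <= k <oo) (u k)%:E)%E.
  by rewrite nneseries_ge0// => k _ _; rewrite lee_fin.
have sC : (\sum_(N <= k <oo) (u k)%:E <= C%:E)%E.
  apply: lime_le; first by apply: is_cvg_nneseries => k _ _; rewrite lee_fin.
  apply: nearW => n; rewrite sumEFin lee_fin; apply: le_trans (uC n).
  have [Nn|nN] := leqP N n; last by rewrite big_geq ?sumr_ge0// ltnW.
  by rewrite -(big_mkord xpredT u) [leRHS](@big_cat_nat _ _ _ N 0%N n)//= lerDr sumr_ge0.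
split; first exact: le_lt_trans sC (ltry _).
rewrite fine_ge0//= -lee_fin fineK// ge0_fin_numE//.
exact: le_lt_trans sC (ltry _).
Qed.

End BoundedSeries.

(** * Coefficients, tails and traces on the domain of the operator *)

Section SturmLiouvilleSpectrum.
Context {R : realType}.
Context (th1 th2 : R) (p q : R -> R).
Context (lam : nat -> R) (phi : nat -> R -> R).
Context (hth1 : 0 < th1 <= pi / 2) (hth2 : 0 <= th2 <= pi / 2).
Context (hp : C2_01 p) (hp0 : forall x, x \in `[0, 1] -> 0 < p x).
Context (hq : C0_01 q) (hq0 : forall x, x \in `[0, 1] -> 0 < q x).
Context (heig : sl_eigenbasis th1 th2 p q lam phi).
Implicit Types f g : R -> R.

Local Notation form := (slform p q).
Local Notation fdom := (form_dom th1 th2).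
Local Notation Aop := (opA p q).
Local Notation tl := (tail phi).

Lemma phi_domA n : domA th1 th2 (phi n). Proof. by have [] := eig_pair heig n. Qed.

Lemma phi_form_dom n : fdom (phi n).
Proof. exact: domA_form_dom (phi_domA n). Qed.

Lemma form_dom_C1 f : fdom f -> C1_01 f. Proof. by case. Qed.

Lemma domA_C1 f : domA th1 th2 f -> C1_01 f. Proof. by move=> [[]]. Qed.

Lemma domA_L2 f : domA th1 th2 f -> L2 f.
Proof. by move=> /domA_C1; exact: L2_C1. Qed.

Lemma domA_L2_opA f : domA th1 th2 f -> L2 (Aop f).
Proof. by move=> [Hf _]; exact: L2_opA. Qed.

Lemma phi_L2 n : L2 (phi n). Proof. exact: domA_L2 (phi_domA n). Qed.

Let orth := eig_orthonormal heig.
Let compl := eig_complete heig.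

Lemma lam_gt0 n : 0 < lam n. Proof. exact: (eig_positive heig). Qed.

Lemma lam_le m n : (m <= n)%N -> lam m <= lam n.
Proof.
elim: n => [|n IH]; first by rewrite leqn0 => /eqP ->.
rewrite leq_eqVlt => /predU1P[->//|]; rewrite ltnS => /IH/le_trans; apply.
exact: ltW (eig_increasing heig n).
Qed.

Lemma opA_sym f g : domA th1 th2 f -> domA th1 th2 g -> ip (Aop f) g = ip f (Aop g).
Proof.
move=> df dg; rewrite (ipC f) !opA_form//; [|by case: dg|exact: domA_C1|by case: df|exact: domA_C1].
exact: (slform_sym p q hth1 (domA_form_dom df) (domA_form_dom dg)).
Qed.

Lemma opA_phi f n : L2 f -> ip (Aop (phi n)) f = lam n * ip (phi n) f.
Proof.
move=> Lf; rewrite -ipZl//; last exact: phi_L2.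
apply: ae_eq_ip => //; [exact: domA_L2_opA (phi_domA n)|exact: L2Z (phi_L2 n)|].
by have [] := eig_pair heig n.
Qed.

Lemma opA_coef f n : domA th1 th2 f -> ip (Aop f) (phi n) = lam n * ip f (phi n).
Proof.
move=> df; rewrite opA_sym//; last exact: phi_domA.
by rewrite ipC opA_phi ?(ipC f)//; exact: domA_L2.
Qed.

Lemma slform_phi f n : fdom f -> form (phi n) f = lam n * ip f (phi n).
Proof.
move=> df; rewrite -opA_form//; [|by case: (phi_domA n)|exact: form_dom_C1].
by rewrite opA_phi ?(ipC f)//; apply: L2_C1; exact: form_dom_C1.
Qed.

Lemma lcombS (c : nat -> R) n :
  lcomb phi c n.+1 = (fun x => 1 * lcomb phi c n x + c n * phi n x).
Proof. by apply/funext => x; rewrite /lcomb big_ord_recr/= mul1r. Qed.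

Lemma form_dom0 : fdom (fun=> 0).
Proof.
have := form_dom_lin 0 0 (phi_form_dom 0) (phi_form_dom 0).
by under eq_fun do rewrite !mul0r addr0.
Qed.

Lemma form_dom_lcomb (c : nat -> R) n : fdom (lcomb phi c n).
Proof.
elim: n => [|n IH]; last by rewrite lcombS; apply: form_dom_lin => //; exact: phi_form_dom.
by rewrite (_ : lcomb phi c 0 = fun=> 0); [exact: form_dom0|apply/funext => x; rewrite /lcomb big_ord0].
Qed.

Lemma slform_lcomb (c : nat -> R) n f : fdom f ->
  form (lcomb phi c n) f = \sum_(k < n) c k * (lam k * ip f (phi k)).
Proof.
move=> df; have Cf := form_dom_C1 df; elim: n => [|n IH].
  rewrite big_ord0 (_ : lcomb phi c 0 = fun x => 0 * f x + 0 * f x).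
    by rewrite (slform_linl hp)// !mul0r addr0.
  by apply/funext => x; rewrite /lcomb big_ord0 !mul0r addr0.
rewrite lcombS (slform_linl hp)//; last 2 first.
- exact: form_dom_C1 (form_dom_lcomb c n).
- exact: form_dom_C1 (phi_form_dom n).
by rewrite mul1r IH big_ord_recr/= slform_phi.
Qed.

Lemma slform_lcomb2 (c : nat -> R) n :
  form (lcomb phi c n) (lcomb phi c n) = \sum_(k < n) lam k * c k ^+ 2.
Proof.
rewrite slform_lcomb; last exact: form_dom_lcomb.
apply: eq_bigr => k _; rewrite (ip_lcomb_phi phi_L2 orth) ltn_ord; ring.
Qed.

(** Symmetry of the form turns each cross term into the sum of lam k <f, phi k>^2, so the energy of
    the remainder is the tail of <A f, f>. This allows the trace bound to be applied to the
    remainder itself. *)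
Lemma slform_resid f n : domA th1 th2 f ->
  let r := fun x => 1 * f x + -1 * lcomb phi (fun k => ip f (phi k)) n x in
  fdom r /\ form r r = tl n (Aop f) f.
Proof.
move=> df r; set s := lcomb phi (fun k => ip f (phi k)) n.
have ff := domA_form_dom df; have fs : fdom s by exact: form_dom_lcomb.
have Cf := form_dom_C1 ff; have Cs := form_dom_C1 fs.
have fr : fdom r by exact: form_dom_lin.
have Cr := form_dom_C1 fr; split=> //.
have sf : form s f = \sum_(k < n) lam k * ip f (phi k) ^+ 2.
  by rewrite slform_lcomb//; apply: eq_bigr => k _; ring.
rewrite (slform_linl hp)// (slform_sym p q hth1 ff fr) (slform_sym p q hth1 fs fr).
rewrite !(slform_linl hp)// (slform_sym p q hth1 ff fs) sf slform_lcomb2.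
rewrite -(opA_form hp hq)//; last by case: df.
have -> : tl n (Aop f) f = ip (Aop f) f - \sum_(k < n) lam k * ip f (phi k) ^+ 2.
  by congr (_ - _); apply: eq_bigr => k _; rewrite opA_coef//; ring.
move: (ip _ _) (\sum_(k < n) _) => A B; ring.
Qed.

Lemma trace_tail : exists2 C : R, 0 < C & forall f n, domA th1 th2 f ->
  (f 0 - \sum_(k < n) ip f (phi k) * phi k 0) ^+ 2 <= C * tl n (Aop f) f.
Proof.
have [C C0 CP] := trace_bounded hth1 hth2 hp hp0 hq hq0.
exists C => // f n df; have [fr <-] := slform_resid n df.
have [+ _] := CP _ fr; by rewrite mul1r mulN1r.
Qed.

(** Pointwise convergence at 0 does not follow from convergence in L^2; it holds because the energy
    of the remainder tends to 0 and controls its trace. *)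
Lemma trace_cvg f : domA th1 th2 f ->
  \sum_(k < n) ip f (phi k) * phi k 0 @[n --> \oo] --> f 0.
Proof.
move=> df; have [C C0 CP] := trace_tail.
apply: (@le_cvg0 _ _ _ _ _ (fun n => Num.sqrt (C * tl n (Aop f) f))).
  apply: nearW => n; rewrite -sqrtr_sqr -[X in X ^+ 2]opprB sqrrN.
  by apply: ler_wsqrtr; exact: CP.
rewrite -[X in _ --> X](sqrtr0 R) -[in X in _ --> X](mulr0 C).
apply: cvg_comp; last exact: sqrt_continuous.
apply: cvgM; first exact: cvg_cst.
rewrite -(subrr (ip (Aop f) f)); apply: cvgB; first exact: cvg_cst.
exact: (parseval phi_L2 compl (domA_L2_opA df) (domA_L2 df)).
Qed.

Lemma tail_opA_ge0 f N : domA th1 th2 f -> 0 <= tl N (Aop f) f.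
Proof.
move=> df; have Lf := domA_L2 df; have L0 : L2 (fun=> 0 : R) := L2on0 measurable01.
have <- : tl N (fun=> 0) (fun=> 0) = 0.
  by rewrite /tail ip0l big1 ?subrr// => k _; rewrite ip0l mul0r.
apply: (tail_le phi_L2 compl L0 L0 (domA_L2_opA df) Lf).
move=> k _; rewrite ip0l mul0r opA_coef// -mulrA mulr_ge0 ?(ltW (lam_gt0 k))//.
by rewrite -expr2 sqr_ge0.
Qed.

Lemma tail_lam1 f N : domA th1 th2 f -> lam N * tl N f f <= tl N (Aop f) f.
Proof.
move=> df; have Lf := domA_L2 df; have LA := domA_L2_opA df.
have -> : lam N * tl N f f = tl N (fun x => lam N * f x + 0 * f x) f.
  by rewrite [RHS](tail_linl phi_L2)// mul0r addr0.
apply: (tail_le phi_L2 compl) => //; first by apply: L2D; exact: L2Z.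
have pL2 := phi_L2; move=> k Nk; rewrite opA_coef// ipDl ?ipZl//; try exact: L2Z.
rewrite mul0r addr0 -!mulrA ler_wpM2r ?lam_le//.
by rewrite -expr2 sqr_ge0.
Qed.

Lemma tail_lam2 f N : domA th1 th2 f -> lam N * tl N (Aop f) f <= tl N (Aop f) (Aop f).
Proof.
move=> df; have Lf := domA_L2 df; have LA := domA_L2_opA df.
have -> : lam N * tl N (Aop f) f = tl N (fun x => lam N * Aop f x + 0 * f x) f.
  by rewrite [RHS](tail_linl phi_L2)// mul0r addr0.
apply: (tail_le phi_L2 compl) => //; first by apply: L2D; exact: L2Z.
have pL2 := phi_L2; move=> k Nk; rewrite ipDl ?ipZl//; try exact: L2Z.
rewrite mul0r addr0 !opA_coef//.
rewrite [leRHS](_ : _ = lam k * (lam k * ip f (phi k) ^+ 2)); last ring.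
rewrite [leLHS](_ : _ = lam N * (lam k * ip f (phi k) ^+ 2)); last ring.
by rewrite ler_wpM2r ?lam_le// mulr_ge0 ?sqr_ge0// ltW// lam_gt0.
Qed.

(** Cauchy-Schwarz with weights [om k] separates phi k 0 from the coefficients of f on finite sums,
    which then pass to the limit. The weight lam with c = 1 serves (i); the weight lam^(3/4) with c
    = lam N^(-1/4) serves (ii). *)
Lemma trace_tail_le (om : nat -> R) (M c : R) N f : domA th1 th2 f ->
  (forall k, 0 < om k) -> (forall k, (N <= k)%N -> om k <= c * lam k) -> 0 <= M -> 0 <= c ->
  (forall n, \sum_(N <= k < n) `|phi k 0| ^+ 2 / om k <= M) ->
  (f 0 - \sum_(k < N) ip f (phi k) * phi k 0) ^+ 2 <= M * c * tl N (Aop f) f.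
Proof.
move=> df om0 omc M0 c0 omM; have Lf := domA_L2 df; have LA := domA_L2_opA df.
have c1 : (\sum_(N <= k < n) ip f (phi k) * phi k 0) ^+ 2 @[n --> \oo] -->
    (f 0 - \sum_(k < N) ip f (phi k) * phi k 0) ^+ 2.
  have : (\sum_(k < n) ip f (phi k) * phi k 0 - \sum_(k < N) ip f (phi k) * phi k 0) ^+ 2
      @[n --> \oo] --> (f 0 - \sum_(k < N) ip f (phi k) * phi k 0) ^+ 2.
    by rewrite !expr2; apply: cvgM; apply: cvgB; try exact: trace_cvg; exact: cvg_cst.
  apply: cvg_trans; apply: near_eq_cvg; near=> n.
  rewrite (sum_ord_shift (fun k => ip f (phi k) * phi k 0))//.
  by near: n; exact: nbhs_infty_ge.
have c2 := @tail_cvg _ _ phi_L2 compl N _ _ LA Lf.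
have {}c2 : M * c * \sum_(N <= k < n) ip (Aop f) (phi k) * ip f (phi k) @[n --> \oo] -->
   M * c * tl N (Aop f) f by apply: cvgM => //; exact: cvg_cst.
apply: (le_cvg_to c1 c2) => n.
pose a k := Num.sqrt (om k) * ip f (phi k); pose b k := phi k 0 / Num.sqrt (om k).
have -> : \sum_(N <= k < n) ip f (phi k) * phi k 0 = \sum_(N <= k < n) a k * b k.
  apply: eq_bigr => k _; rewrite /a /b; have : Num.sqrt (om k) != 0 by rewrite gt_eqF// sqrtr_gt0.
  by move=> H; field.
apply: le_trans (sum_CS a b N n) _; rewrite mulrC -mulrA; apply: ler_pM.
- by apply: sumr_ge0 => k _; exact: sqr_ge0.
- by apply: sumr_ge0 => k _; exact: sqr_ge0.
- apply: le_trans (omM n); apply: ler_sum => k _.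
  by rewrite /b exprMn exprVn sqr_sqrtr ?(ltW (om0 k))// real_normK ?num_real.
rewrite mulr_sumr big_nat [leRHS]big_nat; apply: ler_sum => k /andP[Nk _].
rewrite /a exprMn sqr_sqrtr ?(ltW (om0 k))// opA_coef//.
rewrite [leRHS](_ : _ = c * lam k * ip f (phi k) ^+ 2); last ring.
by rewrite ler_wpM2r ?sqr_ge0// omc.
Unshelve. all: by end_near. Qed.

(** Duality: the trace bound is tested on the combination with coefficients phi k 0 / lam k, whose
    value at 0 and whose energy are both the sum S to be bounded, so S^2 <= C S. *)
Lemma sum_trace_lam : exists2 C : R, 0 < C &
  forall n, \sum_(k < n) `|phi k 0| ^+ 2 / lam k <= C.
Proof.
have [C C0 CP] := trace_bounded hth1 hth2 hp hp0 hq hq0.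
exists C => // n; pose c k := phi k 0 / lam k.
have [+ _] := CP _ (form_dom_lcomb c n); rewrite slform_lcomb2.
have -> : lcomb phi c n 0 = \sum_(k < n) `|phi k 0| ^+ 2 / lam k.
  by apply: eq_bigr => k _; rewrite real_normK ?num_real// /c; ring.
have -> : \sum_(k < n) lam k * c k ^+ 2 = \sum_(k < n) `|phi k 0| ^+ 2 / lam k.
  apply: eq_bigr => k _; rewrite real_normK ?num_real// /c.
  by have := lam_gt0 k => /lt0r_neq0 ?; field.
have : 0 <= \sum_(k < n) `|phi k 0| ^+ 2 / lam k.
  by apply: sumr_ge0 => k _; rewrite divr_ge0 ?sqr_ge0// ltW// lam_gt0.
move: (\sum_(k < n) _) => S; rewrite le_eqVlt => /predU1P[<- _|S0]; first exact: ltW.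
by rewrite expr2 ler_pM2r.
Qed.

(** The multiplicative trace bound is tested on the combination with coefficients phi k 0: its value
    at 0 and its squared norm are S, its energy at most lam n S, so S^2 <= S + C S sqrt(lam n). The
    added 1 keeps the partial sums positive for the telescoping that follows and is absorbed because
    lam n >= lam 0 > 0. *)
Lemma sum_trace_sqrt : exists2 C : R, 0 < C &
  forall n, 1 + \sum_(k < n.+1) `|phi k 0| ^+ 2 <= C * Num.sqrt (lam n).
Proof.
have [C C0 CP] := trace_bounded hth1 hth2 hp hp0 hq hq0.
have l0 : 0 < Num.sqrt (lam 0) by rewrite sqrtr_gt0 lam_gt0.
exists (2 / Num.sqrt (lam 0) + C); first by rewrite addr_gt0// divr_gt0.
move=> n; pose c k := phi k 0.
have [_ +] := CP _ (form_dom_lcomb c n.+1); rewrite slform_lcomb2.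
have -> : lcomb phi c n.+1 0 = \sum_(k < n.+1) `|phi k 0| ^+ 2.
  by apply: eq_bigr => k _; rewrite real_normK ?num_real// /c expr2.
have Ell : ip (lcomb phi c n.+1) (lcomb phi c n.+1) = \sum_(k < n.+1) `|phi k 0| ^+ 2.
  rewrite (ip_lcomb phi_L2)//; last exact: L2_lcomb phi_L2 _ _.
  apply: eq_bigr => k _; rewrite [ip (phi k) _]ipC (ip_lcomb_phi phi_L2 orth) ltn_ord.
  by rewrite real_normK ?num_real// /c expr2.
rewrite /normL2 Ell.
have : \sum_(k < n.+1) lam k * c k ^+ 2 <= lam n * \sum_(k < n.+1) `|phi k 0| ^+ 2.
  rewrite mulr_sumr; apply: ler_sum => k _; rewrite real_normK ?num_real//.
  by rewrite ler_wpM2r ?sqr_ge0// lam_le// -ltnS.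
have : 0 <= \sum_(k < n.+1) `|phi k 0| ^+ 2 by apply: sumr_ge0 => k _; exact: sqr_ge0.
move: (\sum_(k < n.+1) lam k * _) (\sum_(k < n.+1) _) => Q S S0 QS H.
have ln : Num.sqrt (lam 0) <= Num.sqrt (lam n) by rewrite ler_wsqrtr// lam_le.
have sn0 : 0 < Num.sqrt (lam n) by exact: lt_le_trans ln.
have one : 1 <= (Num.sqrt (lam 0))^-1 * Num.sqrt (lam n) by rewrite ler_pdivlMl// mulr1.
suff : S <= 1 + C * Num.sqrt (lam n) by rewrite mulrDl; lra.
have : S ^+ 2 <= S * (1 + C * Num.sqrt (lam n)).
  apply: (le_trans H); rewrite mulrDr mulr1 lerD2l [leRHS]mulrCA ler_wpM2l ?(ltW C0)//.
  apply: (@le_trans _ _ (Num.sqrt S * Num.sqrt (lam n * S))).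
    by rewrite ler_wpM2l ?sqrtr_ge0// ler_wsqrtr.
  by rewrite sqrtrM ?(ltW (lam_gt0 n))// mulrCA -expr2 sqr_sqrtr// mulrC.
move: S0; rewrite le_eqVlt => /predU1P[<- _|S0].
  by rewrite addr_ge0// mulr_ge0// ltW.
by rewrite expr2 ler_pM2l.
Qed.

Lemma pow34 (x : R) : 0 < x -> x `^ (3 / 4) = (x `^ (1 / 4)) ^+ 3.
Proof.
move=> x0; rewrite -powR_mulrn ?powR_ge0// -powRrM; congr (_ `^ _); lra.
Qed.

Lemma pow14 (x : R) : 0 < x -> Num.sqrt x = (x `^ (1 / 4)) ^+ 2 /\ x = (x `^ (1 / 4)) ^+ 4.
Proof.
move=> x0; split.
  rewrite -powR12_sqrt ?(ltW x0)// -powR_mulrn ?powR_ge0// -powRrM; congr (_ `^ _); lra.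
rewrite -powR_mulrn ?powR_ge0// -powRrM -[LHS]powRr1 ?(ltW x0)//; congr (_ `^ _); lra.
Qed.

(* The partial sums S_n of 1 + phi_k(0)^2 are O(lam_n^(1/2)), so the n-th term
   is at most a multiple of (S_(n+1) - S_n) / S_(n+1)^(3/2), which telescopes:
   no eigenvalue asymptotics are needed. *)
Lemma sum_trace_lam34 : exists2 C : R, 0 < C &
  forall n, \sum_(k < n) `|phi k 0| ^+ 2 / lam k `^ (3 / 4) <= C.
Proof.
have [C C0 CP] := sum_trace_sqrt.
pose S n := 1 + \sum_(k < n) `|phi k 0| ^+ 2.
have S1 n : 1 <= S n by rewrite /S lerDl sumr_ge0// => k _; exact: sqr_ge0.
have S0 n : 0 < S n by exact: lt_le_trans (S1 n).
pose c := Num.sqrt C; have c0 : 0 < c by rewrite sqrtr_gt0.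
have step n : `|phi n 0| ^+ 2 / lam n `^ (3 / 4) <=
    2 * c ^+ 3 * ((Num.sqrt (S n))^-1 - (Num.sqrt (S n.+1))^-1).
  have l0 := lam_gt0 n; have [sq _] := pow14 l0; rewrite pow34//.
  set s := lam n `^ (1 / 4) in sq *; have s0 : 0 < s by exact: powR_gt0.
  have SS : `|phi n 0| ^+ 2 = S n.+1 - S n by rewrite /S big_ord_recr/=; ring.
  have := CP n; rewrite -/(S n.+1) sq => H.
  set u := Num.sqrt (S n.+1); set v := Num.sqrt (S n).
  have v0 : 0 < v by rewrite sqrtr_gt0.
  have uv : v <= u by rewrite ler_wsqrtr// /S lerD2l big_ord_recr/= lerDl sqr_ge0.
  have u0 : 0 < u by exact: lt_le_trans uv.
  rewrite SS -[S n.+1]sqr_sqrtr ?(ltW (S0 _))// -[S n]sqr_sqrtr ?(ltW (S0 _))// -/u -/v.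
  have us : u <= c * s.
    have -> : c * s = Num.sqrt (C * s ^+ 2) by rewrite sqrtrM ?(ltW C0)// sqrtr_sqr gtr0_norm.
    by rewrite ler_wsqrtr.
  have us3 : u ^+ 3 <= c ^+ 3 * s ^+ 3 by rewrite -exprMn lerXn2r// nnegrE ltW// mulr_gt0.
  rewrite ler_pdivrMr ?exprn_gt0//.
  apply: (@le_trans _ _ (2 * u ^+ 3 * (v^-1 - u^-1))); last first.
    rewrite [leRHS](_ : _ = 2 * (c ^+ 3 * s ^+ 3) * (v^-1 - u^-1)); last ring.
    by rewrite ler_wpM2r ?ler_pM2l// subr_ge0 lef_pV2.
  rewrite (_ : 2 * u ^+ 3 * (v^-1 - u^-1) = (u - v) * (2 * u ^+ 2 / v)); last first.
    by field; rewrite !gt_eqF.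
  (* u + v <= 2 u^2 / v because v <= u. *)
  rewrite subr_sqr ler_wpM2l ?subr_ge0// ler_pdivlMr//; nra.
exists (2 * c ^+ 3); first by rewrite mulr_gt0// exprn_gt0.
move=> n; suff : \sum_(k < n) `|phi k 0| ^+ 2 / lam k `^ (3 / 4) <=
    2 * c ^+ 3 * (1 - (Num.sqrt (S n))^-1).
  move=> /le_trans; apply; rewrite -[X in _ <= X]mulr1; apply: ler_wpM2l.
    by rewrite mulr_ge0// exprn_ge0// ltW.
  by rewrite lerBlDr lerDl invr_ge0 sqrtr_ge0.
elim: n => [|n IH].
  by rewrite big_ord0 /S big_ord0 addr0 sqrtr1 invr1 subrr mulr0.
rewrite big_ord_recr/=; have := step n; move: IH.
move: (\sum_(k < n) _) (_ / lam n `^ (3 / 4)) (Num.sqrt (S n))^-1 (Num.sqrt (S n.+1))^-1.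
by move=> A B x y; rewrite !mulrBr; lra.
Qed.

(** The partial sums of the series have squared norm equal to the sum of lam k <f, phi k>^2 over k <
    n, which is at most <A f, f>. In the branch where the series has no sum, [opA_sqrt] takes its
    default value 0 and the bound holds as well. *)
Lemma normL2_opA_sqrt f : domA th1 th2 f ->
  normL2 (opA_sqrt lam phi f) ^+ 2 <= ip (Aop f) f.
Proof.
move=> df; have Lf := domA_L2 df; have LA := domA_L2_opA df.
have ip0 : 0 <= ip (Aop f) f.
  by have := tail_opA_ge0 0 df; rewrite /tail big_ord0 subr0.
rewrite /opA_sqrt /L2_series.
pose s := fun (n : nat) x => Num.sqrt (lam n) * ip f (phi n) * phi n x.
case: (pselect (exists h, L2_series_cvg s h)) => [[h0 Hh0]|noh]; last first.
  rewrite xgetPN; first by rewrite normL2_sqr ip0l.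
  by move=> h Hh; apply: noh; exists h.
have /= [Lh ch] := xgetPex (fun=> 0) (P := [set h | L2_series_cvg s h]) (ex_intro _ h0 Hh0).
set h := xget _ _ in Lh ch *.
pose S n := lcomb phi (fun k => Num.sqrt (lam k) * ip f (phi k)) n.
have LS n : L2 (S n) by exact: L2_lcomb phi_L2 _ _.
have cS : normL2 (S n) ^+ 2 @[n --> \oo] --> normL2 h ^+ 2.
  have H : normL2 (S n) @[n --> \oo] --> normL2 h by apply: cvg_normL2 => //; exact: nearW.
  by rewrite !expr2; apply: cvgM.
have cc : (fun=> ip (Aop f) f) n @[n --> \oo] --> ip (Aop f) f by exact: cvg_cst.
apply: (le_cvg_to cS cc) => n; rewrite normL2_sqr (ip_lcomb phi_L2)//.
have := tail_opA_ge0 n df; rewrite /tail subr_ge0; apply: le_trans.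
apply: ler_sum => k _; rewrite [ip (phi k) _]ipC (ip_lcomb_phi phi_L2 orth) ltn_ord opA_coef//.
rewrite [leLHS](_ : _ = Num.sqrt (lam k) ^+ 2 * (ip f (phi k) * ip f (phi k))); last ring.
by rewrite sqr_sqrtr ?(ltW (lam_gt0 k))// mulrA.
Qed.

End SturmLiouvilleSpectrum.

(** * The matrix inequality *)

Section QuadraticForms.
Context {R : realType}.

Definition qf n (M : 'M[R]_n) (v : 'cV[R]_n) : R := (v^T *m M *m v) 0 0.
Definition dotv n (u v : 'cV[R]_n) : R := (u^T *m v) 0 0.

Lemma dotvE n (u v : 'cV[R]_n) : dotv u v = \sum_i u i 0 * v i 0.
Proof. by rewrite /dotv mxE; apply: eq_bigr => i _; rewrite mxE. Qed.

Lemma dotvC n (u v : 'cV[R]_n) : dotv u v = dotv v u.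
Proof. by rewrite !dotvE; apply: eq_bigr => i _; rewrite mulrC. Qed.

Lemma dotvDr n (u v w : 'cV[R]_n) : dotv u (v + w) = dotv u v + dotv u w.
Proof. by rewrite /dotv mulmxDr mxE. Qed.

Lemma dotvZr n (a : R) (u v : 'cV[R]_n) : dotv u (a *: v) = a * dotv u v.
Proof. by rewrite /dotv -scalemxAr mxE. Qed.

Lemma dotvv_ge0 n (u : 'cV[R]_n) : 0 <= dotv u u.
Proof. by rewrite dotvE sumr_ge0// => i _; rewrite -expr2 sqr_ge0. Qed.

Lemma dotv_ge0_sqr n (u : 'cV[R]_n) i : u i 0 ^+ 2 <= dotv u u.
Proof.
rewrite dotvE (bigD1 i)//= -expr2 lerDl sumr_ge0// => j _.
by rewrite -expr2 sqr_ge0.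
Qed.

Lemma qfE n (M : 'M[R]_n) v : qf M v = dotv v (M *m v).
Proof. by rewrite /qf /dotv mulmxA. Qed.

Lemma qfD n (M M' : 'M[R]_n) v : qf (M + M') v = qf M v + qf M' v.
Proof. by rewrite !qfE mulmxDl dotvDr. Qed.

Lemma qfZ n (a : R) (M : 'M[R]_n) v : qf (a *: M) v = a * qf M v.
Proof. by rewrite !qfE -scalemxAl dotvZr. Qed.

Lemma dotv_mull n m (M : 'M[R]_(m, n)) u v : dotv u (M *m v) = dotv (M^T *m u) v.
Proof. by rewrite /dotv trmx_mul trmxK mulmxA. Qed.

Lemma dotv_col m n (u1 v1 : 'cV[R]_m) (u2 v2 : 'cV[R]_n) :
  dotv (col_mx u1 u2) (col_mx v1 v2) = dotv u1 v1 + dotv u2 v2.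
Proof. by rewrite /dotv tr_col_mx mul_row_col mxE. Qed.

Lemma dotv1 (u v : 'cV[R]_1) : dotv u v = u 0 0 * v 0 0.
Proof. by rewrite dotvE big_ord1. Qed.

Lemma qf_gram m n (M : 'M[R]_(m, n)) v : qf (M^T *m M) v = dotv (M *m v) (M *m v).
Proof. by rewrite /qf /dotv trmx_mul !mulmxA. Qed.

Lemma dotv_CS n (u v : 'cV[R]_n) : dotv u v ^+ 2 <= dotv u u * dotv v v.
Proof.
apply: discriminant_le; [exact: dotvv_ge0..|] => t.
have -> : dotv u u - 2 * t * dotv u v + t ^+ 2 * dotv v v =
    dotv (u + (- t) *: v) (u + (- t) *: v).
  rewrite dotvDr dotvZr !(dotvC (u + _)) !dotvDr !dotvZr (dotvC v u); ring.
exact: dotvv_ge0.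
Qed.

Lemma qf_CS n (P : 'M[R]_n) u v : P^T = P -> (forall w, 0 <= qf P w) ->
  dotv u (P *m v) ^+ 2 <= qf P u * qf P v.
Proof.
move=> Psym P0; apply: discriminant_le; [exact: P0..|] => t.
have sym x y : dotv x (P *m y) = dotv y (P *m x) by rewrite dotv_mull Psym dotvC.
have -> : qf P u - 2 * t * dotv u (P *m v) + t ^+ 2 * qf P v = qf P (u + (- t) *: v).
  rewrite !qfE mulmxDr dotvDr -scalemxAr dotvZr ![dotv (_ + _) _]dotvC !dotvDr.
  rewrite ![dotv _ (_ *: _)]dotvZr ![dotv (P *m _) _]dotvC (sym v u); ring.
exact: P0.
Qed.

Lemma posdef_ge0 n (P : 'M[R]_n) v : posdefmx P -> 0 <= qf P v.
Proof.
move=> [_ P0]; have [->|/P0/ltW//] := eqVneq v 0.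
by rewrite /qf mulmx0 mxE.
Qed.

Lemma posdef_unit n (P : 'M[R]_n) : posdefmx P -> P \in unitmx.
Proof.
move=> [Psym P0]; rewrite -row_free_unit -kermx_eq0.
apply/eqP/row_matrixP => i; rewrite row0.
apply/eqP; rewrite -[_ == 0]negbK; apply/negP => r0.
set r := row i (kermx P) in r0.
have rP : r *m P = 0 by apply/sub_kermxP; exact: row_sub.
have : 0 < qf P r^T by apply: P0; apply: contraNneq r0 => /(congr1 trmx); rewrite trmxK trmx0 => ->.
by rewrite /qf trmxK rP mul0mx mxE ltxx.
Qed.

(* Cauchy-Schwarz for the inner product of P, applied to v and P^-1 e_i. *)
Lemma posdef_coercive n (P : 'M[R]_n) : posdefmx P ->
  exists2 c : R, 0 < c & forall v, dotv v v <= c * qf P v.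
Proof.
move=> Ppos; have Pu := posdef_unit Ppos; have [Psym P0] := Ppos.
have qP w := posdef_ge0 w Ppos.
pose e i : 'cV[R]_n := invmx P *m delta_mx i 0.
exists (1 + \sum_i qf P (e i)); first by rewrite ltr_pwDl// sumr_ge0.
move=> v; rewrite dotvE mulrDl mul1r.
apply: (@le_trans _ _ ((\sum_i qf P (e i)) * qf P v)); last by rewrite lerDr.
rewrite mulr_suml; apply: ler_sum => i _.
have -> : v i 0 * v i 0 = dotv (e i) (P *m v) ^+ 2.
  rewrite dotv_mull Psym /e mulmxA mulmxV// mul1mx dotvE (bigD1 i)//= mxE !eqxx mul1r.
  rewrite big1 ?addr0// => j ji; by rewrite mxE (negbTE ji) mul0r.
exact: qf_CS.
Qed.

Lemma dotv_bounded m n (M : 'M[R]_(m, n)) : exists2 c : R, 0 < c &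
  forall v, dotv (M *m v) (M *m v) <= c * dotv v v.
Proof.
exists (1 + \sum_i dotv (row i M)^T (row i M)^T).
  by rewrite ltr_pwDl// sumr_ge0// => i _; exact: dotvv_ge0.
move=> v; rewrite mulrDl mul1r.
apply: (@le_trans _ _ ((\sum_i dotv (row i M)^T (row i M)^T) * dotv v v)); last first.
  by rewrite lerDr dotvv_ge0.
rewrite mulr_suml [leLHS]dotvE; apply: ler_sum => i _.
have -> : (M *m v) i 0 * (M *m v) i 0 = dotv (row i M)^T v ^+ 2.
  have -> : (M *m v) i 0 = dotv (row i M)^T v; last by rewrite expr2.
  by rewrite /dotv trmxK -row_mul [RHS]mxE.
exact: dotv_CS.
Qed.

Lemma qf_bounded n (P : 'M[R]_n) : exists2 c : R, 0 < c & forall v, qf P v <= c * dotv v v.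
Proof.
have [c c0 cP] := dotv_bounded P; exists (1 + c); first by rewrite addr_gt0.
move=> v; rewrite qfE; have := dotv_CS v (P *m v); have := cP v; have := dotvv_ge0 v.
set A := dotv v v; set B := dotv (P *m v) (P *m v); set x := dotv v (P *m v) => A0 BA xAB.
have [x0|/ltW x0] := leP x 0; first by rewrite (le_trans x0)// mulr_ge0// addr_ge0// ltW.
rewrite -ler_sqr ?nnegrE ?mulr_ge0 ?addr_ge0 ?(ltW c0)//.
apply: (le_trans xAB); apply: (@le_trans _ _ (A * (c * A))); first by rewrite ler_wpM2l.
rewrite (_ : ((1 + c) * A) ^+ 2 = A * (c * A) + (1 + c + c ^+ 2) * A ^+ 2); last ring.
by rewrite lerDl mulr_ge0 ?sqr_ge0// !addr_ge0 ?sqr_ge0// ltW.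
Qed.

End QuadraticForms.

(** * Scalar budgets for the feasibility of the matrix inequality *)

Section ScalarInequalities.
Context {R : realType}.

(** 2 y c <= (w / a) y^2 + (a / w) c^2, and the first term is at most w X. *)
Lemma young_sq (w a X y c : R) : 0 < w -> 0 < a -> y ^+ 2 <= a * X ->
  2 * (y * c) <= w * X + a / w * c ^+ 2.
Proof.
move=> w0 a0 yX; have := sqr_ge0 (w * y - a * c).
have wa : 0 < (w * a)^-1 by rewrite invr_gt0 mulr_gt0.
move=> /(mulr_ge0 (ltW wa)) H.
have Hy : w / a * y ^+ 2 <= w / a * (a * X) by rewrite ler_pM2l// divr_gt0.
rewrite -subr_ge0; move: H Hy; rewrite -[in X in X -> _ -> _]subr_ge0 subr0.
rewrite (_ : (w * a)^-1 * _ = w / a * y ^+ 2 - 2 * (y * c) + a / w * c ^+ 2); last first.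
  by field; rewrite !lt0r_neq0.
rewrite (_ : w / a * (a * X) = w * X); last by field; exact: lt0r_neq0.
move: (w / a * _) (a / w * _) => *; lra.
Qed.

(** X, E, V, G are the squared norms of the four blocks x, e, v, g of the state. The scalars al, be,
    la, bb stand for the products of x with P_K L, of x with P_K B_0, of e with P_L L and of v with
    B_1; kx, c0, c1 for K x, C_0 e, C_1 g; hx, he, va, ga for the diagonal blocks of the form, and
    qx, qe for the forms of P_K and P_L. *)
Lemma nominal_balance (a1 a2 a3 a4 k2 cB cC ka k eps mu m : R)
    (X E V G al be la bb kx c0 c1 ze ps hx qx he qe va ga del : R) :
  0 < a1 -> 0 < a2 -> 0 < a3 -> 0 < a4 -> 0 < cB -> 0 < cC -> 0 < ka -> 0 < eps -> 0 < mu ->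
  0 < m -> 0 <= E -> 0 <= V -> 0 <= G -> 0 <= X ->
  al ^+ 2 <= a1 * X -> be ^+ 2 <= a2 * X -> la ^+ 2 <= a4 * E -> bb ^+ 2 <= cB * V ->
  kx ^+ 2 <= k2 * X -> c0 ^+ 2 <= a3 * E -> c1 ^+ 2 <= cC * G ->
  2 * hx + 2 * del * qx <= - X -> 2 * he + 2 * del * qe <= - E ->
  va + del * V <= - ka * V -> ga + del * G <= - ka * G ->
  8 * a1 * a3 + 1 <= m / 2 ->
  8 * a1 * cC + 4 * m * a4 * cC + 1 <= 2 * mu * ka ->
  eps * (2 * cB / ka * k ^+ 2 * k2) <= 1 / 8 ->
  2 * (hx + al * (c0 + c1 + ze) + be * ps + m * (he - la * (c1 + ze))
    + eps * (va + k * kx * bb + ps * bb) + mu * ga)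
  + 2 * del * (qx + m * qe + eps * V + mu * G)
  <= - (3 / 8 * X + E + eps * ka * V + G)
    + (8 * a1 + 4 * m * a4) * ze ^+ 2 + (8 * a2 + 2 * eps * cB / ka) * ps ^+ 2.
Proof.
move=> a10 a20 a30 a40 cB0 cC0 ka0 eps0 mu0 m0 E0 V0 G0 X0 alX beX laE bbV kxX c0E c1G Hx He Hv Hg.
move=> mH muH epsH.
(* X is charged 1/8 for each of its four products and 1/8 more through K x, which leaves 3/8. E is
   charged m / 4 twice and 8 a1 a3 through C_0 e, out of m. V is charged eps ka / 2 twice, out of 2
   eps ka. *)
have w8 : 0 < 1 / 8 :> R by rewrite divr_gt0.
have w4 : 0 < 1 / 4 :> R by rewrite divr_gt0.
have wk : 0 < ka / 2 by rewrite divr_gt0.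
have T1 := young_sq c0 w8 a10 alX; have T2 := young_sq c1 w8 a10 alX.
have T3 := young_sq ze w8 a10 alX; have T4 := young_sq ps w8 a20 beX.
have T5 := ler_wpM2l (ltW m0) (young_sq (- c1) w4 a40 laE).
have T6 := ler_wpM2l (ltW m0) (young_sq (- ze) w4 a40 laE).
have T7 := ler_wpM2l (ltW eps0) (young_sq (k * kx) wk cB0 bbV).
have T8 := ler_wpM2l (ltW eps0) (young_sq ps wk cB0 bbV).
have d8 (x : R) : x / (1 / 8) = 8 * x by field.
have d4 (x : R) : x / (1 / 4) = 4 * x by field.
have dk (x : R) : x / (ka / 2) = 2 * x / ka by field; exact: lt0r_neq0.
move: T1 T2 T3 T4 T5 T6 T7 T8; rewrite !d8 !d4 !dk !sqrrN => T1 T2 T3 T4 T5 T6 T7 T8.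
have c0' := ler_wpM2l (ltW a10) c0E; have c1' := ler_wpM2l (ltW a10) c1G.
have c1'' := ler_wpM2l (mulr_ge0 (ltW m0) (ltW a40)) c1G.
have Hk : eps * (2 * cB / ka) * (k * kx) ^+ 2 <= 1 / 8 * X.
  apply: (@le_trans _ _ (eps * (2 * cB / ka) * k ^+ 2 * (k2 * X))).
    rewrite exprMn [leLHS]mulrA; apply: ler_wpM2l => //.
    by rewrite mulr_ge0 ?sqr_ge0// mulr_ge0 ?(ltW eps0)// divr_ge0 ?(ltW ka0)// mulr_ge0// ltW.
  have := ler_wpM2r X0 epsH; by rewrite !mulrA.
have m1 := ler_wpM2r E0 mH; have mu1 := ler_wpM2r G0 muH.
have He' := ler_wpM2l (ltW m0) He.
have Hv' := ler_wpM2l (ltW eps0) Hv; have Hg' := ler_wpM2l (ltW mu0) Hg.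
move: T1 T2 T3 T4 T5 T6 T7 T8 c0' c1' c1'' Hk m1 mu1 He' Hv' Hg' Hx.
move: ka^-1 (k * kx) => ki kk; lra.
Qed.

(** Half of the decay rate et pays for the sector term in dk, the other half for the residuals Ra
    and Rb. In z and s, the coefficient d + 1 leaves a surplus of 1 over the disturbance gain d, of
    which the residuals consume at most 1/2. The factor 1 in [al * 1] is the value of gamma. *)
Lemma feasibility_balance (et d cE k2 al kp dk ta Ra Rb M X z s Q kx e : R) :
  0 <= al -> 0 <= Ra -> 0 <= Rb -> 0 <= X -> 0 <= ta -> 0 <= cE ->
  Q <= - et * X + d * (z ^+ 2 + s ^+ 2) -> kx ^+ 2 <= k2 * X ->
  e ^+ 2 <= cE * (X + z ^+ 2 + s ^+ 2) ->
  ta * dk ^+ 2 * k2 <= et / 2 ->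
  al * kp ^+ 2 * k2 * Ra + al * M ^+ 2 * cE * Rb <= et / 2 ->
  al * Ra + al * M ^+ 2 * cE * Rb <= 1 / 2 ->
  Q + (al * 1 * kp ^+ 2 * Ra + ta * dk ^+ 2) * kx ^+ 2 - (d + 1) * z ^+ 2
    + (al * 1 * Ra - (d + 1)) * s ^+ 2 + al * 1 * Rb * M ^+ 2 * e ^+ 2 <= 0.
Proof.
move=> al0 Ra0 Rb0 X0 ta0 cE0 HQ Hk He Hd H1 H2.
have p1 : 0 <= al * 1 * kp ^+ 2 * Ra + ta * dk ^+ 2.
  have k0 := mulr_ge0 (mulr_ge0 al0 (sqr_ge0 kp)) Ra0; have d0 := mulr_ge0 ta0 (sqr_ge0 dk).
  by rewrite mulr1; exact: addr_ge0.
have p2 : 0 <= al * 1 * Rb * M ^+ 2.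
  by rewrite mulr1; exact: mulr_ge0 (mulr_ge0 al0 Rb0) (sqr_ge0 M).
have T1 := ler_wpM2l p1 Hk; have T2 := ler_wpM2l p2 He.
have T3 := ler_wpM2r X0 (lerD Hd H1).
have z0 := sqr_ge0 z; have s0 := sqr_ge0 s.
have p3 : 0 <= al * Ra by rewrite mulr_ge0.
have H3 : al * M ^+ 2 * cE * Rb <= 1 / 2 by lra.
have T4 := ler_wpM2r z0 H3; have T5 := ler_wpM2r s0 H2.
move: HQ T1 T2 T3 T4 T5 z0 s0; rewrite !mulr1.
move: (z ^+ 2) (s ^+ 2) (kx ^+ 2) (e ^+ 2) (kp ^+ 2) (M ^+ 2) (dk ^+ 2) => *; lra.
Qed.

End ScalarInequalities.

(** * The matrix inequality in block coordinates *)

Section LMI.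
Context {R : realType}.
Context (th2 : R) (p qt : R -> R) (qc : R) (lam : nat -> R) (phi : nat -> R -> R).
Context (N0 N : nat) (kphi dkphi Mphi : R) (K : 'rV[R]_N0) (L : 'cV[R]_N0) (delta : R).

Local Notation F := (matF th2 p qt qc lam phi N kphi K L).
Local Notation cL := (calL N L).
Local Notation cLpsi := (calLpsi th2 p qt qc lam phi N0 N).
Local Notation Kt := (Ktilde N K).
Local Notation Em := (matE th2 p qt qc lam phi N kphi K L).
Local Notation T1 := (Theta1 th2 p qt qc lam phi kphi dkphi Mphi K L delta).

Definition ext_vec (X : 'cV[R]_(dimF N0 N)) (z s : R) : 'cV[R]_(dimF N0 N + 1 + 1) :=
  col_mx (col_mx X z%:M) s%:M.

Lemma scal_mx00 (a : R) : (a%:M : 'M[R]_1) 0 0 = a.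
Proof. by rewrite mxE eqxx. Qed.

Lemma mul_scal_cV n (u : 'cV[R]_n) (a : R) : u *m (a%:M : 'M[R]_1) = a *: u.
Proof. by rewrite mul_mx_scalar. Qed.

Lemma Theta1_sym (P : 'M[R]_(dimF N0 N)) (al be ga ta : R) : P^T = P -> (T1 P al be ga ta)^T = T1 P al be ga ta.
Proof.
move=> Psym; rewrite /Theta1 linearD/= linearZ/= trmx_mul trmxK; congr (_ + _).
rewrite tr_block_mx tr_block_mx tr_col_mx tr_row_mx !trmx_mul trmxK !trmx0 !tr_scalar_mx Psym.
rewrite !trmxK; congr (block_mx (block_mx _ _ _ _) _ _ _).
rewrite /Theta11 !linearD/= !linearZ/= !trmx_mul !trmxK Psym.
by rewrite [in RHS](addrC (F^T *m P)).
Qed.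

(** The first term is the derivative of <X, P X> along X' = F X + z [calL] + s [calLpsi], which is
    how the matrix inequality enters the Lyapunov argument. *)
Lemma Theta1_quad (P : 'M[R]_(dimF N0 N)) (al be ga ta : R) X (z s : R) : P^T = P ->
  qf (T1 P al be ga ta) (ext_vec X z s) =
  2 * dotv X (P *m (F *m X + z *: cL + s *: cLpsi)) + 2 * delta * qf P X
  + (al * ga * kphi ^+ 2 * normL2 (resid phi N (coefa th2 p qt)) ^+ 2 + ta * dkphi ^+ 2)
    * (Kt *m X) 0 0 ^+ 2
  - be * z ^+ 2 + (al * ga * normL2 (resid phi N (coefa th2 p qt)) ^+ 2 - ta) * s ^+ 2
  + al * ga * normL2 (resid phi N (coefb th2)) ^+ 2 * Mphi ^+ 2
    * (Em *m ext_vec X z s) 0 0 ^+ 2.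
Proof.
move=> Psym; rewrite /Theta1 qfD qfZ qf_gram dotv1 -expr2.
rewrite {1}qfE /ext_vec mul_block_col mul_block_col mul_col_mx mul0mx mul_row_col mul0mx addr0.
rewrite add_col_mx addr0 !dotv_col !dotv1 !scal_mx00.
have E1 u : (u^T *m P *m X) 0 0 = dotv X (P *m u).
  by rewrite -mulmxA -/(dotv u (P *m X)) dotv_mull Psym dotvC.
have E2 (A B : 'M[R]_1) : (A + B) 0 0 = A 0 0 + B 0 0 by rewrite mxE.
have E3 (a b : R) : (b *: a%:M : 'M[R]_1) 0 0 = b * a by rewrite mxE scal_mx00.
rewrite !mul_scal_cV !E2 !E1 !E3 !mulmxDr -!scalemxAr !dotvDr !dotvZr -qfE.
rewrite /Theta11 !qfD !qfZ qf_gram dotv1 -expr2.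
have -> : qf (F^T *m P) X = dotv X (P *m (F *m X)).
  by rewrite qfE -mulmxA dotv_mull trmxK dotv_mull Psym dotvC.
have -> : qf (P *m F) X = dotv X (P *m (F *m X)) by rewrite qfE mulmxA.
move: (dotv X (P *m (F *m X))) (dotv X (P *m cL)) (dotv X (P *m cLpsi)) (qf P X).
move: ((Kt *m X) 0 0) ((Em *m col_mx (col_mx X z%:M) s%:M) 0 0).
generalize (normL2 (resid phi N (coefa th2 p qt))) (normL2 (resid phi N (coefb th2))).
by move=> *; ring.
Qed.

Lemma Theta1_quad_tail (P : 'M[R]_(dimF N0 N)) (al be ga ta Ra Rb : R) X (z s : R) :
  P^T = P -> normL2 (resid phi N (coefa th2 p qt)) ^+ 2 = Ra ->
  normL2 (resid phi N (coefb th2)) ^+ 2 = Rb ->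
  qf (T1 P al be ga ta) (ext_vec X z s) =
  2 * dotv X (P *m (F *m X + z *: cL + s *: cLpsi)) + 2 * delta * qf P X
  + (al * ga * kphi ^+ 2 * Ra + ta * dkphi ^+ 2) * (Kt *m X) 0 0 ^+ 2
  - be * z ^+ 2 + (al * ga * Ra - ta) * s ^+ 2
  + al * ga * Rb * Mphi ^+ 2 * (Em *m ext_vec X z s) 0 0 ^+ 2.
Proof. by move=> Psym <- <-; exact: Theta1_quad. Qed.

Local Notation A1' := (A1 qc lam N0 N).
Local Notation B0' := (B0 th2 p qt qc lam phi N0).
Local Notation B1' := (B1 th2 p qt qc lam phi N0 N).
Local Notation C0' := (C0 phi N0).
Local Notation C1' := (C1 lam phi N0 N).
Local Notation H := (A0 qc lam N0 + kphi *: (B0' *m K)).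
Local Notation G := (A0 qc lam N0 - L *m C0').

Lemma mulmx_rank1 m n (a : 'cV[R]_m) (r : 'rV[R]_n) (v : 'cV[R]_n) i :
  (a *m r *m v) i 0 = a i 0 * (r *m v) 0 0.
Proof. by rewrite -mulmxA mxE big_ord1. Qed.

(** The blocks are the low observer modes, the low errors, the rescaled high observer modes and the
    rescaled high errors. *)
Definition blk (x e : 'cV[R]_N0) (v g : 'cV[R]_(N - N0)) : 'cV[R]_(dimF N0 N) :=
  col_mx (col_mx x e) (col_mx v g).

Lemma blk_onto X : exists x e v g, X = blk x e v g.
Proof.
exists (usubmx (usubmx X)), (dsubmx (usubmx X)), (usubmx (dsubmx X)), (dsubmx (dsubmx X)).
by rewrite /blk !vsubmxK.
Qed.

Lemma rank1_mul n k (u : 'cV[R]_n) (r : 'rV[R]_k) v : u *m r *m v = (r *m v) 0 0 *: u.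
Proof.
by apply/matrixP => i j; rewrite ord1 mulmx_rank1 [RHS]mxE mulrC.
Qed.

Lemma dotv_blk x e v g x' e' v' g' : dotv (blk x e v g) (blk x' e' v' g') =
  dotv x x' + dotv e e' + (dotv v v' + dotv g g').
Proof. by rewrite /blk !dotv_col. Qed.

Lemma matF_blk x e v g ze ps : F *m blk x e v g + ze *: cL + ps *: cLpsi = blk
  (H *m x + ((C0' *m e) 0 0 + (C1' *m g) 0 0 + ze) *: L + ps *: B0')
  (G *m e - ((C1' *m g) 0 0 + ze) *: L)
  (A1' *m v + (kphi * (K *m x) 0 0 + ps) *: B1')
  (A1' *m g).
Proof.
rewrite /matF /blk /calL /calLpsi !scale_col_mx !mul_block_col !add_col_mx !scaler0.
rewrite !mul0mx !addr0 !add0r scalerN mulNmx -scalemxAl !rank1_mul !scalerDl scalerA opprD.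
congr (col_mx (col_mx _ _) (col_mx _ _)); last first.
  by rewrite [_ *: _ + A1' *m v]addrC addrA.
  by rewrite !addrA.
by rewrite !addrA.
Qed.

(** The right-hand side is K applied to the first block of [matF_blk]: along a trajectory, E yields
    the derivative of the input u. *)
Lemma matE_blk x e v g ze ps : (Em *m ext_vec (blk x e v g) ze ps) 0 0 =
  (K *m (H *m x)) 0 0 + (K *m L) 0 0 * ((C0' *m e) 0 0 + (C1' *m g) 0 0 + ze)
  + (K *m B0') 0 0 * ps.
Proof.
have E2 (A B : 'M[R]_1) : (A + B) 0 0 = A 0 0 + B 0 0 by rewrite mxE.
have E3 (a : R) (A : 'M[R]_1) : (a *: A) 0 0 = a * A 0 0 by rewrite mxE.
have -> : (Em *m ext_vec (blk x e v g) ze ps) 0 0 =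
    (K *m (H *m x + L *m C0' *m e + L *m C1' *m g + ze *: L + ps *: B0')) 0 0.
  rewrite /matE /ext_vec -(mulmxA K); congr ((K *m _) 0 0).
  by rewrite /blk !mul_row_col !mul0mx !add0r !mul_scal_cV -!addrA.
rewrite !rank1_mul !mulmxDr -!scalemxAr !E2 !E3.
by move: ((C0' *m _) 0 0) ((C1' *m _) 0 0) ((K *m L) 0 0) ((K *m B0') 0 0) ((K *m (_ *m x)) 0 0) => *; ring.
Qed.

Lemma Ktilde_blk x e v g : Kt *m blk x e v g = K *m x.
Proof. by rewrite /Ktilde /blk !mul_row_col !mul0mx !addr0. Qed.

Definition blkP (PK PL : 'M[R]_N0) (m eps mu : R) : 'M[R]_(dimF N0 N) :=
  block_mx (block_mx PK 0 0 (m *: PL)) 0 0 (block_mx eps%:M 0 0 mu%:M).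

Lemma blkP_mul PK PL m eps mu x e v g : blkP PK PL m eps mu *m blk x e v g =
  blk (PK *m x) (m *: (PL *m e)) (eps *: v) (mu *: g).
Proof.
rewrite /blkP /blk !mul_block_col !mul0mx !addr0 !add0r !mul_scalar_mx.
by rewrite scalemxAl.
Qed.

Lemma blkP_sym PK PL m eps mu : PK^T = PK -> PL^T = PL ->
  (blkP PK PL m eps mu)^T = blkP PK PL m eps mu.
Proof.
by move=> sK sL; rewrite /blkP !tr_block_mx !trmx0 linearZ/= sK sL !tr_scalar_mx.
Qed.

Lemma blkP_qf PK PL m eps mu x e v g : qf (blkP PK PL m eps mu) (blk x e v g) =
  qf PK x + m * qf PL e + eps * dotv v v + mu * dotv g g.
Proof. by rewrite qfE blkP_mul dotv_blk !dotvZr -!qfE addrA. Qed.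

Lemma dotv_gt0 n (v : 'cV[R]_n) : v != 0 -> 0 < dotv v v.
Proof.
move=> v0; rewrite lt0r dotvv_ge0 andbT; apply: contra_neq v0 => v0.
apply/matrixP => i j; rewrite ord1 mxE; apply/eqP; rewrite -sqrf_eq0 eq_le sqr_ge0 andbT.
by rewrite -v0 dotv_ge0_sqr.
Qed.

Lemma blkP_posdef PK PL m eps mu : posdefmx PK -> posdefmx PL -> 0 < m -> 0 < eps -> 0 < mu ->
  posdefmx (blkP PK PL m eps mu).
Proof.
move=> pK pL m0 e0 mu0; split; first exact: blkP_sym pK.1 pL.1.
move=> X X0; rewrite -/(qf _ X).
have [cK cK0 HK] := posdef_coercive pK; have [cL cL0 HL] := posdef_coercive pL.
have := dotv_gt0 X0; have [x [e [v [g ->]]]] := blk_onto X; rewrite blkP_qf dotv_blk.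
have := HK x; have := HL e; have := posdef_ge0 x pK; have := posdef_ge0 e pL.
have := dotvv_ge0 v; have := dotvv_ge0 g.
move: (dotv x x) (dotv e e) (dotv v v) (dotv g g) (qf PK x) (qf PL e) => X1 E1 V1 G1 Q1 Q2.
move=> G10 V10 Q20 Q10 E1Q X1Q pos.
rewrite lt0r !addr_ge0// ?mulr_ge0// ?(ltW m0) ?(ltW e0) ?(ltW mu0)// andbT.
apply: contraTneq pos => /eqP; rewrite !paddr_eq0 ?addr_ge0 ?mulr_ge0// ?(ltW m0) ?(ltW e0) ?(ltW mu0)//.
rewrite !mulf_eq0 (gt_eqF m0) (gt_eqF e0) (gt_eqF mu0)/= => /andP[/andP[/andP[/eqP q1 /eqP q2] /eqP ->] /eqP ->].
by move: E1Q X1Q; rewrite q1 q2 !mulr0 addr0 addr0 -leNgt => E1Q X1Q; rewrite -(addr0 0) lerD.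
Qed.

Lemma qf_A1 (ka : R) w : (forall i : 'I_(N - N0), - lam (N0 + i)%N + qc + delta <= - ka) ->
  dotv w (A1' *m w) + delta * dotv w w <= - ka * dotv w w.
Proof.
move=> h; rewrite !dotvE !mulr_sumr -big_split/=; apply: ler_sum => i _.
rewrite mul_diag_mx !mxE; have := ler_wpM2r (sqr_ge0 (w i 0)) (h i); rewrite expr2; lra.
Qed.

Lemma dotv_sqr_bounded n (w : 'cV[R]_n) : exists2 a : R, 0 < a &
  forall v, dotv v w ^+ 2 <= a * dotv v v.
Proof.
exists (dotv w w + 1) => [|v]; first by rewrite ltr_wpDl ?dotvv_ge0.
by rewrite dotvC; apply: (le_trans (dotv_CS _ _)); rewrite ler_wpM2r ?dotvv_ge0// lerDl.
Qed.

Lemma row_mul_bounded n (r : 'rV[R]_n) : exists2 a : R, 0 < a &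
  forall v, (r *m v) 0 0 ^+ 2 <= a * dotv v v.
Proof.
have [a a0 ra] := dotv_sqr_bounded r^T; exists a => // v.
by have := ra v; rewrite dotvC {1}/dotv trmxK.
Qed.

(** The factor 5 comes from squaring a sum of five terms. The constant sees the modes beyond N0 only
    through cC. *)
Lemma matE_bounded (h1 a3 cC : R) : 0 <= h1 -> 0 <= a3 -> 0 <= cC ->
  (forall x, (K *m H *m x) 0 0 ^+ 2 <= h1 * dotv x x) ->
  (forall e, (C0' *m e) 0 0 ^+ 2 <= a3 * dotv e e) ->
  (forall g, (C1' *m g) 0 0 ^+ 2 <= cC * dotv g g) ->
  forall x e v g ze ps, (Em *m ext_vec (blk x e v g) ze ps) 0 0 ^+ 2 <=
  5 * (h1 + (K *m L) 0 0 ^+ 2 * (a3 + cC + 1) + (K *m B0') 0 0 ^+ 2)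
    * (dotv (blk x e v g) (blk x e v g) + ze ^+ 2 + ps ^+ 2).
Proof.
move=> h10 a30 cC0 hh ha hC x e v g ze ps; rewrite matE_blk (mulmxA K) dotv_blk.
have := hh x; have := ha e; have := hC g.
have := dotvv_ge0 x; have := dotvv_ge0 e; have := dotvv_ge0 v; have := dotvv_ge0 g.
move: ((K *m L) 0 0) ((K *m B0') 0 0) => kl kb.
move: ((K *m H *m x) 0 0) ((C0' *m e) 0 0) ((C1' *m g) 0 0) => s r t.
move: (dotv x x) (dotv e e) (dotv v v) (dotv g g) => X2 E2 V2 G2 G0 V0 E0 X0 ht hr hs.
have l0 := sqr_ge0 kl; have b0 := sqr_ge0 kb; have z0 := sqr_ge0 ze; have s0 := sqr_ge0 ps.
have lr := ler_wpM2l l0 hr; have lt' := ler_wpM2l l0 ht.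
have F5 : (s + kl * (r + t + ze) + kb * ps) ^+ 2 <=
    5 * (s ^+ 2 + kl ^+ 2 * r ^+ 2 + kl ^+ 2 * t ^+ 2 + kl ^+ 2 * ze ^+ 2 + kb ^+ 2 * ps ^+ 2).
  rewrite -!exprMn !mulrDr.
  have q5 (a b c' d' f : R) : (a + (b + c' + d') + f) ^+ 2 <=
      5 * (a ^+ 2 + b ^+ 2 + c' ^+ 2 + d' ^+ 2 + f ^+ 2).
    rewrite -subr_ge0 [X in 0 <= X](_ : _ = (a - b) ^+ 2 + (a - c') ^+ 2 + (a - d') ^+ 2
      + (a - f) ^+ 2 + (b - c') ^+ 2 + (b - d') ^+ 2 + (b - f) ^+ 2 + (c' - d') ^+ 2
      + (c' - f) ^+ 2 + (d' - f) ^+ 2); last ring.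
    by rewrite !addr_ge0// sqr_ge0.
  by have := q5 s (kl * r) (kl * t) (kl * ze) (kb * ps); rewrite !mulrDr.
apply: (le_trans F5); rewrite -[leRHS]mulrA ler_pM2l//.
apply: (@le_trans _ _ (h1 * X2 + kl ^+ 2 * (a3 * E2) + kl ^+ 2 * (cC * G2) + kl ^+ 2 * ze ^+ 2
  + kb ^+ 2 * ps ^+ 2)); first by rewrite !lerD.
rewrite -subr_ge0; move: l0 b0 z0 s0; move: (kl ^+ 2) (kb ^+ 2) (ze ^+ 2) (ps ^+ 2).
move=> l b z w l0 b0 z0 w0; rewrite [X in 0 <= X](_ : _ = h1 * (E2 + V2 + G2 + z + w)
  + l * a3 * (X2 + V2 + G2 + z + w) + l * cC * (X2 + E2 + V2 + z + w)
  + l * (X2 + E2 + V2 + G2 + w) + b * (X2 + E2 + V2 + G2 + z)); last ring.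
by rewrite !addr_ge0// !mulr_ge0// !addr_ge0.
Qed.

(* The cross terms are absorbed by taking m, then mu, large and eps small; none
   of the constants refers to N. *)
Lemma nominal_form (PK PL : 'M[R]_N0) (a1 a2 a3 a4 k2 cB cC ka eps mu m : R) :
  0 < a1 -> 0 < a2 -> 0 < a3 -> 0 < a4 -> 0 < cB -> 0 < cC -> 0 < ka -> 0 < eps -> 0 < mu ->
  0 < m ->
  (forall x, dotv x (PK *m L) ^+ 2 <= a1 * dotv x x) ->
  (forall x, dotv x (PK *m B0') ^+ 2 <= a2 * dotv x x) ->
  (forall x, dotv x (PL *m L) ^+ 2 <= a4 * dotv x x) ->
  (forall x, (K *m x) 0 0 ^+ 2 <= k2 * dotv x x) ->
  (forall e, (C0' *m e) 0 0 ^+ 2 <= a3 * dotv e e) ->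
  (forall v, dotv v B1' ^+ 2 <= cB * dotv v v) ->
  (forall g, (C1' *m g) 0 0 ^+ 2 <= cC * dotv g g) ->
  (forall x, 2 * dotv x (PK *m (H *m x)) + 2 * delta * qf PK x <= - dotv x x) ->
  (forall e, 2 * dotv e (PL *m (G *m e)) + 2 * delta * qf PL e <= - dotv e e) ->
  (forall i : 'I_(N - N0), - lam (N0 + i)%N + qc + delta <= - ka) ->
  8 * a1 * a3 + 1 <= m / 2 ->
  8 * a1 * cC + 4 * m * a4 * cC + 1 <= 2 * mu * ka ->
  eps * (2 * cB / ka * kphi ^+ 2 * k2) <= 1 / 8 ->
  forall x e v g ze ps,
  2 * dotv (blk x e v g) (blkP PK PL m eps mu *m (F *m blk x e v g + ze *: cL + ps *: cLpsi))
    + 2 * delta * qf (blkP PK PL m eps mu) (blk x e v g)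
  <= - (3 / 8 * dotv x x + dotv e e + eps * ka * dotv v v + dotv g g)
    + (8 * a1 + 4 * m * a4) * ze ^+ 2 + (8 * a2 + 2 * eps * cB / ka) * ps ^+ 2.
Proof.
move=> a10 a20 a30 a40 cB0 cC0 ka0 eps0 mu0 m0 h1 h2 h4 hk h3 hB hC hPK hPL hlam mH muH eH.
move=> x e v g ze ps; rewrite matF_blk blkP_mul dotv_blk blkP_qf.
have := @nominal_balance _ a1 a2 a3 a4 k2 cB cC ka kphi eps mu m
  (dotv x x) (dotv e e) (dotv v v) (dotv g g) _ _ _ _ _ _ _ ze ps _ _ _ _ _ _ delta
  a10 a20 a30 a40 cB0 cC0 ka0 eps0 mu0 m0 (dotvv_ge0 e) (dotvv_ge0 v) (dotvv_ge0 g) (dotvv_ge0 x)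
  (h1 x) (h2 x) (h4 e) (hB v) (hk x) (h3 e) (hC g) (hPK x) (hPL e)
  (qf_A1 v hlam) (qf_A1 g hlam) mH muH eH.
apply: le_trans; rewrite le_eqVlt; apply/orP; left; apply/eqP.
rewrite mulmxBr !mulmxDr -!scalemxAr -[- (_ *: _)]scaleN1r !(dotvDr, dotvZr).
move: (dotv x _) (dotv x _) (dotv x _) (dotv e _) (dotv e _) (dotv v _) (dotv v _) (dotv g _).
move: ((C0' *m _) 0 0) ((C1' *m _) 0 0) ((K *m x) 0 0) (qf PK x) (qf PL e) (dotv v v) (dotv g g).
move=> *; ring.
Qed.

End LMI.

(** * Derivatives along trajectories *)

Section Derivatives.
Context {R : realType}.
Implicit Types (f : R -> R) (v : R -> R -> R).

Lemma is_derive_quot f (t l : R) :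
  (f s - f t) / (s - t) @[s --> t^'] --> l <-> is_derive t (1 : R) f l.
Proof.
pose D := fun h : R => h^-1 *: (f (h *: 1 + t) - f t).
have DE h : D h = (f (h + t) - f t) / ((h + t) - t).
  by rewrite /D addrK /GRing.scale/= mulr1 mulrC.
have DP : D h @[h --> 0^'] --> l <-> (f s - f t) / (s - t) @[s --> t^'] --> l.
  split=> /cvgrPdist_le H; apply/cvgrPdist_le => e e0;
    move: (H e e0) => /nbhs_ballP[d /= d0 dP]; apply/nbhs_ballP; exists d => //= h.
  - rewrite /ball/= => hd ht; have := dP (h - t).
    rewrite DE !subrK; apply; first by rewrite /ball/= sub0r opprB.
    by rewrite subr_eq0.
  - rewrite /ball/= sub0r normrN => hd h0; rewrite DE; apply: dP.
      by rewrite /ball/= opprD addrCA subrr addr0 normrN.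
    by rewrite -subr_eq0 addrK.
rewrite -DP; split=> [H|[dD vD]].
  split; first by apply/cvg_ex; exists l.
  exact: (cvg_lim (@Rhausdorff R) H).
by rewrite -vD; exact: dD.
Qed.

Lemma is_derive_eqf f g (t l : R) : (forall s, f s = g s) -> is_derive t (1 : R) f l ->
  is_derive t (1 : R) g l.
Proof. by move=> /funext ->. Qed.

Lemma is_derive_add f g (t l m : R) : is_derive t (1 : R) f l -> is_derive t (1 : R) g m ->
  is_derive t (1 : R) (fun s => f s + g s) (l + m).
Proof. by move=> H1 H2; exact: is_deriveD. Qed.

Lemma is_derive_mulc f (c t l : R) : is_derive t (1 : R) f l ->
  is_derive t (1 : R) (fun s => c * f s) (c * l).
Proof. by move=> H; exact: (is_deriveZ c H). Qed.

Lemma is_derive_mul f g (t l m : R) : is_derive t (1 : R) f l -> is_derive t (1 : R) g m ->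
  is_derive t (1 : R) (fun s => f s * g s) (l * g t + f t * m).
Proof.
move=> H1 H2; have H := is_deriveM H1 H2; rewrite addrC (mulrC l); exact: H.
Qed.

Lemma is_derive_bigsum n (F : 'I_n -> R -> R) (dF : 'I_n -> R) (t : R) :
  (forall i, is_derive t (1 : R) (F i) (dF i)) ->
  is_derive t (1 : R) (fun s => \sum_i F i s) (\sum_i dF i).
Proof.
move=> H; have := is_derive_sum H; apply: is_derive_eqf => s.
by rewrite fct_sumE.
Qed.

Lemma is_derive_cvg f (t l : R) : is_derive t (1 : R) f l -> f s @[s --> t] --> f t.
Proof. by case=> d _; apply: differentiable_continuous; apply/derivable1_diffP. Qed.

Lemma L2_diffquot v (s t : R) : L2 (v s) -> L2 (v t) ->
  L2 (fun x => (v s x - v t x) / (s - t)).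
Proof. by move=> Ls Lt; under eq_fun do rewrite mulrC; apply: L2Z; exact: L2B. Qed.

Lemma is_L2_deriv_near v (t : R) g : is_L2_deriv v t g ->
  (\forall s \near t, L2 (v s)) -> L2 (v t) ->
  \forall s \near t^', L2 (fun x => (v s x - v t x) / (s - t)).
Proof.
move=> _ nL Lt; have : \forall s \near t^', L2 (v s) by exact: nbhs_dnbhs.
by apply: filterS => s Ls; exact: L2_diffquot.
Qed.

(* If (h, w) is symmetric along the curve then
   <h(s),w(s)> - <h(t),w(t)> = <h(s) + h(t), w(s) - w(t)>, so that no
   derivative of h is needed. *)
Lemma is_derive_ip_sym (h w : R -> R -> R) (t : R) dw : is_L2_deriv w t dw ->
  (\forall s \near t, L2 (w s)) -> (\forall s \near t, L2 (h s)) -> L2 (w t) -> L2 (h t) ->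
  normL2 (fun x => h s x - h t x) @[s --> t^'] --> (0 : R) ->
  (\forall s \near t, ip (h s) (w t) = ip (h t) (w s)) ->
  is_derive t (1 : R) (fun s => ip (h s) (w s)) (2 * ip (h t) dw).
Proof.
move=> dwt nw nh Lw Lh ch sym; have [Ldw cw] := dwt; apply/is_derive_quot.
have nq := is_L2_deriv_near dwt nw Lw.
have nh' : \forall s \near t^', L2 (h s) by exact: nbhs_dnbhs.
have nw' : \forall s \near t^', L2 (w s) by exact: nbhs_dnbhs.
have sym' : \forall s \near t^', ip (h s) (w t) = ip (h t) (w s) by exact: nbhs_dnbhs.
pose W s x := (w s x - w t x) / (s - t).
have c1 : ip (h s) (W s) @[s --> t^'] --> ip (h t) dw by exact: cvg_ip.
have c2 : ip (h t) (W s) @[s --> t^'] --> ip (h t) dw.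
  by apply: cvg_ip => //; [exact: nearW|exact: cst_cvgL2].
have c3 : (ip (h s) (W s) + ip (h t) (W s)) @[s --> t^'] --> 2 * ip (h t) dw.
  by rewrite (_ : 2 * _ = ip (h t) dw + ip (h t) dw); [exact: cvgD|ring].
apply: cvg_trans c3; apply: near_eq_cvg; near=> s.
have Lhs : L2 (h s) by near: s.
have Lws : L2 (w s) by near: s.
have LB := L2B Lws Lw.
have WE g : L2 g -> ip g (W s) = (s - t)^-1 * (ip g (w s) - ip g (w t)).
  move=> Lg; rewrite -ipBr// -ipZr//; congr (ip g _).
  by apply/funext => x; rewrite /W mulrC.
rewrite !WE//; have -> : ip (h s) (w t) = ip (h t) (w s) by near: s.
ring.
Unshelve. all: by end_near. Qed.

Lemma is_derive_ip v (t : R) dv f : is_L2_deriv v t dv ->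
  (\forall s \near t, L2 (v s)) -> L2 (v t) -> L2 f ->
  is_derive t (1 : R) (fun s => ip (v s) f) (ip dv f).
Proof.
move=> dvt nv Lv Lf; have [Ldv cv] := dvt; apply/is_derive_quot.
have nq := is_L2_deriv_near dvt nv Lv.
have nv' : \forall s \near t^', L2 (v s) by exact: nbhs_dnbhs.
have c1 : ip (fun x => (v s x - v t x) / (s - t)) f @[s --> t^'] --> ip dv f.
  by apply: cvg_ip => //; [exact: nearW|exact: cst_cvgL2].
apply: cvg_trans c1; apply: near_eq_cvg; near=> s.
have Lvs : L2 (v s) by near: s.
rewrite -ipBl// mulrC -ipZl//; last exact: L2B.
by congr (ip _ f); apply/funext => x; rewrite mulrC.
Unshelve. all: by end_near. Qed.

Lemma is_L2_derivD v (u : R -> R) (t d : R) dv b : is_L2_deriv v t dv ->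
  (\forall s \near t, L2 (v s)) -> L2 (v t) -> L2 b -> is_derive t (1 : R) u d ->
  is_L2_deriv (fun s x => v s x + b x * u s) t (fun x => dv x + d * b x).
Proof.
move=> dvt nv Lv Lb /is_derive_quot du; have [Ldv cv] := dvt.
split; first by apply: L2D => //; exact: L2Z.
have nq := is_L2_deriv_near dvt nv Lv.
pose A s := normL2 (fun x => (v s x - v t x) / (s - t) - dv x).
pose B s := `|(u s - u t) / (s - t) - d|.
have cB : B s @[s --> t^'] --> (0 : R).
  have : `|(u s - u t) / (s - t) - d| @[s --> t^'] --> `|d - d|.
    by apply: cvg_norm; apply: cvgB => //; exact: cvg_cst.
  by rewrite subrr normr0.
apply: (@le_cvg0 _ _ _ _ _ (fun s => A s + B s * normL2 b)).
  apply: filterS nq => s Lq; rewrite subr0 ger0_norm ?normL2_ge0//.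
  have L1 := L2B Lq Ldv; have L2' := L2Z ((u s - u t) / (s - t) - d) Lb.
  rewrite -normL2Z//; apply: le_trans (normL2_triangle L1 L2').
  rewrite le_eqVlt; apply/orP; left; apply/eqP; congr normL2; apply/funext => x; ring.
rewrite -[X in _ --> X]addr0 -[X in _ --> _ + X](mul0r (normL2 b)).
by apply: cvgD => //; apply: cvgM => //; exact: cvg_cst.
Qed.

End Derivatives.

(** expR (rate t) V t is nonincreasing. The derivative is taken on the open interval and only
    continuity at its ends, so that the L^2 estimate can start at the initial time. *)
Lemma gronwall_decay (R : realType) (V dV : R -> R) (rate a c : R) : a <= c ->
  {within `[a, c], continuous V} ->
  (forall t, a < t -> t < c -> is_derive t (1 : R) V (dV t)) ->
  (forall t, a < t -> t < c -> dV t <= - rate * V t) ->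
  V c <= expR (- rate * (c - a)) * V a.
Proof.
move=> ac cV dVt dVle; pose W t := expR (rate * t) * V t.
have dexp t : is_derive t (1 : R) (fun s => expR (rate * s)) (expR (rate * t) * rate).
  have H : is_derive t (1 : R) (fun s : R => rate * s) (rate * 1).
    by apply: is_derive_mulc; exact: is_derive_id.
  have := is_derive1_comp (is_derive_expR (rate * t)) H; rewrite mulr1 mulrC; exact.
have dW t : a < t -> t < c ->
    is_derive t (1 : R) W (expR (rate * t) * (rate * V t + dV t)).
  move=> at' tc; have := is_derive_mul (dexp t) (dVt t at' tc).
  by rewrite mulrDr mulrA.
have cW : {within `[a, c], continuous W}.
  move=> x; apply: cvgM; last exact: cV.
  apply: continuous_subspaceT => y.
  exact: (is_derive_cvg (dexp y)).
have := @ler0_derive1_le_cc R W a c.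
have HW1 (x : R) : x \in `]a, c[ -> derivable W x 1.
  by rewrite in_itv/= => /andP[ax xc]; have [] := dW x ax xc.
have HW2 (x : R) : x \in `]a, c[ -> derive1 W x <= 0.
  rewrite in_itv/= => /andP[ax xc]; have [_ dE] := dW x ax xc.
  rewrite derive1E dE pmulr_rle0 ?expR_gt0//.
  by have := dVle x ax xc; rewrite mulNr; lra.
move=> /(_ HW1 HW2 cW c a); rewrite !in_itv/= !lexx ac => /(_ isT isT isT).
rewrite /W => H; rewrite -(ler_pM2l (expR_gt0 (rate * c))) mulrA -expRD.
by rewrite (_ : rate * c + _ = rate * a); [exact: H|ring].
Qed.

(** The gap in the conclusion is exactly the sum of the gaps in the eight hypotheses, so these are
    added and an identity remains. The term 3 ga ai hh gathers the three Young inequalities, with ai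
    the inverse of alpha: this is the origin of 3 / (2 alpha) in the constraints. *)
Lemma lyapunov_balance (R : realType) (Q1 Q2 ga qc delta S hA hw ha hb hh ai al Ra Rb : R)
    (k D M ta be m Aw uu ps ze d du : R) :
  2 * Q1 + 2 * delta * Q2 + (al * ga * k ^+ 2 * Ra + ta * D ^+ 2) * uu ^+ 2 - be * ze ^+ 2
    + (al * ga * Ra - ta) * ps ^+ 2 + al * ga * Rb * M ^+ 2 * du ^+ 2 <= 0 ->
  2 * ga * (- hA + qc * hw + delta * S) + 3 * ga * ai * hh + be * m * Aw <= 0 ->
  be * ze ^+ 2 <= be * (m * Aw) ->
  ta * ps ^+ 2 <= ta * (D ^+ 2 * uu ^+ 2) ->
  ga * (2 * (k * uu * ha)) <= ga * (ai * hh + al * (k * uu) ^+ 2 * Ra) ->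
  ga * (2 * (ps * ha)) <= ga * (ai * hh + al * ps ^+ 2 * Ra) ->
  ga * (2 * (d * hb)) <= ga * (ai * hh + al * d ^+ 2 * Rb) ->
  ga * al * Rb * d ^+ 2 <= ga * al * Rb * (M ^+ 2 * du ^+ 2) ->
  2 * Q1 + ga * (2 * (- hA + qc * hw + k * uu * ha + ps * ha + d * hb))
    <= - (2 * delta) * (Q2 + ga * S).
Proof.
move=> HT Hr; rewrite -subr_le0 => H1; rewrite -subr_le0 => H2; rewrite -subr_le0 => H3.
rewrite -subr_le0 => H4; rewrite -subr_le0 => H5; rewrite -subr_le0 => H6; rewrite -subr_le0.
have := addr_ge0 (addr_ge0 (addr_ge0 (addr_ge0 (addr_ge0 (addr_ge0 (addr_ge0
  (etrans (oppr_ge0 _) HT) (etrans (oppr_ge0 _) Hr)) (etrans (oppr_ge0 _) H1))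
  (etrans (oppr_ge0 _) H2)) (etrans (oppr_ge0 _) H3)) (etrans (oppr_ge0 _) H4))
  (etrans (oppr_ge0 _) H5)) (etrans (oppr_ge0 _) H6).
by rewrite -oppr_ge0; congr (0 <= _); ring.
Qed.

(** x is an observer mode and y the plant mode that it estimates. The left-hand expression is the
    contribution of the pair to the squared norm of the state, with l = lam k for a high mode; for a
    low mode l = 1. *)
Lemma mode_equiv (R : realType) (l c x y : R) : 0 < l -> 1 <= c -> l <= c -> l^-1 <= c ->
  (x / l) ^+ 2 + l * (y - x) ^+ 2 <= 4 * c ^+ 2 * (x ^+ 2 + y ^+ 2) /\
  x ^+ 2 + y ^+ 2 <= 4 * c ^+ 2 * ((x / l) ^+ 2 + l * (y - x) ^+ 2).
Proof.
move=> l0 c1 lc ic; have i0 : 0 < l^-1 by rewrite invr_gt0.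
have c0 : 0 <= c by exact: le_trans c1.
have cc : c <= c ^+ 2 by rewrite expr2 ler_peMr.
have l2 : l ^+ 2 <= c ^+ 2 by rewrite lerXn2r ?nnegrE// ltW.
have i2 : l^-1 ^+ 2 <= c ^+ 2 by rewrite lerXn2r ?nnegrE// ltW.
have D0 := sqr_ge0 (y - x); have X0 := sqr_ge0 x; have V0 := sqr_ge0 (x / l).
have LD0 : 0 <= l * (y - x) ^+ 2 by rewrite mulr_ge0// ltW.
have xE : x ^+ 2 = l ^+ 2 * (x / l) ^+ 2 by rewrite -exprMn mulrCA divff ?mulr1// gt_eqF.
have dE : (y - x) ^+ 2 = l^-1 * (l * (y - x) ^+ 2) by rewrite mulKf// gt_eqF.
split.
  have H1 := ler_wpM2r X0 i2; have H2 := ler_wpM2r D0 (le_trans lc cc).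
  have H3 : c ^+ 2 * (y - x) ^+ 2 <= c ^+ 2 * (2 * x ^+ 2 + 2 * y ^+ 2).
    by rewrite ler_wpM2l ?sqr_ge0//; have := sqr_ge0 (x + y); lra.
  have H4 := mulr_ge0 (sqr_ge0 c) X0; have H5 := mulr_ge0 (sqr_ge0 c) (sqr_ge0 y).
  by rewrite exprMn; lra.
have H1 := ler_wpM2r V0 l2; have H2 := ler_wpM2r LD0 (le_trans ic cc).
have H3 : x ^+ 2 + y ^+ 2 <= 3 * x ^+ 2 + 2 * (y - x) ^+ 2.
  by have := sqr_ge0 (y - 2 * x); lra.
have H4 := mulr_ge0 (sqr_ge0 c) V0; have H5 := mulr_ge0 (sqr_ge0 c) LD0.
by move: H3; rewrite {2}xE [(y - x) ^+ 2 in X in X -> _]dE; lra.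
Qed.

(** * The closed loop *)

Section PlantCoefficients.
Context {R : realType}.
Context (th1 th2 : R) (p qt q : R -> R) (qc : R).
Context (lam : nat -> R) (phi : nat -> R -> R).
Context (hth1 : 0 < th1 <= pi / 2) (hth2 : 0 <= th2 <= pi / 2).
Context (hp : C2_01 p) (hp0 : forall x, x \in `[0, 1] -> 0 < p x).
Context (hqt : C0_01 qt) (hq : C0_01 q).
Context (hqqc : forall x, x \in `[0, 1] -> qt x = q x - qc).
Context (hq0 : forall x, x \in `[0, 1] -> 0 < q x).
Context (heig : sl_eigenbasis th1 th2 p q lam phi).
Local Notation mu := (@lebesgue_measure R).

Lemma eq_ipl f f' g : (forall x : R, x \in `[0, 1] -> f x = f' x) -> ip f g = ip f' g.
Proof. by move=> ff; apply: eq_Rintegral => x; rewrite inE => x01; rewrite ff. Qed.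

Let c := cos th2 + 2 * sin th2.

Lemma coefb_deriv01 (x : R) : is_deriv01 (coefb th2) x (- (2 * x / c)).
Proof.
rewrite /is_deriv01.
have H : (- ((y + x) / c)) @[y --> within `[0, 1] x^'] --> - ((x + x) / c).
  apply: cvgN; apply: cvgM; last exact: cvg_cst.
  apply: cvgD; last exact: cvg_cst.
  by apply: cvg_within_filter; apply: cvg_within_filter; exact: cvg_id.
rewrite (_ : 2 * x = x + x); last ring.
apply: cvg_trans H; apply: near_eq_cvg; near=> y.
have yx : y - x != 0.
  rewrite subr_eq0; near: y; rewrite near_withinE; near=> y => _; near: y.
  exact: nbhs_dnbhs_neq.
rewrite /diffq01 /coefb -/c.
by rewrite (_ : _ - _ = (- ((y + x) / c)) * (y - x)) ?mulfK//; ring.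
Unshelve. all: by end_near. Qed.

Lemma deriv01_coefb (x : R) : x \in `[0, 1] -> deriv01 (coefb th2) x = - (2 * x / c).
Proof. by move=> x01; apply: is_deriv01_eq => //; exact: coefb_deriv01. Qed.

Lemma C0_01_cst (a : R) : C0_01 (fun=> a).
Proof. by move=> x; exact: cvg_cst. Qed.

Lemma C0_01_id : C0_01 (fun x : R => x).
Proof. by apply/C0_01P => x x01; apply: cvg_within_filter; exact: cvg_id. Qed.

Lemma coefb_C1 : C1_01 (coefb th2).
Proof.
split; first by move=> x _; apply: is_deriv01_derivable; exact: coefb_deriv01.
apply: (@eq_C0_01 _ (fun x => - (2 / c) * x + 0 * x)); last first.
  exact: (C0_01_lin C0_01_id C0_01_id).
by move=> x x01; rewrite deriv01_coefb//; ring.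
Qed.

Lemma L2_cst (a : R) : L2 (fun=> a).
Proof. apply: C0_L2; exact: C0_01_cst. Qed.

Lemma coefb_wderiv : is_wderiv (deriv01 (coefb th2)) (fun=> - (2 / c)).
Proof.
split; first exact: L2_cst.
move=> x x01; rewrite !deriv01_coefb//; last by rewrite in_itv/= lexx ler01.
rewrite Rintegral_cst//; move: x01; rewrite in_itv/= => /andP[x0 x1].
have -> : fine (mu `[0, x]) = x.
  by transitivity (fine (x - 0)%:E); [congr fine; exact: mu_itv|rewrite subr0].
ring.
Qed.

Lemma coefb_H2 : H2 (coefb th2).
Proof. by split; [exact: coefb_C1|exists (fun=> - (2 / c)); exact: coefb_wderiv]. Qed.

Lemma coefb_L2 : L2 (coefb th2). Proof. exact: (L2_C1 coefb_C1). Qed.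

Lemma coefa_L2 : L2 (coefa th2 p qt).
Proof.
apply: C0_L2; have Cp := C1_C0_01 hp.1.
have H1 : C0_01 (fun x => 2 / c * p x + 2 / c * (x * deriv01 p x)).
  by apply: C0_01_lin => //; apply: C0_01M; [exact: C0_01_id|exact: hp.1.2].
have H2 : C0_01 (fun x => x * (x * qt x)).
  by apply: C0_01M; [exact: C0_01_id|apply: C0_01M; [exact: C0_01_id|]].
apply: (@eq_C0_01 _ _ _ _ (C0_01_lin (a := 1) (b := - c^-1) H1 H2)) => x _.
by rewrite /coefa -/c; ring.
Qed.

Lemma H2_lin (a b : R) f g : H2 f -> H2 g -> H2 (fun y => a * f y + b * g y).
Proof.
move=> [Cf [u fu]] [Cg [v gv]]; split; first exact: C1_01_lin.
exists (fun x => a * u x + b * v x); have [Lu fE] := fu; have [Lv gE] := gv.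
split; first by apply: L2D; exact: L2Z.
have i0 : (0 : R) \in `[0, 1] by rewrite in_itv/= lexx ler01.
move=> x x01; rewrite !deriv01_lin// fE// gE//.
have /andP[x0 x1] : 0 <= x <= 1 by rewrite in_itv/= in x01.
have I h : L2 h -> mu.-integrable `[0, x] (EFin \o h).
  by move=> Lh; apply: L2on_integrable => //; [exact: mu_itv_lty|exact: L2on_itv].
rewrite RintD//; [|by apply: RintegrableZ => //; exact: I..].
rewrite !RintZ//; [|exact: I..].
by move: (\int[mu]_(s in _) u s) (\int[mu]_(s in _) v s) => A B; ring.
Qed.

Lemma phi_C1 n : C1_01 (phi n).
Proof. exact: domA_C1 (phi_domA heig n). Qed.

(** The function a is characterised by -(p b')' + q b = a + qc b, that is, A applied formally to
    b. *)
Lemma slform_coefb n :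
  slform p q (coefb th2) (phi n) = an th2 p qt phi n + qc * bn th2 phi n.
Proof.
have Lphi := phi_L2 heig n; have Lb := coefb_L2.
have Wb := wderivM (C1_wderiv hp.1) coefb_wderiv.
have := flux_form q hp coefb_C1 Wb (phi_C1 n).
set W := fun x => _ => H.
have {H} -> : slform p q (coefb th2) (phi n) =
    ip (fun x => q x * coefb th2 x) (phi n) - ip W (phi n) by rewrite H; ring.
have LW : L2 W := Wb.1.
rewrite -ipBl//; last exact: L2_C0M.
rewrite /an /bn -ipZl// -ipDl//; [|exact: coefa_L2|exact: L2Z].
apply: eq_ipl => x x01; rewrite /W /coefa deriv01_coefb// hqqc// /coefb -/c.
move: (p x) (q x) (deriv01 p x) c^-1 => *; ring.
Qed.

(* The n-th coordinate of p z'' + p' z' - qt z, for z = w - u b in H^2 with w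
   in D(A): integrations by parts only see w through lam n <w, phi n>. *)
Lemma plant_coef (f w : R -> R) (u : R) n : domA th1 th2 w ->
  f = (fun x => 1 * w x + (- u) * coefb th2 x) ->
  ip (fun x => wderiv (fun y => p y * deriv01 f y) x - qt x * f x) (phi n) =
  (- lam n + qc) * ip f (phi n) + betan th2 p qt qc lam phi n * u.
Proof.
move=> dw fE; have Lphi := phi_L2 heig n; have Lw := domA_L2 dw; have Lb := coefb_L2.
have Hf : H2 f by rewrite fE; apply: H2_lin; [by case: dw|exact: coefb_H2].
have Lf : L2 f := L2_C1 Hf.1; have Wf := flux_wderiv hp Hf.
rewrite ipBl//; [|exact: Wf.1|exact: L2_C0M].
rewrite (flux_form q hp Hf.1 Wf (phi_C1 n)).
have -> : ip (fun x => q x * f x) (phi n) =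
    ip (fun x => qt x * f x) (phi n) + qc * ip f (phi n).
  rewrite -ipZl// -ipDl//; [|exact: L2_C0M|exact: L2Z].
  by apply: eq_ipl => x x01; rewrite hqqc//; move: (q x) (f x) => *; ring.
have -> : slform p q f (phi n) = lam n * ip w (phi n)
    - u * (an th2 p qt phi n + qc * bn th2 phi n).
  have Cw := domA_C1 dw; have Cb := coefb_C1; have Cp := phi_C1 n.
  rewrite fE (slform_linl hp hq 1 (- u) Cw Cb Cp).
  rewrite slform_coefb -(slform_phi hp hq heig)//; last exact: domA_form_dom.
  rewrite (slform_sym p q hth1 (phi_form_dom heig n) (domA_form_dom dw)); ring.
have -> : ip w (phi n) = ip f (phi n) + u * bn th2 phi n.
  rewrite fE ipDl//; [|exact: L2Z..]; rewrite !ipZl// /bn; ring.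
rewrite /betan; ring.
Qed.

End PlantCoefficients.

(** * Modal and tail dynamics along a trajectory *)

Section ClosedLoopTrajectory.
Context {R : realType}.
Context (th1 th2 : R) (p qt q : R -> R) (qc : R).
Context (lam : nat -> R) (phi : nat -> R -> R).
Context (hth1 : 0 < th1 <= pi / 2) (hth2 : 0 <= th2 <= pi / 2).
Context (hp : C2_01 p) (hp0 : forall x, x \in `[0, 1] -> 0 < p x).
Context (hqt : C0_01 qt) (hq : C0_01 q).
Context (hqqc : forall x, x \in `[0, 1] -> qt x = q x - qc).
Context (hq0 : forall x, x \in `[0, 1] -> 0 < q x).
Context (heig : sl_eigenbasis th1 th2 p q lam phi).
Context (N0 N : nat) (hN : (N0 <= N)%N) (K : 'rV[R]_N0) (L : 'cV[R]_N0).
Context (vphi : R -> R) (vphi' : forall x, derivable vphi x 1).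
Context (T : \bar R) (z : R -> R -> R) (zh : nat -> R -> R).
Context (hsol : classical_solution th1 th2 p qt q qc lam phi N K L vphi T z zh).

Local Notation w := (hom_state th2 K vphi z zh).
Local Notation u := (fun t => \sum_(k < N0) K 0 k * zh k t).
Local Notation uph := (uphi K vphi zh).
Local Notation Aop := (opA p q).
Local Notation tl := (tail phi).
Local Notation b := (coefb th2).

Definition zcoef (n : nat) (t : R) : R := ip (z t) (phi n).
Definition wcoef (n : nat) (t : R) : R := ip (w t) (phi n).

Lemma Ioo_Ico t : Ioo T t -> Ico T t.
Proof. by move=> [t0 tT]; split=> //; exact: ltW. Qed.

Lemma Ioo_near t : Ioo T t -> \forall s \near t, Ioo T s.
Proof.
move=> [t0 tT]; have H : \forall s \near t, (s%:E < T)%E.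
  move: tT; case: (T) => [r||]//.
    by rewrite lte_fin => tr; apply: filterS (lt_nbhsl tr) => s; rewrite lte_fin.
  by move=> _; apply: filterS (lt_nbhsr t0) => s _; exact: ltry.
by apply: filterS2 H (lt_nbhsr t0) => s sT s0; split.
Qed.

Lemma Ico_near t : Ioo T t -> \forall s \near t, Ico T s.
Proof. by move=> /Ioo_near; apply: filterS => s; exact: Ioo_Ico. Qed.

Lemma w_domA t : Ico T t -> domA th1 th2 (w t).
Proof. exact: (cs_w_dom hsol). Qed.

Lemma zE t : z t = (fun x => 1 * w t x + (- uph t) * b x).
Proof. by apply/funext => x; rewrite /hom_state; ring. Qed.

Lemma wE t : w t = (fun x => z t x + b x * uph t).
Proof. by []. Qed.

Lemma L2_w t : Ico T t -> L2 (w t).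
Proof. by move=> /w_domA; exact: domA_L2. Qed.

Lemma L2_z t : Ico T t -> L2 (z t).
Proof. by move=> /L2_w Lw; rewrite zE; apply: L2D; apply: L2Z => //; exact: coefb_L2. Qed.

Lemma L2_Aw t : Ico T t -> L2 (Aop (w t)).
Proof. by move=> /w_domA; exact: domA_L2_opA. Qed.

Lemma wcoefE n t : Ico T t -> wcoef n t = zcoef n t + bn th2 phi n * uph t.
Proof.
move=> tT; have Lphi := phi_L2 heig n; have Lb := coefb_L2 th2; have Lz := L2_z tT.
rewrite /wcoef wE ipDl//; last by under eq_fun do rewrite mulrC; exact: L2Z.
by under [X in _ + ip X _]eq_fun do rewrite mulrC; rewrite ipZl// mulrC.
Qed.

Lemma zh_derivable n t : (n < N)%N -> Ioo T t -> derivable (zh n) t 1.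
Proof.
move=> nN tT; have [n0|n0] := ltnP n N0.
  by have [] := cs_observer_low hsol (Ordinal n0) tT.
by have [] := @cs_observer_high _ _ _ _ _ _ _ _ _ _ _ _ _ _ _ _ _ hsol n t (introT andP (conj n0 nN)) tT.
Qed.

Lemma zh_is_derive n t : (n < N)%N -> Ioo T t -> is_derive t (1 : R) (zh n) ('D_1 (zh n) t).
Proof. by move=> nN tT; split=> //; exact: zh_derivable. Qed.

Definition du t : R := \sum_(k < N0) K 0 k * 'D_1 (zh k) t.

Lemma u_is_derive t : Ioo T t -> is_derive t (1 : R) u (du t).
Proof.
move=> tT; apply: is_derive_bigsum => k; apply: is_derive_mulc.
by apply: zh_is_derive => //; exact: leq_trans hN.
Qed.

Lemma uph_is_derive t : Ioo T t ->
  is_derive t (1 : R) uph (derive1 vphi (u t) * du t).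
Proof.
move=> tT; have H := u_is_derive tT.
have Hv : is_derive (u t) (1 : R) vphi (derive1 vphi (u t)).
  by split; [exact: vphi'|rewrite derive1E].
have := is_derive1_comp Hv H; rewrite mulrC.
by [].
Qed.

Definition zt t : R -> R :=
  fun x => wderiv (fun y => p y * deriv01 (z t) y) x - qt x * z t x.

Definition wt t : R -> R := fun x => zt t x + (derive1 vphi (u t) * du t) * b x.

Lemma near_L2_z t : Ioo T t -> \forall s \near t, L2 (z s).
Proof. by move=> /Ico_near; apply: filterS => s; exact: L2_z. Qed.

Lemma near_L2_w t : Ioo T t -> \forall s \near t, L2 (w s).
Proof. by move=> /Ico_near; apply: filterS => s; exact: L2_w. Qed.

Lemma near_L2_Aw t : Ioo T t -> \forall s \near t, L2 (Aop (w s)).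
Proof. by move=> /Ico_near; apply: filterS => s; exact: L2_Aw. Qed.

Lemma w_is_L2_deriv t : Ioo T t -> is_L2_deriv w t (wt t).
Proof.
move=> tT; apply: is_L2_derivD.
- exact: (cs_plant hsol tT).
- exact: near_L2_z.
- by apply: L2_z; exact: Ioo_Ico.
- exact: coefb_L2.
- exact: uph_is_derive.
Qed.

Lemma zt_coef n t : Ioo T t -> ip (zt t) (phi n) =
  (- lam n + qc) * zcoef n t + betan th2 p qt qc lam phi n * uph t.
Proof.
move=> tT; exact: (plant_coef hth1 hp hqt hq hqqc heig n (w_domA (Ioo_Ico tT)) (zE t)).
Qed.

Lemma zcoef_is_derive n t : Ioo T t -> is_derive t (1 : R) (zcoef n)
  ((- lam n + qc) * zcoef n t + betan th2 p qt qc lam phi n * uph t).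
Proof.
move=> tT; rewrite -zt_coef//; apply: (is_derive_ip (cs_plant hsol tT)).
- exact: near_L2_z.
- by apply: L2_z; exact: Ioo_Ico.
- exact: (phi_L2 heig n).
Qed.

Lemma wcoef_is_derive n t : Ioo T t -> is_derive t (1 : R) (wcoef n) (ip (wt t) (phi n)).
Proof.
move=> tT; apply: (is_derive_ip (w_is_L2_deriv tT)).
- exact: near_L2_w.
- by apply: L2_w; exact: Ioo_Ico.
- exact: (phi_L2 heig n).
Qed.

Lemma wt_coef n t : Ioo T t -> ip (wt t) (phi n) =
  (- lam n + qc) * wcoef n t + an th2 p qt phi n * uph t
  + bn th2 phi n * (derive1 vphi (u t) * du t).
Proof.
move=> tT; have Lzt : L2 (zt t) by have [] := cs_plant hsol tT.
have Lphi := phi_L2 heig n; have Lb := coefb_L2 th2.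
rewrite /wt ipDl ?ipZl//; last exact: L2Z.
rewrite zt_coef// wcoefE; last exact: Ioo_Ico.
by rewrite /betan -/(bn th2 phi n); ring.
Qed.

(** The right-hand side -A w + qc w + a u_phi + b u_phi' of the equation for w. It is identified
    with [wt] through its coefficients, which is enough to substitute it in every tail. The nesting
    of binary combinations is the shape that the linearity lemmas expect. *)
Definition wrhs t : R -> R := fun x =>
  1 * (-1 * Aop (w t) x + qc * w t x)
  + 1 * (uph t * coefa th2 p qt x + (derive1 vphi (u t) * du t) * b x).

Lemma L2_lin (c d : R) f g : L2 f -> L2 g -> L2 (fun x => c * f x + d * g x).
Proof. by move=> Lf Lg; apply: L2D; exact: L2Z. Qed.

Lemma L2_wrhs t : Ico T t -> L2 (wrhs t).
Proof.
move=> tT; have Lw := L2_w tT; have LA := L2_Aw tT; have Lb := coefb_L2 th2.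
have La : L2 (coefa th2 p qt) by exact: coefa_L2.
by apply: L2_lin; apply: L2_lin.
Qed.

Lemma ip_lin (c d : R) f g h : L2 f -> L2 g -> L2 h ->
  ip (fun x => c * f x + d * g x) h = c * ip f h + d * ip g h.
Proof. by move=> Lf Lg Lh; rewrite ipDl ?ipZl//; exact: L2Z. Qed.

Lemma wrhs_coef n t : Ioo T t -> ip (wrhs t) (phi n) = ip (wt t) (phi n).
Proof.
move=> tT; have tT' := Ioo_Ico tT.
have Lw := L2_w tT'; have LA := L2_Aw tT'; have Lb := coefb_L2 th2.
have La : L2 (coefa th2 p qt) by exact: coefa_L2.
have Lphi := phi_L2 heig n; rewrite wt_coef// /wrhs.
have L1 := L2_lin (-1) qc LA Lw; have L2' := L2_lin (uph t) (derive1 vphi (u t) * du t) La Lb.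
rewrite (ip_lin _ _ L1 L2' Lphi) (ip_lin _ _ LA Lw Lphi) (ip_lin _ _ La Lb Lphi).
rewrite (opA_coef hth1 hp hq heig n (w_domA tT')) /wcoef /an /bn; move: (ip (w t) _) (ip b _) (ip (coefa _ _ _) _) (uph t) => *; ring.
Qed.

Lemma tail_wt M f t : Ioo T t -> L2 f -> tl M f (wt t) = tl M f (wrhs t).
Proof.
move=> tT Lf; have tT' := Ioo_Ico tT; have pL := phi_L2 heig; have cp := eig_complete heig.
have Lwt : L2 (wt t) by have [] := w_is_L2_deriv tT.
have Lr := L2_wrhs tT'.
apply/eqP; rewrite eq_le; apply/andP; split.
  by apply: (tail_le pL cp) => // k _; rewrite wrhs_coef.
by apply: (tail_le pL cp) => // k _; rewrite wrhs_coef.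
Qed.

(** Covers h = w with c = 1 and h = A w with c = lam: both are symmetric against w and diagonal in
    the eigenbasis. The full inner product is differentiated by [is_derive_ip_sym], the M subtracted
    modes one at a time. *)
Lemma tail_is_derive (h : R -> R -> R) (c : nat -> R) M t : Ioo T t ->
  (\forall s \near t, L2 (h s)) -> L2 (h t) ->
  normL2 (fun x => h s x - h t x) @[s --> t^'] --> (0 : R) ->
  (\forall s \near t, ip (h s) (w t) = ip (h t) (w s)) ->
  (\forall s \near t, forall k, ip (h s) (phi k) = c k * wcoef k s) ->
  is_derive t (1 : R) (fun s => tl M (h s) (w s)) (2 * tl M (h t) (wt t)).
Proof.
move=> tT nh Lh ch sym hc; have tT' := Ioo_Ico tT; have Lw := L2_w tT'.
have nw := near_L2_w tT; have dw := w_is_L2_deriv tT.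
have D1 := is_derive_ip_sym dw nw nh Lw Lh ch sym.
have D2 : is_derive t (1 : R) (fun s => \sum_(k < M) c k * (wcoef k s * wcoef k s))
    (\sum_(k < M) c k * (2 * wcoef k t * ip (wt t) (phi k))).
  apply: is_derive_bigsum => k; apply: is_derive_mulc.
  have Hk := wcoef_is_derive k tT; have := is_derive_mul Hk Hk.
  by rewrite (_ : ip (wt t) (phi k) * _ + _ = 2 * wcoef k t * ip (wt t) (phi k))//; ring.
have D3 := is_derive_add D1 (is_derive_mulc (-1) D2).
have -> : 2 * tl M (h t) (wt t) = 2 * ip (h t) (wt t) +
    -1 * (\sum_(k < M) c k * (2 * wcoef k t * ip (wt t) (phi k))).
  rewrite /tail mulrBr mulN1r; congr (_ - _); rewrite mulr_sumr; apply: eq_bigr => k _.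
  by rewrite (nbhs_singleton hc); ring.
move: D3 => /is_derive_quot D3; apply/is_derive_quot.
apply: cvg_trans D3; apply: near_eq_cvg; near=> s.
have E r : (forall k, ip (h r) (phi k) = c k * wcoef k r) -> tl M (h r) (w r) =
    ip (h r) (w r) + -1 * (\sum_(k < M) c k * (wcoef k r * wcoef k r)).
  move=> H; rewrite /tail mulN1r; congr (_ - _); apply: eq_bigr => k _.
  by rewrite H -mulrA.
rewrite !E//; first exact: (nbhs_singleton hc).
by near: s; exact: nbhs_dnbhs.
Unshelve. all: by end_near. Qed.

Lemma within_Ioo_cvg (v : R -> R) (t l : R) : Ioo T t ->
  v s @[s --> within (Ioo T) (nbhs t)] --> l -> v s @[s --> t^'] --> l.
Proof.
move=> tT H; apply: cvg_trans H; apply: cvg_app => A /= HA.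
have {}HA : \forall s \near nbhs t, Ioo T s -> A s by exact: HA.
have : \forall s \near t, A s by apply: filterS2 HA (Ioo_near tT) => s; apply.
exact: nbhs_dnbhs.
Qed.

Lemma within_Ico_cvg (v : R -> R) (t l : R) : Ioo T t ->
  v s @[s --> within (Ico T) (nbhs t)] --> l -> v s @[s --> t^'] --> l.
Proof.
move=> tT H; apply: cvg_trans H; apply: cvg_app => A /= HA.
have {}HA : \forall s \near nbhs t, Ico T s -> A s by exact: HA.
have : \forall s \near t, A s by apply: filterS2 HA (Ico_near tT) => s; apply.
exact: nbhs_dnbhs.
Qed.

Lemma tail_w_is_derive M t : Ioo T t ->
  is_derive t (1 : R) (fun s => tl M (w s) (w s)) (2 * tl M (w t) (wt t)).
Proof.
move=> tT; have tT' := Ioo_Ico tT; have nI := Ico_near tT.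
apply: (@tail_is_derive w (fun=> 1)) => //; [exact: near_L2_w|exact: L2_w| | |].
- apply: within_Ico_cvg => //; exact: (cs_w_C0 hsol).2.
- by apply: filterS nI => s _; rewrite ipC.
- by apply: filterS nI => s _ k; rewrite mul1r.
Qed.

Lemma tail_Aw_is_derive M t : Ioo T t ->
  is_derive t (1 : R) (fun s => tl M (Aop (w s)) (w s)) (2 * tl M (Aop (w t)) (wt t)).
Proof.
move=> tT; have tT' := Ioo_Ico tT; have nI := Ico_near tT.
apply: (@tail_is_derive (fun s => Aop (w s)) lam) => //; [exact: near_L2_Aw|exact: L2_Aw| | |].
- apply: within_Ioo_cvg => //; exact: (cs_Aw_C0 hsol).2.
- apply: filterS nI => s sT; by rewrite (opA_sym hth1 hp hq (w_domA sT) (w_domA tT')) ipC.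
- by apply: filterS nI => s sT k; exact: (opA_coef hth1 hp hq heig k (w_domA sT)).
Qed.

(** * The finite-dimensional state and its dynamics *)

Context (kphi dkphi Mphi delta : R).
Context (hpsi : forall x, (vphi x - kphi * x) ^+ 2 <= dkphi ^+ 2 * x ^+ 2).
Context (hslope : forall x, derive1 vphi x ^+ 2 <= Mphi ^+ 2).

Definition Zlow t : 'cV[R]_N0 := \col_i zh i t.
Definition Elow t : 'cV[R]_N0 := \col_i (zcoef i t - zh i t).
(** The input coefficients [betan] contain -lam n bn; division by lam makes them square summable.
    Likewise the factor sqrt lam on the errors below replaces phi n 0 by phi n 0 / sqrt lam in the
    output. Both scalings keep the blocks of F bounded uniformly in N. *)
Definition Zhigh t : 'cV[R]_(N - N0) := \col_i (zh (N0 + i)%N t / lam (N0 + i)%N).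
Definition Ehigh t : 'cV[R]_(N - N0) :=
  \col_i (Num.sqrt (lam (N0 + i)%N) * (zcoef (N0 + i)%N t - zh (N0 + i)%N t)).
Definition Xv t : 'cV[R]_(dimF N0 N) := blk (Zlow t) (Elow t) (Zhigh t) (Ehigh t).
Definition zeta t : R := w t 0 - \sum_(k < N) wcoef k t * phi k 0.
Definition psi t : R := uph t - kphi * u t.

Local Notation A0' := (A0 qc lam N0).
Local Notation B0' := (B0 th2 p qt qc lam phi N0).
Local Notation C0' := (C0 phi N0).
Local Notation C1' := (C1 lam phi N0 N).
Local Notation F := (matF th2 p qt qc lam phi N kphi K L).
Local Notation cL := (calL N L).
Local Notation cLpsi := (calLpsi th2 p qt qc lam phi N0 N).
Local Notation Kt := (Ktilde N K).
Local Notation Em := (matE th2 p qt qc lam phi N kphi K L).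

Definition dX t : 'cV[R]_(dimF N0 N) := F *m Xv t + zeta t *: cL + psi t *: cLpsi.

Definition dZlow t : 'cV[R]_N0 := (A0' + kphi *: (B0' *m K)) *m Zlow t
  + ((C0' *m Elow t) 0 0 + (C1' *m Ehigh t) 0 0 + zeta t) *: L + psi t *: B0'.

Lemma KZlow t : (K *m Zlow t) 0 0 = u t.
Proof. by rewrite mxE; apply: eq_bigr => k _; rewrite mxE. Qed.

Lemma KtX t : (Kt *m Xv t) 0 0 = u t.
Proof. by rewrite Ktilde_blk KZlow. Qed.

Lemma sum_split_N (f : nat -> R) :
  \sum_(k < N) f k = \sum_(k < N0) f k + \sum_(k < N - N0) f (N0 + k)%N.
Proof.
have -> : \sum_(k < N) f k = \sum_(k < N0 + (N - N0)) f k by rewrite subnKC.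
by rewrite big_split_ord.
Qed.

(** As b(0) = 0, z and w have the same value at 0. The terms bn u_phi present in both [wcoef] and
    [hatw] cancel, and the estimation errors remain. *)
Lemma output_errorE t : Ico T t -> output_error th2 phi N K vphi z zh t =
  - ((C0' *m Elow t) 0 0 + (C1' *m Ehigh t) 0 0 + zeta t).
Proof.
move=> tT; rewrite /output_error.
have -> : z t 0 = w t 0 by rewrite /hom_state /coefb expr0n/= mul0r oppr0 mul0r addr0.
have -> : (C0' *m Elow t) 0 0 + (C1' *m Ehigh t) 0 0 =
    \sum_(k < N) (zcoef k t - zh k t) * phi k 0.
  rewrite (sum_split_N (fun k => (zcoef k t - zh k t) * phi k 0)) !mxE; congr (_ + _).
    by apply: eq_bigr => k _; rewrite !mxE mulrC.
  apply: eq_bigr => k _; rewrite !mxE.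
  have : Num.sqrt (lam (N0 + k)%N) != 0 by rewrite gt_eqF// sqrtr_gt0 (lam_gt0 heig).
  by move=> H; field.
rewrite /zeta -[w t 0 in RHS](subrK (z t 0)).
have -> : \sum_(k < N) hatw th2 phi K vphi zh k t * phi k 0 =
    \sum_(k < N) wcoef k t * phi k 0 - \sum_(k < N) (zcoef k t - zh k t) * phi k 0.
  by rewrite -sumrB; apply: eq_bigr => k _; rewrite wcoefE// /hatw; ring.
move: (\sum_(k < N) _) (\sum_(k < N) _) => A B; ring.
Qed.

Lemma cvD n (a c : 'cV[R]_n) i : (a + c) i 0 = a i 0 + c i 0.
Proof. by rewrite mxE. Qed.

Lemma cvN n (a : 'cV[R]_n) i : (- a) i 0 = - a i 0.
Proof. by rewrite mxE. Qed.

Lemma cvZ n (c : R) (a : 'cV[R]_n) i : (c *: a) i 0 = c * a i 0.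
Proof. by rewrite mxE. Qed.

Lemma diag_mulE n (d : 'rV[R]_n) (a : 'cV[R]_n) i : (diag_mx d *m a) i 0 = d 0 i * a i 0.
Proof. by rewrite mul_diag_mx mxE. Qed.

Lemma uphE t : uph t = kphi * u t + psi t.
Proof. by rewrite /psi addrC subrK. Qed.

Lemma dZlowE t (i : 'I_N0) : Ico T t -> dZlow t i 0 =
  open_loop_rhs th2 p qt qc lam phi K vphi zh i t
  - L i 0 * output_error th2 phi N K vphi z zh t.
Proof.
move=> tT; rewrite output_errorE// /open_loop_rhs uphE /dZlow mulmxDl -scalemxAl.
rewrite !(cvD, cvZ) !mulmx_rank1 KZlow diag_mulE.
rewrite [B0' i 0]mxE [Zlow t i 0]mxE [in LHS]mxE.
move: ((C0' *m _) 0 0) ((C1' *m _) 0 0) (u t) (psi t) (zeta t) => *; ring.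
Qed.

Lemma is_derive_col_mx m n (a da : R -> 'cV[R]_m) (c dc : R -> 'cV[R]_n) t :
  (forall i, is_derive t (1 : R) (fun s => a s i 0) (da t i 0)) ->
  (forall i, is_derive t (1 : R) (fun s => c s i 0) (dc t i 0)) ->
  forall i, is_derive t (1 : R) (fun s => col_mx (a s) (c s) i 0) (col_mx (da t) (dc t) i 0).
Proof.
move=> Ha Hc i; case: (splitP i) => j ij.
  have -> : i = lshift n j by exact: val_inj.
  have := Ha j; rewrite -(col_mxEu _ (dc t)); apply: is_derive_eqf => s.
  by rewrite col_mxEu.
have -> : i = rshift m j by exact: val_inj.
have := Hc j; rewrite -(col_mxEd (da t)); apply: is_derive_eqf => s.
by rewrite col_mxEd.
Qed.

Lemma zh_low_is_derive t (i : 'I_N0) : Ioo T t ->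
  is_derive t (1 : R) (zh i) (dZlow t i 0).
Proof.
move=> tT; rewrite dZlowE; last exact: Ioo_Ico.
exact: (cs_observer_low hsol i tT).
Qed.

Lemma high_ltn (i : 'I_(N - N0)) : (N0 <= N0 + i < N)%N.
Proof. by rewrite leq_addr/= -ltn_subRL. Qed.

Lemma zh_high_is_derive t (i : 'I_(N - N0)) : Ioo T t ->
  is_derive t (1 : R) (zh (N0 + i)%N)
    ((- lam (N0 + i)%N + qc) * zh (N0 + i)%N t
     + betan th2 p qt qc lam phi (N0 + i) * (kphi * u t + psi t)).
Proof.
by move=> tT; have := cs_observer_high hsol (high_ltn i) tT; rewrite /open_loop_rhs uphE.
Qed.

Lemma du_dZlow t : Ioo T t -> du t = (K *m dZlow t) 0 0.
Proof.
move=> tT; rewrite mxE; apply: eq_bigr => k _; congr (_ * _).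
by have [_ ->] := zh_low_is_derive k tT.
Qed.

Lemma EmX t : Ioo T t -> (Em *m ext_vec (Xv t) (zeta t) (psi t)) 0 0 = du t.
Proof.
move=> tT; rewrite du_dZlow// matE_blk /dZlow !(mulmxDr K) -!scalemxAr !(cvD, cvZ).
by move: ((K *m L) 0 0) ((K *m B0') 0 0) (psi t) (_ + zeta t) => *; ring.
Qed.

(** In the errors, the input terms of plant and observer cancel; hence the zero blocks of F and
    [calLpsi] in the second and fourth rows. *)
Lemma Xv_is_derive t i : Ioo T t -> is_derive t (1 : R) (fun s => Xv s i 0) (dX t i 0).
Proof.
move=> tT; have tT' := Ioo_Ico tT; rewrite /dX matF_blk -/(dZlow t) /Xv /blk; move: i.
apply: (is_derive_col_mx (a := fun s => col_mx (Zlow s) (Elow s))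
  (da := fun=> col_mx _ _) (c := fun s => col_mx (Zhigh s) (Ehigh s)) (dc := fun=> col_mx _ _));
  [apply: (is_derive_col_mx (a := Zlow) (da := fun=> _) (c := Elow) (dc := fun=> _))
  |apply: (is_derive_col_mx (a := Zhigh) (da := fun=> _) (c := Ehigh) (dc := fun=> _))] => i.
- have := zh_low_is_derive i tT; apply: is_derive_eqf => s; by rewrite mxE.
- have := is_derive_add (zcoef_is_derive i tT) (is_derive_mulc (-1) (zh_low_is_derive i tT)).
  set d1 := _ + -1 * _; set d2 := (X in is_derive _ _ (fun s => Elow s i 0) X).
  have -> : d1 = d2.
    rewrite /d1 /d2 dZlowE// output_errorE// /open_loop_rhs uphE mulmxBl.
    rewrite !(cvD, cvN, cvZ) mulmx_rank1 diag_mulE [Elow t i 0]mxE.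
    rewrite [(\row__ _) 0 i]mxE.
    move: ((C0' *m _) 0 0) ((C1' *m _) 0 0) (u t) (psi t) (zeta t) => *; ring.
  by apply: is_derive_eqf => s; rewrite mxE mulN1r.
- have := is_derive_mulc (lam (N0 + i)%N)^-1 (zh_high_is_derive i tT).
  set d1 := _^-1 * _; set d2 := (X in is_derive _ _ (fun s => Zhigh s i 0) X).
  have -> : d1 = d2.
    rewrite /d1 /d2 !(cvD, cvN, cvZ) KZlow diag_mulE.
    rewrite [B1 _ _ _ _ _ _ _ _ i 0]mxE [Zhigh t i 0]mxE [(\row__ _) 0 i]mxE.
    move: (u t) (psi t) (lam (N0 + i)%N)^-1 => *; ring.
  by apply: is_derive_eqf => s; rewrite mxE mulrC.
- have := is_derive_mulc (Num.sqrt (lam (N0 + i)%N))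
    (is_derive_add (zcoef_is_derive (N0 + i) tT) (is_derive_mulc (-1) (zh_high_is_derive i tT))).
  set d1 := _ * (_ + -1 * _); set d2 := (X in is_derive _ _ (fun s => Ehigh s i 0) X).
  have -> : d1 = d2.
    rewrite /d1 /d2 diag_mulE [Ehigh t i 0]mxE [(\row__ _) 0 i]mxE uphE.
    move: (u t) (psi t) => *; ring.
  by apply: is_derive_eqf => s; rewrite mxE mulN1r.
Qed.

Lemma qf_is_derive (P : 'M[R]_(dimF N0 N)) t : P^T = P -> Ioo T t ->
  is_derive t (1 : R) (fun s => qf P (Xv s)) (2 * dotv (Xv t) (P *m dX t)).
Proof.
move=> Psym tT.
have D1 i : is_derive t (1 : R) (fun s => (P *m Xv s) i 0) ((P *m dX t) i 0).
  have : is_derive t (1 : R) (fun s => \sum_j P i j * Xv s j 0) (\sum_j P i j * dX t j 0).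
    by apply: is_derive_bigsum => j; apply: is_derive_mulc; exact: Xv_is_derive.
  by rewrite [(P *m dX t) i 0]mxE; apply: is_derive_eqf => s; rewrite mxE.
have D2 : is_derive t (1 : R) (fun s => \sum_i Xv s i 0 * (P *m Xv s) i 0)
    (\sum_i (dX t i 0 * (P *m Xv t) i 0 + Xv t i 0 * (P *m dX t) i 0)).
  by apply: is_derive_bigsum => i; apply: is_derive_mul => //; exact: Xv_is_derive.
have -> : 2 * dotv (Xv t) (P *m dX t) =
    \sum_i (dX t i 0 * (P *m Xv t) i 0 + Xv t i 0 * (P *m dX t) i 0).
  rewrite big_split/= -!dotvE (dotv_mull P (dX t)) Psym [dotv (P *m dX t) _]dotvC; ring.
by apply: is_derive_eqf D2 => s; rewrite qfE dotvE.
Qed.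

(** * Differential inequalities for the two Lyapunov functions *)

Local Notation T1 := (Theta1 th2 p qt qc lam phi kphi dkphi Mphi K L delta).

Lemma tail_young_scaled M (al c : R) f g : 0 < al -> L2 f -> L2 g ->
  2 * (c * tl M f g) <= al^-1 * tl M f f + al * c ^+ 2 * tl M g g.
Proof.
move=> al0 Lf Lg; have Lcg : L2 (fun x => c * g x + 0 * g x) by exact: L2_lin.
have := tail_young (phi_L2 heig) (eig_complete heig) M al0 Lf Lcg.
have pL := phi_L2 heig; set g' := fun x => c * g x + 0 * g x.
have E k : L2 k -> tl M k g' = c * tl M k g.
  by move=> Lk; rewrite tailC (tail_linl pL _ _ _ Lg Lg Lk) mul0r addr0 (tailC _ _ g).
rewrite (E f)// (E g')// (tailC _ _ g' g) (E g)//.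
move: (tl M f g) (tl M f f) (tl M g g) => A B C; lra.
Qed.

Lemma dpsi_le t : psi t ^+ 2 <= dkphi ^+ 2 * u t ^+ 2.
Proof. exact: hpsi. Qed.

(* Both Lyapunov functions are <X, P X> + ga * tail (h, w), with h = w for the
   L^2 estimate and h = A w for the energy estimate. *)
Lemma lyapunov_derivative (P : 'M[R]_(dimF N0 N)) (al be ga ta m S : R) h t :
  P^T = P -> 0 < al -> 0 < be -> 0 < ga -> 0 < ta ->
  (forall v, qf (T1 P al be ga ta) v <= 0) ->
  Ioo T t -> L2 h ->
  zeta t ^+ 2 <= m * tl N (Aop (w t)) (w t) ->
  2 * ga * (- tl N h (Aop (w t)) + qc * tl N h (w t) + delta * S)
    + 3 * ga * al^-1 * tl N h h + be * m * tl N (Aop (w t)) (w t) <= 0 ->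
  2 * dotv (Xv t) (P *m dX t) + ga * (2 * tl N h (wt t))
    <= - (2 * delta) * (qf P (Xv t) + ga * S).
Proof.
move=> Psym al0 be0 ga0 ta0 T1P tT Lh zm Hres; have tT' := Ioo_Ico tT.
have La : L2 (coefa th2 p qt) by exact: coefa_L2.
have Lb := coefb_L2 th2; have pL := phi_L2 heig; have cp := eig_complete heig.
have Lw := L2_w tT'; have LA := L2_Aw tT'.
have := T1P (ext_vec (Xv t) (zeta t) (psi t)).
have RA := normL2_resid pL (eig_orthonormal heig) cp N La.
have RB := normL2_resid pL (eig_orthonormal heig) cp N Lb.
rewrite (@Theta1_quad_tail _ _ _ _ _ _ _ N0 N kphi dkphi Mphi K L delta P al be ga ta _ _
  (Xv t) (zeta t) (psi t) Psym RA RB) KtX (EmX tT) -/(dX t).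
rewrite tail_wt//; set d := derive1 vphi (u t) * du t.
have -> : tl N h (wrhs t) = - tl N h (Aop (w t)) + qc * tl N h (w t)
    + (kphi * u t) * tl N h (coefa th2 p qt) + psi t * tl N h (coefa th2 p qt)
    + d * tl N h b.
  have L1 := L2_lin (-1) qc LA Lw; have L2' := L2_lin (uph t) d La Lb.
  rewrite tailC /wrhs -/d (tail_linl pL _ _ _ L1 L2' Lh) (tail_linl pL _ _ _ LA Lw Lh).
  rewrite (tail_linl pL _ _ _ La Lb Lh) uphE !(tailC _ _ _ h).
  move: (tl N h _) (tl N h _) (tl N h _) (tl N h _) (u t) (psi t) => *; ring.
have Ya := tail_young_scaled N (kphi * u t) al0 Lh La.
have Yp := tail_young_scaled N (psi t) al0 Lh La.
have Yb := tail_young_scaled N d al0 Lh Lb.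
have Rb0 : 0 <= tl N b b by apply: (tail_ge0 pL cp).
have dd : d ^+ 2 <= Mphi ^+ 2 * du t ^+ 2.
  by rewrite /d exprMn ler_wpM2r ?sqr_ge0//; exact: hslope.
have pp := dpsi_le t.
move: Ya Yp Yb Rb0 dd pp zm Hres.
move: (tl N h h) (tl N h b) (tl N h (coefa th2 p qt)) => hh hb ha.
move: (tl N b b) (tl N (coefa th2 p qt) (coefa th2 p qt)) => Rb Ra.
move: (tl N (Aop (w t)) (w t)) (tl N h (Aop (w t))) (tl N h (w t)) => Aw hA hw.
move: (dotv _ _) (qf P _) (u t) (psi t) (zeta t) (du t) => Q1 Q2 uu ps ze dd'.
move: d al^-1 => d ai Ya Yp Yb Rb0 dd pp zm Hres HT.
have H1 : be * ze ^+ 2 <= be * (m * Aw) by rewrite ler_wpM2l// ltW.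
have H2 : ta * ps ^+ 2 <= ta * (dkphi ^+ 2 * uu ^+ 2) by rewrite ler_wpM2l// ltW.
have H3 : ga * (2 * (kphi * uu * ha)) <= ga * (ai * hh + al * (kphi * uu) ^+ 2 * Ra).
  by rewrite ler_wpM2l// ltW.
have H4 : ga * (2 * (ps * ha)) <= ga * (ai * hh + al * ps ^+ 2 * Ra).
  by rewrite ler_wpM2l// ltW.
have H5 : ga * (2 * (d * hb)) <= ga * (ai * hh + al * d ^+ 2 * Rb).
  by rewrite ler_wpM2l// ltW.
have H6 : ga * al * Rb * d ^+ 2 <= ga * al * Rb * (Mphi ^+ 2 * dd' ^+ 2).
  by rewrite ler_wpM2l// !mulr_ge0// ltW.
exact: (lyapunov_balance HT Hres H1 H2 H3 H4 H5 H6).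
Qed.

Lemma zeta_sqr t : Ico T t -> ~~ (M_phi lam phi N == +oo)%E ->
  zeta t ^+ 2 <= fine (M_phi lam phi N) * tl N (Aop (w t)) (w t).
Proof.
move=> tT Moo; have l0 := lam_gt0 heig.
have pos k : 0 <= `|phi k 0| ^+ 2 / lam k by rewrite divr_ge0 ?sqr_ge0// ltW.
have Mlt : (M_phi lam phi N < +oo)%E by rewrite ltey.
have H n := nneseries_fine_ge n pos Mlt.
have := @trace_tail_le _ _ _ _ _ _ _ hth1 hth2 hp hp0 hq hq0 heig lam (fine (M_phi lam phi N)) 1 N
  (w t) (w_domA tT) l0.
rewrite mulr1; apply => //.
- by move=> k _; rewrite mul1r.
- by have := H 0%N; apply: le_trans; rewrite big_geq.
Qed.

Lemma zeta_sqr' t : Ico T t -> (M_phi' lam phi N < +oo)%E ->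
  zeta t ^+ 2 <= fine (M_phi' lam phi N) / lam N `^ (1 / 4) * tl N (Aop (w t)) (w t).
Proof.
move=> tT Mlt; have l0 := lam_gt0 heig.
have l34 k : 0 < lam k `^ (3 / 4) by exact: powR_gt0.
have lN : 0 < lam N `^ (1 / 4) by exact: powR_gt0.
have pos k : 0 <= `|phi k 0| ^+ 2 / lam k `^ (3 / 4) by rewrite divr_ge0 ?sqr_ge0// ltW.
have H n := nneseries_fine_ge n pos Mlt.
apply: (@trace_tail_le _ _ _ _ _ _ _ hth1 hth2 hp hp0 hq hq0 heig (fun k => lam k `^ (3 / 4))
  (fine (M_phi' lam phi N)) (lam N `^ (1 / 4))^-1 N (w t) (w_domA tT) l34) => //.
- move=> k Nk; rewrite [X in _ <= X]mulrC ler_pdivlMr//.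
  rewrite [X in _ <= X](_ : _ = lam k `^ (3 / 4) * lam k `^ (1 / 4)); last first.
    by have [_ E] := pow14 (l0 k); rewrite pow34// -exprSr.
  rewrite ler_wpM2l//; first exact: ltW.
  by apply: ge0_ler_powR; rewrite ?nnegrE ?(ltW (l0 _))// (lam_le heig).
- by have := H 0%N; apply: le_trans; rewrite big_geq.
- by rewrite invr_ge0 ltW.
Qed.

Definition lyap (P : 'M[R]_(dimF N0 N)) (ga : R) (h : R -> R -> R) t : R :=
  qf P (Xv t) + ga * tl N (h t) (w t).

Section LyapunovL2.
Context (P : 'M[R]_(dimF N0 N)) (al be ga ta : R).
Context (Psym : P^T = P) (al0 : 0 < al) (be0 : 0 < be) (ga0 : 0 < ga) (ta0 : 0 < ta).
Context (T1P : forall v, qf (T1 P al be ga ta) v <= 0).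
Let M' := fine (M_phi' lam phi N).
Context (Moo : (M_phi' lam phi N < +oo)%E).
Context (Th2 : 2 * ga * (- lam N + qc + delta + 3 / (2 * al)) + be * M' * lam N `^ (3 / 4) <= 0).
Context (Th3 : 0 <= 2 * ga - be * M' / lam N `^ (1 / 4)).

(** Let x be the tail of <A w, w> and y that of <w, w>. In the residual, x has as coefficient the
    opposite of the quantity in [Th3], hence a nonpositive one, so x may be replaced by its lower
    bound lam N y. As lam^(3/4) = lam / lam^(1/4), what remains is the quantity in [Th2] times y. *)
Lemma lyapunov_L2 t : Ioo T t ->
  is_derive t (1 : R) (lyap P ga w)
    (2 * dotv (Xv t) (P *m dX t) + ga * (2 * tl N (w t) (wt t))) /\
  2 * dotv (Xv t) (P *m dX t) + ga * (2 * tl N (w t) (wt t))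
    <= - (2 * delta) * lyap P ga w t.
Proof.
move=> tT; have tT' := Ioo_Ico tT; split.
  apply: is_derive_add; first exact: qf_is_derive.
  by apply: is_derive_mulc; exact: tail_w_is_derive.
have dw := w_domA tT'; have Lw := L2_w tT'; have l0 := lam_gt0 heig N.
apply: (lyapunov_derivative Psym al0 be0 ga0 ta0 T1P tT Lw (zeta_sqr' tT' Moo)).
have y0 := tail_ge0 (phi_L2 heig) (eig_complete heig) N Lw.
have xy := tail_lam1 hth1 hp hq heig N dw.
rewrite (tailC _ _ (w t)); move: Th2 Th3 y0 xy; rewrite -/M'.
have lN : 0 < lam N `^ (1 / 4) by exact: powR_gt0.
have -> : lam N `^ (3 / 4) = lam N / lam N `^ (1 / 4).
  have [_ E] := pow14 l0; rewrite pow34// [X in _ = X / _]E; field; exact: lt0r_neq0.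
have -> : 3 / (2 * al) = 3 / 2 * al^-1 by field; exact: lt0r_neq0.
move: (tl N _ _) (tl N _ _) M' al^-1 (lam N `^ (1 / 4))^-1 => x y M ai li T2 T3 y0 xy.
have H1 : (2 * ga - be * M * li) * (lam N * y) <= (2 * ga - be * M * li) * x.
  by rewrite ler_wpM2l.
have H2 : (2 * ga * (- lam N + qc + delta + 3 / 2 * ai) + be * M * (lam N * li)) * y <= 0.
  by rewrite mulr_le0_ge0.
move: H1 H2; lra.
Qed.

End LyapunovL2.

Section LyapunovH1.
Context (P : 'M[R]_(dimF N0 N)) (al be ga ta : R).
Context (Psym : P^T = P) (al0 : 3 / 2 < al) (be0 : 0 < be) (ga0 : 0 < ga) (ta0 : 0 < ta).
Context (T1P : forall v, qf (T1 P al be ga ta) v <= 0).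
Let M := fine (M_phi lam phi N).
Context (Moo : (M_phi lam phi N < +oo)%E).
Context (Th2 : 2 * ga * (- (1 - 3 / (2 * al)) * lam N + qc + delta) + be * M <= 0).

(** Now X is the tail of <A w, A w> and x that of <A w, w>. The condition alpha > 3/2 makes the
    coefficient -2 gamma (1 - 3 / (2 alpha)) of X negative; X >= lam N x then reduces the residual
    to the quantity in [Th2] times x. *)
Lemma lyapunov_H1 t : Ioo T t ->
  is_derive t (1 : R) (lyap P ga (fun s => Aop (w s)))
    (2 * dotv (Xv t) (P *m dX t) + ga * (2 * tl N (Aop (w t)) (wt t))) /\
  2 * dotv (Xv t) (P *m dX t) + ga * (2 * tl N (Aop (w t)) (wt t))
    <= - (2 * delta) * lyap P ga (fun s => Aop (w s)) t.
Proof.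
move=> tT; have tT' := Ioo_Ico tT; split.
  apply: is_derive_add; first exact: qf_is_derive.
  by apply: is_derive_mulc; exact: tail_Aw_is_derive.
have dw := w_domA tT'; have LA := L2_Aw tT'; have l0 := lam_gt0 heig N.
have al0' : 0 < al by apply: lt_trans al0; rewrite divr_gt0.
have zz : zeta t ^+ 2 <= M * tl N (Aop (w t)) (w t).
  by apply: zeta_sqr => //; rewrite -ltey.
apply: (lyapunov_derivative Psym al0' be0 ga0 ta0 T1P tT LA zz).
have x0 := tail_opA_ge0 hth1 hp hq heig N dw.
have xX := tail_lam2 hth1 hp hq heig N dw.
move: Th2 x0 xX.
have ai1 : 0 <= 1 - 3 / 2 * al^-1.
  by rewrite subr_ge0 ler_pdivrMr// mul1r ltW.
have -> : 3 / (2 * al) = 3 / 2 * al^-1 by field; exact: lt0r_neq0.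
move: ai1; move: (tl N _ _) (tl N _ _) M al^-1 => X x M1 ai ai1 T2 x0 xX.
have H1 : 2 * ga * (1 - 3 / 2 * ai) * (lam N * x) <= 2 * ga * (1 - 3 / 2 * ai) * X.
  by rewrite ler_wpM2l// !mulr_ge0// ltW.
have H2 : (2 * ga * (- (1 - 3 / 2 * ai) * lam N + qc + delta) + be * M1) * x <= 0.
  by rewrite mulr_le0_ge0.
move: H1 H2; lra.
Qed.

End LyapunovH1.

(** * Comparison of the Lyapunov functions with the norms *)

Definition modes t : R := \sum_(k < N) (zh k t ^+ 2 + zcoef k t ^+ 2).

Lemma dotv_Xv t : dotv (Xv t) (Xv t) =
  \sum_(k < N0) (zh k t ^+ 2 + (zcoef k t - zh k t) ^+ 2) +
  \sum_(k < N - N0) ((zh (N0 + k)%N t / lam (N0 + k)%N) ^+ 2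
    + lam (N0 + k)%N * (zcoef (N0 + k)%N t - zh (N0 + k)%N t) ^+ 2).
Proof.
rewrite /Xv !dotv_col !dotvE -!big_split/=; congr (_ + _).
  by apply: eq_bigr => k _; rewrite !mxE -!expr2.
apply: eq_bigr => k _; rewrite !mxE -!expr2; congr (_ + _).
by rewrite exprMn sqr_sqrtr// ltW// (lam_gt0 heig).
Qed.

(** A common bound for 1, lam k and the inverse of lam k over k < N. The final constant may depend
    on N, so a crude sum is enough. *)
Definition lam_ratio : R := 1 + \sum_(k < N) (lam k + (lam k)^-1).
Definition Ceq : R := 4 * lam_ratio ^+ 2.

Lemma Ceq_ge0 : 0 <= Ceq. Proof. by rewrite mulr_ge0 ?sqr_ge0. Qed.

Lemma lam_ratio_ge k : (k < N)%N ->
  [/\ 1 <= lam_ratio, lam k <= lam_ratio & (lam k)^-1 <= lam_ratio].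
Proof.
move=> kN; have l0 n := lam_gt0 heig n; have i0 n : 0 < (lam n)^-1 by rewrite invr_gt0.
have := l0 k; have := i0 k; rewrite /lam_ratio (bigD1 (Ordinal kN))//=.
set S := \sum_(i < N | _) _; have : 0 <= S by rewrite sumr_ge0// => i _; rewrite addr_ge0// ltW.
by move: (lam k) (lam k)^-1 S => *; split; lra.
Qed.

Lemma mode_low_equiv k (x y : R) : (k < N)%N ->
  x ^+ 2 + (y - x) ^+ 2 <= Ceq * (x ^+ 2 + y ^+ 2) /\
  x ^+ 2 + y ^+ 2 <= Ceq * (x ^+ 2 + (y - x) ^+ 2).
Proof.
move=> kN; have [c1 _ _] := lam_ratio_ge kN.
by have := mode_equiv x y ltr01 c1 c1; rewrite invr1 mulr1 mul1r; apply.
Qed.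

Lemma mode_high_equiv k (x y : R) : (k < N)%N ->
  (x / lam k) ^+ 2 + lam k * (y - x) ^+ 2 <= Ceq * (x ^+ 2 + y ^+ 2) /\
  x ^+ 2 + y ^+ 2 <= Ceq * ((x / lam k) ^+ 2 + lam k * (y - x) ^+ 2).
Proof.
move=> kN; have [c1 cl ci] := lam_ratio_ge kN.
exact: (mode_equiv x y (lam_gt0 heig k) c1 cl ci).
Qed.

Lemma dotv_Xv_le t : dotv (Xv t) (Xv t) <= Ceq * modes t.
Proof.
rewrite dotv_Xv /modes (sum_split_N (fun k => zh k t ^+ 2 + zcoef k t ^+ 2)) mulrDr !mulr_sumr.
apply: lerD; apply: ler_sum => k _.
  by have kN := leq_trans (ltn_ord k) hN; exact: (mode_low_equiv _ _ kN).1.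
by have /andP[_ kN] := high_ltn k; exact: (mode_high_equiv _ _ kN).1.
Qed.

Lemma modes_le t : modes t <= Ceq * dotv (Xv t) (Xv t).
Proof.
rewrite dotv_Xv /modes (sum_split_N (fun k => zh k t ^+ 2 + zcoef k t ^+ 2)) mulrDr !mulr_sumr.
apply: lerD; apply: ler_sum => k _.
  by have kN := leq_trans (ltn_ord k) hN; exact: (mode_low_equiv _ _ kN).2.
by have /andP[_ kN] := high_ltn k; exact: (mode_high_equiv _ _ kN).2.
Qed.

Definition zsum t : R := \sum_(k < N) zh k t ^+ 2.
(** Sees the nonlinearity only through [kphi] and [dkphi], like [Clow] and [Cup] built on it; this
    makes the final constant uniform over the admissible nonlinearities. *)
Definition Cu : R := 2 * (kphi ^+ 2 + dkphi ^+ 2) * dotv K^T K^T.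
Local Notation BB := (ip b b).

Lemma Cu_ge0 : 0 <= Cu.
Proof. by rewrite /Cu mulr_ge0 ?dotvv_ge0// mulr_ge0// addr_ge0 ?sqr_ge0. Qed.

Lemma zsum_ge0 t : 0 <= zsum t.
Proof. by rewrite sumr_ge0// => k _; exact: sqr_ge0. Qed.

Lemma modesE t : modes t = zsum t + \sum_(k < N) zcoef k t ^+ 2.
Proof. by rewrite /modes big_split. Qed.

Lemma zsum_modes t : zsum t <= modes t.
Proof. by rewrite modesE lerDl sumr_ge0// => k _; exact: sqr_ge0. Qed.

Lemma u_sqr t : u t ^+ 2 <= dotv K^T K^T * zsum t.
Proof.
have -> : u t = dotv K^T (Zlow t) by rewrite -KZlow /dotv trmxK.
apply: (le_trans (dotv_CS _ _)); rewrite ler_wpM2l ?dotvv_ge0//.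
rewrite dotvE /zsum (sum_split_N (fun k => zh k t ^+ 2)).
rewrite [leLHS](_ : _ = \sum_(k < N0) zh k t ^+ 2); last first.
  by apply: eq_bigr => k _; rewrite !mxE expr2.
by rewrite lerDl sumr_ge0// => k _; exact: sqr_ge0.
Qed.

Lemma uph_sqr t : uph t ^+ 2 <= Cu * zsum t.
Proof.
have H0 := u_sqr t; have := dpsi_le t; rewrite uphE /Cu.
move: H0; move: (psi t) => y; move: (u t) (dotv _ _) (zsum t) => x C S xS yx.
have H1 : kphi ^+ 2 * x ^+ 2 <= kphi ^+ 2 * (C * S) by rewrite ler_wpM2l ?sqr_ge0.
have H2 : dkphi ^+ 2 * x ^+ 2 <= dkphi ^+ 2 * (C * S) by rewrite ler_wpM2l ?sqr_ge0.
have H : (kphi * x + y) ^+ 2 <= 2 * (kphi ^+ 2 * x ^+ 2) + 2 * y ^+ 2.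
  have := sqr_ge0 (kphi * x - y); rewrite -subr_ge0 => G.
  by rewrite -subr_ge0 [X in 0 <= X](_ : _ = (kphi * x - y) ^+ 2); [move: G; rewrite subr0|ring].
apply: (le_trans H); move: H1 H2 yx.
move: (kphi ^+ 2) (dkphi ^+ 2) => k2 d2; lra.
Qed.

Lemma BB_ge0 : 0 <= BB. Proof. exact: ip_ge0. Qed.

Lemma bessel f : L2 f -> \sum_(k < N) ip f (phi k) ^+ 2 <= ip f f.
Proof.
move=> Lf; have := tail_ge0 (phi_L2 heig) (eig_complete heig) N Lf.
by rewrite /tail subr_ge0.
Qed.

(** Passing between z and w costs a multiple of u_phi^2, which the sector condition bounds by the
    observer modes. *)
Lemma ip_wz t : Ico T t ->
  ip (w t) (w t) <= 2 * ip (z t) (z t) + 2 * BB * (Cu * zsum t) /\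
  ip (z t) (z t) <= 2 * ip (w t) (w t) + 2 * BB * (Cu * zsum t).
Proof.
move=> tT; have Lz := L2_z tT; have Lw := L2_w tT; have Lb := coefb_L2 th2.
have wE' : w t = (fun x => 1 * z t x + uph t * b x).
  by apply/funext => x; rewrite /hom_state; ring.
have E1 := ip_expand 1 (uph t) Lz Lb; have E2 := ip_expand 1 (- uph t) Lz Lb.
have E3 := ip_expand 1 (- uph t) Lw Lb; have E4 := ip_expand 1 (uph t) Lw Lb.
rewrite -wE' in E1; rewrite -zE in E3.
have G2 := ip_ge0 (fun x => 1 * z t x + - uph t * b x); rewrite E2 in G2.
have G4 := ip_ge0 (fun x => 1 * w t x + uph t * b x); rewrite E4 in G4.
have U : BB * uph t ^+ 2 <= BB * (Cu * zsum t) by rewrite ler_wpM2l ?BB_ge0// uph_sqr.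
split; [rewrite E1|rewrite E3]; move: G2 G4 U.
  by move: (ip (z t) (z t)) (ip (z t) b) BB (uph t) => *; lra.
by move: (ip (w t) (w t)) (ip (w t) b) BB (uph t) => *; lra.
Qed.

Lemma wmodes_le t : Ico T t ->
  \sum_(k < N) wcoef k t ^+ 2 <= (2 + 2 * BB * Cu) * modes t.
Proof.
move=> tT; have Lb := coefb_L2 th2.
have H : \sum_(k < N) wcoef k t ^+ 2 <=
    2 * (\sum_(k < N) zcoef k t ^+ 2) + 2 * uph t ^+ 2 * (\sum_(k < N) ip b (phi k) ^+ 2).
  rewrite !mulr_sumr -big_split/=; apply: ler_sum => k _; rewrite wcoefE// -/(bn th2 phi k) /bn.
  by have := sqr_ge0 (zcoef k t - ip b (phi k) * uph t); nra.
apply: (le_trans H); rewrite [X in _ <= X]mulrDl; apply: lerD.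
  by rewrite ler_pM2l// modesE lerDr zsum_ge0.
have := uph_sqr t; have := bessel Lb; have := zsum_modes t; have := zsum_ge0 t.
have := sqr_ge0 (uph t); have := BB_ge0; have := Cu_ge0.
move: (uph t ^+ 2) BB (modes t) (zsum t) Cu (\sum_(k < N) _) => U B D Z C Q C0 B0 U0 Z0 ZD QB UCZ.
have H1 : U * Q <= U * B by rewrite ler_wpM2l.
have H2 : U * B <= C * Z * B by rewrite ler_wpM2r.
have H3 : C * B * Z <= C * B * D by rewrite ler_wpM2l// mulr_ge0.
lra.
Qed.

Section Bounds.
Context (P : 'M[R]_(dimF N0 N)) (ga c1 c2 : R).
Context (ga0 : 0 < ga) (c10 : 0 < c1) (c20 : 0 < c2) (P0 : forall v, 0 <= qf P v).
Context (Pc1 : forall v, dotv v v <= c1 * qf P v) (Pc2 : forall v, qf P v <= c2 * dotv v v).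

Definition Clow : R := (5 + 6 * BB * Cu) * (Ceq * c1) + 2 / ga.
Definition Cup : R := c2 * Ceq + ga * (2 + 2 * BB * Cu).

Lemma modes_qf t : modes t <= Ceq * c1 * qf P (Xv t).
Proof.
apply: (le_trans (modes_le t)); rewrite -mulrA ler_wpM2l ?Ceq_ge0//.
Qed.

Lemma low_L2 t : Ico T t ->
  ip (z t) (z t) + zsum t <= Clow * lyap P ga w t.
Proof.
move=> tT; have [_ H] := ip_wz tT; have W := wmodes_le tT.
have wE2 : ip (w t) (w t) = \sum_(k < N) wcoef k t ^+ 2 + tl N (w t) (w t).
  by rewrite /tail addrC subrK.
have t0 := tail_ge0 (phi_L2 heig) (eig_complete heig) N (L2_w tT).
have D := modes_qf t; have Z := zsum_modes t.
move: H W D Z t0 (zsum_ge0 t) (P0 (Xv t)) BB_ge0 Cu_ge0 Ceq_ge0; rewrite wE2 /Clow /lyap.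
have : ga / ga = 1 by rewrite divff// lt0r_neq0.
have : 0 < ga^-1 by rewrite invr_gt0.
move: (ip (z t) (z t)) (\sum_(k < N) _) (tl N _ _) (zsum t) (modes t) (qf P _) BB Cu Ceq ga^-1.
move=> zz W S Z D Q B C E gi gi0 gg H WD DQ ZD S0 Z0 Q0 B0 C0 E0.
have BC : 0 <= B * C by rewrite mulr_ge0.
have H1 : B * C * Z <= B * C * D by rewrite ler_wpM2l.
have H2 : (5 + 6 * (B * C)) * D <= (5 + 6 * (B * C)) * (E * c1 * Q).
  by rewrite ler_wpM2l// addr_ge0// mulr_ge0.
have H3 : 0 <= 2 * gi * Q by rewrite !mulr_ge0// ltW.
have H4 : 0 <= (5 + 6 * (B * C)) * (E * c1) * (ga * S).
  by rewrite !mulr_ge0// ?addr_ge0 ?mulr_ge0// ltW.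
have H5 : 2 * gi * (ga * S) = 2 * S by rewrite mulrA -(mulrA 2) (mulrC gi) gg mulr1.
move: H WD ZD H1 H2 H3 H4 H5; lra.
Qed.

Lemma up_L2 t : Ico T t ->
  lyap P ga w t <= Cup * (ip (z t) (z t) + zsum t).
Proof.
move=> tT; have [H _] := ip_wz tT.
have B1 : modes t <= ip (z t) (z t) + zsum t by rewrite modesE addrC lerD2r; exact: bessel (L2_z tT).
have B2 : tl N (w t) (w t) <= ip (w t) (w t).
  by rewrite /tail gerBl sumr_ge0// => k _; rewrite -expr2 sqr_ge0.
have X1 := dotv_Xv_le t; have X2 := Pc2 (Xv t).
move: H B1 B2 X1 X2 (zsum_ge0 t) (ip_ge0 (z t)) BB_ge0 Cu_ge0 Ceq_ge0; rewrite /Cup /lyap.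
move: (ip (z t) (z t)) (ip (w t) (w t)) (tl N _ _) (zsum t) (modes t) (qf P _) (dotv _ _) BB Cu Ceq.
move=> zz ww S Z D Q X B C E H B1 B2 X1 X2 Z0 zz0 B0 C0 E0.
have H1 : c2 * X <= c2 * (E * D) by rewrite ler_pM2l.
have H2 : c2 * E * D <= c2 * E * (zz + Z) by rewrite ler_wpM2l// mulr_ge0// ltW.
have H3 : ga * S <= ga * (2 * zz + 2 * B * (C * Z)) by rewrite ler_pM2l//; lra.
have H4 : 0 <= ga * (2 * Z + 2 * (B * C) * zz) by rewrite !mulr_ge0 ?addr_ge0 ?mulr_ge0// ltW.
move: H1 H2 H3 H4 X2; lra.
Qed.

Lemma lyap_ge0 (h : R -> R -> R) t : 0 <= tl N (h t) (w t) -> 0 <= lyap P ga h t.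
Proof. by move=> t0; rewrite addr_ge0// mulr_ge0// ltW. Qed.

Lemma energy_le t : Ico T t ->
  energy th2 lam phi N K vphi z zh t <=
  (lam N * (2 + 2 * BB * Cu) * (Ceq * c1) + Ceq * c1 + ga^-1)
    * lyap P ga (fun s => Aop (w s)) t.
Proof.
move=> tT; have dw := w_domA tT; rewrite /energy -/(zsum t).
have E1 := normL2_opA_sqrt hth1 hp hq heig dw.
have E2 : ip (Aop (w t)) (w t) = \sum_(k < N) lam k * wcoef k t ^+ 2 + tl N (Aop (w t)) (w t).
  rewrite /tail addrC; under eq_bigr do rewrite (opA_coef hth1 hp hq heig)// -mulrA -expr2.
  by rewrite subrK.
have E3 : \sum_(k < N) lam k * wcoef k t ^+ 2 <= lam N * \sum_(k < N) wcoef k t ^+ 2.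
  rewrite mulr_sumr; apply: ler_sum => k _; rewrite ler_wpM2r ?sqr_ge0//.
  by apply: (lam_le heig); exact: ltnW.
have W := wmodes_le tT; have t0 := tail_opA_ge0 hth1 hp hq heig N dw.
have D := modes_qf t; have Z := zsum_modes t; have l0 := lam_gt0 heig N.
move: E1 E3 W D Z t0 l0 (zsum_ge0 t) (P0 (Xv t)) BB_ge0 Cu_ge0 Ceq_ge0; rewrite E2 /lyap.
have gg : ga^-1 * ga = 1 by rewrite mulVf// lt0r_neq0.
have gi0 : 0 < ga^-1 by rewrite invr_gt0.
move: gg gi0; move: (normL2 _ ^+ 2) => nn.
move: (\sum_(k < N) lam k * wcoef k t ^+ 2) (\sum_(k < N) wcoef k t ^+ 2) (tl N _ _) (zsum t) (modes t) (qf P _) BB Cu Ceq ga^-1 (lam N).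
move=> LW W S Z D Q B C E gi l gg gi0 E1 E3 WD DQ ZD S0 l0 Z0 Q0 B0 C0 E0.
have BC : 0 <= 2 + 2 * B * C by rewrite addr_ge0 ?mulr_ge0.
have H1 : l * W <= l * ((2 + 2 * B * C) * D) by rewrite ler_pM2l.
have H2 : l * (2 + 2 * B * C) * D <= l * (2 + 2 * B * C) * (E * c1 * Q).
  by rewrite ler_wpM2l// mulr_ge0// ltW.
have H3 : 0 <= gi * Q by rewrite mulr_ge0// ltW.
have H4 : 0 <= (l * (2 + 2 * B * C) * (E * c1) + E * c1) * (ga * S).
  by rewrite !mulr_ge0 ?addr_ge0// ?mulr_ge0// ltW.
have H5 : gi * (ga * S) = S by rewrite mulrA gg mul1r.
move: E1 E3 H1 H2 H3 H4 H5 DQ ZD; lra.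
Qed.

End Bounds.

(** * Continuity in time, initial time included *)

Section Continuity.
Context (t : R) (tT : Ico T t).
Let F := within (Ico T) (nbhs t).
Let FF : Filter F := within_filter _ _.

Lemma cvg_sumf n (f : 'I_n -> R -> R) (l : 'I_n -> R) :
  (forall i, f i s @[s --> F] --> l i) -> \sum_i f i s @[s --> F] --> \sum_i l i.
Proof. by move=> H; apply: cvg_big => // -[x y]; exact: add_continuous. Qed.

Lemma zh_cvg n : (n < N)%N -> zh n s @[s --> F] --> zh n t.
Proof. by move=> nN; have := cs_zh_C0 hsol nN => /subspace_continuousP; apply. Qed.

Lemma u_cvg : u s @[s --> F] --> u t.
Proof.
apply: cvg_sumf => i; apply: cvgMr; apply: zh_cvg; exact: leq_trans hN.
Qed.

Lemma uph_cvg : uph s @[s --> F] --> uph t.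
Proof.
have H : {for u t, continuous vphi}.
  by apply: differentiable_continuous; apply/derivable1_diffP; exact: vphi'.
exact: (continuous_cvg _ H u_cvg).
Qed.

Lemma near_Ico : \forall s \near F, Ico T s.
Proof. exact: withinT. Qed.

Lemma wcoef_cvg n : wcoef n s @[s --> F] --> wcoef n t.
Proof.
apply: cvg_ip.
- by apply: filterS near_Ico => s; exact: L2_w.
- by apply: filterS near_Ico => s _; exact: phi_L2 heig n.
- exact: L2_w.
- exact: phi_L2 heig n.
- exact: (cs_w_C0 hsol).2.
- exact: cst_cvgL2.
Qed.

Lemma ipww_cvg : ip (w s) (w s) @[s --> F] --> ip (w t) (w t).
Proof.
have H : \forall s \near F, L2 (w s) by apply: filterS near_Ico => s; exact: L2_w.
have C := (cs_w_C0 hsol).2 t tT.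
by apply: cvg_ip => //; exact: L2_w.
Qed.

Lemma zcoef_cvg n : zcoef n s @[s --> F] --> zcoef n t.
Proof.
have E s : Ico T s -> wcoef n s - bn th2 phi n * uph s = zcoef n s.
  by move=> sT; rewrite wcoefE// addrK.
have H : wcoef n s - bn th2 phi n * uph s @[s --> F] --> wcoef n t - bn th2 phi n * uph t.
  by apply: cvgB; [exact: wcoef_cvg|apply: cvgMr; exact: uph_cvg].
rewrite -E//; apply: cvg_trans H.
by apply: near_eq_cvg; apply: filterS near_Ico => s /E.
Qed.

Lemma cvg_col_mx m n (a : R -> 'cV[R]_m) (c : R -> 'cV[R]_n) :
  (forall i, a s i 0 @[s --> F] --> a t i 0) ->
  (forall i, c s i 0 @[s --> F] --> c t i 0) ->
  forall i, col_mx (a s) (c s) i 0 @[s --> F] --> col_mx (a t) (c t) i 0.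
Proof.
move=> Ha Hc i; case: (splitP i) => j ij.
  have -> : i = lshift n j by exact: val_inj.
  rewrite col_mxEu; apply: cvg_trans (Ha j); apply: near_eq_cvg.
  by apply: filterS near_Ico => s _; rewrite col_mxEu.
have -> : i = rshift m j by exact: val_inj.
rewrite col_mxEd; apply: cvg_trans (Hc j); apply: near_eq_cvg.
by apply: filterS near_Ico => s _; rewrite col_mxEd.
Qed.

Lemma Xv_cvg i : Xv s i 0 @[s --> F] --> Xv t i 0.
Proof.
move: i; apply: cvg_col_mx; apply: cvg_col_mx => i; under eq_cvg do rewrite mxE; rewrite mxE.
- by apply: zh_cvg; exact: leq_trans hN.
- by apply: cvgB; [exact: zcoef_cvg|apply: zh_cvg; exact: leq_trans hN].
- by have /andP[_ iN] := high_ltn i; apply: cvgMl; exact: zh_cvg.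
- have /andP[_ iN] := high_ltn i; apply: cvgMr.
  by apply: cvgB; [exact: zcoef_cvg|exact: zh_cvg].
Qed.

Lemma qf_cvg (P : 'M[R]_(dimF N0 N)) : qf P (Xv s) @[s --> F] --> qf P (Xv t).
Proof.
under eq_cvg do rewrite qfE dotvE; rewrite qfE dotvE.
apply: cvg_sumf => i; apply: cvgM; first exact: Xv_cvg.
under eq_cvg do rewrite mxE; rewrite mxE; apply: cvg_sumf => j.
by apply: cvgMr; exact: Xv_cvg.
Qed.

(** The function built on w is continuous down to t = 0. For the one built on A w, continuity will
    be drawn from differentiability at positive times. *)
Lemma lyap_cvg P ga : lyap P ga w s @[s --> F] --> lyap P ga w t.
Proof.
apply: cvgD; first exact: qf_cvg.
apply: cvgMr; apply: cvgB; first exact: ipww_cvg.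
by apply: cvg_sumf => i; apply: cvgM; exact: wcoef_cvg.
Qed.

Lemma energy_cvg : energy th2 lam phi N K vphi z zh s @[s --> F] -->
  energy th2 lam phi N K vphi z zh t.
Proof.
have [HL HC] := cs_sqrtAw_C0 hsol.
apply: cvgD.
  under eq_cvg do rewrite expr2; rewrite expr2.
  have H : normL2 (opA_sqrt lam phi (w s)) @[s --> F] --> normL2 (opA_sqrt lam phi (w t)).
    apply: cvg_normL2; [|exact: HL|exact: HC].
    by apply: filterS near_Ico => s; exact: HL.
  exact: cvgM.
apply: cvg_sumf => i; under eq_cvg do rewrite expr2; rewrite expr2.
by apply: cvgM; exact: zh_cvg.
Qed.

End Continuity.

Lemma itv_Ico (c : R) : Ico T c -> `[0, c] `<=` Ico T.
Proof.
move=> [_ cT] s /=; rewrite in_itv/= => /andP[s0 sc]; split=> //.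
by apply: le_lt_trans cT; rewrite lee_fin.
Qed.

Lemma BCu_ge0 : 0 <= 2 + 2 * ip b b * Cu.
Proof.
have := mulr_ge0 BB_ge0 Cu_ge0; move: (ip b b) Cu => B C H; rewrite -mulrA; lra.
Qed.

Lemma Clow_gt0 (ga c1 : R) : 0 < ga -> 0 < c1 -> 0 < Clow ga c1.
Proof.
move=> ga0 c10; rewrite /Clow.
have := mulr_ge0 Ceq_ge0 (ltW c10); have : 0 < 2 / ga by rewrite divr_gt0.
have := mulr_ge0 BB_ge0 Cu_ge0; rewrite -mulrA.
move: (Ceq * c1) (2 / ga) (ip b b * Cu) => x y v v0 y0 x0.
by apply: ltr_wpDl => //; rewrite mulr_ge0//; lra.
Qed.

Lemma Cup_gt0 (ga c2 : R) : 0 < ga -> 0 < c2 -> 0 < Cup ga c2.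
Proof.
move=> ga0 c20; rewrite /Cup; have := mulr_ge0 (ltW c20) Ceq_ge0.
have := mulr_ge0 BB_ge0 Cu_ge0; rewrite -mulrA.
move: (c2 * Ceq) (ip b b * Cu) => x v v0 x0.
by apply: ltr_wpDl => //; rewrite mulr_gt0//; lra.
Qed.

(** * Decay in norm and boundedness of the energy *)

Section Conclusions.
Context (P : 'M[R]_(dimF N0 N)) (al be ga ta c1 c2 : R).
Context (Psym : P^T = P) (be0 : 0 < be) (ga0 : 0 < ga) (ta0 : 0 < ta).
Context (T1P : forall v, qf (T1 P al be ga ta) v <= 0).
Context (c10 : 0 < c1) (c20 : 0 < c2) (P0 : forall v, 0 <= qf P v).
Context (Pc1 : forall v, dotv v v <= c1 * qf P v) (Pc2 : forall v, qf P v <= c2 * dotv v v).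

Lemma decay_L2 (al0 : 0 < al) (Moo : (M_phi' lam phi N < +oo)%E)
  (Th2 : 2 * ga * (- lam N + qc + delta + 3 / (2 * al))
    + be * fine (M_phi' lam phi N) * lam N `^ (3 / 4) <= 0)
  (Th3 : 0 <= 2 * ga - be * fine (M_phi' lam phi N) / lam N `^ (1 / 4)) t : Ico T t ->
  ip (z t) (z t) + zsum t <=
  Clow ga c1 * Cup ga c2 * expR (- (2 * delta) * t) * (ip (z 0) (z 0) + zsum 0).
Proof.
move=> tT; have [t0 tT'] := tT.
have sI s : 0 < s -> s < t -> Ioo T s.
  by move=> s0 st; split=> //; apply: lt_trans tT'; rewrite lte_fin.
have T0 : Ico T 0 by split=> //; apply: le_lt_trans tT'; rewrite lee_fin.
have LY s (s0 : 0 < s) (st : s < t) := lyapunov_L2 Psym al0 be0 ga0 ta0 T1P Moo Th2 Th3 (sI s s0 st).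
have G := @gronwall_decay _ (lyap P ga w) _ (2 * delta) 0 t t0 _
  (fun s s0 st => (LY s s0 st).1) (fun s s0 st => (LY s s0 st).2).
have C0 : 0 <= Clow ga c1.
  by rewrite ltW// Clow_gt0.
apply: (le_trans (low_L2 ga0 c10 P0 Pc1 tT)); rewrite -!mulrA ler_wpM2l//.
have {}G := G (continuous_subspaceW (itv_Ico tT) _); rewrite subr0 in G.
apply: (le_trans (G _)).
  by apply/subspace_continuousP => s sT; exact: lyap_cvg.
rewrite mulrCA ler_wpM2l ?expR_ge0//.
exact: (up_L2 ga0 c20 Pc2 T0).
Qed.

(** The interval is cut at a positive time t0. Up to t0 the energy is continuous on a compact
    interval; after t0 it is at most a multiple of the Lyapunov function built on A w, which is
    nonincreasing as delta > 0. The bound may depend on the trajectory, since it is only opposed to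
    blow-up. *)
Lemma energy_bounded (al0 : 3 / 2 < al) (Moo : (M_phi lam phi N < +oo)%E)
  (delta0 : 0 < delta)
  (Th2 : 2 * ga * (- (1 - 3 / (2 * al)) * lam N + qc + delta)
    + be * fine (M_phi lam phi N) <= 0) t0 : Ioo T t0 ->
  exists B, forall t, Ico T t -> energy th2 lam phi N K vphi z zh t <= B.
Proof.
move=> t0T; have [t00 _] := t0T.
have LY s (sT : Ioo T s) := lyapunov_H1 Psym al0 be0 ga0 ta0 T1P Moo Th2 sT.
have cE : {within `[0, t0], continuous (energy th2 lam phi N K vphi z zh)}.
  apply: continuous_subspaceW (itv_Ico (Ioo_Ico t0T)) _.
  by apply/subspace_continuousP => s sT; exact: energy_cvg.
have [c _ Hc] := EVT_max (ltW t00) cE.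
pose V := lyap P ga (fun s => Aop (w s)).
pose C := lam N * (2 + 2 * ip b b * Cu) * (Ceq * c1) + Ceq * c1 + ga^-1.
have C0 : 0 <= C.
  have := ltW (lam_gt0 heig N); have := BCu_ge0; have := mulr_ge0 Ceq_ge0 (ltW c10).
  have : 0 <= ga^-1 by rewrite invr_ge0 ltW.
  rewrite /C; move: (Ceq * c1) ga^-1 (2 + _) (lam N) => x y v r y0 x0 v0 r0.
  by rewrite !addr_ge0// !mulr_ge0.
exists (Num.max (energy th2 lam phi N K vphi z zh c) (C * V t0)) => t tT.
rewrite le_max; have [tt0|tt0] := leP t t0.
  by rewrite Hc// in_itv/= tt0 tT.1.
apply/orP; right.
have sI s : t0 <= s -> s <= t -> Ioo T s.
  move=> s0 st; split; first exact: lt_le_trans s0.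
  by apply: le_lt_trans tT.2; rewrite lee_fin.
apply: (le_trans (energy_le ga0 c10 P0 Pc1 tT)); rewrite -/C -/V ler_wpM2l//.
have cV : {within `[t0, t], continuous V}.
  apply/subspace_continuousP => s /=; rewrite in_itv/= => /andP[s0 st].
  apply: cvg_trans (is_derive_cvg (LY s (sI s s0 st)).1); apply: cvg_app.
  exact: cvg_within.
have := @gronwall_decay _ V _ (2 * delta) t0 t (ltW tt0) cV
  (fun s s0 st => (LY s (sI s (ltW s0) (ltW st))).1) (fun s s0 st => (LY s (sI s (ltW s0) (ltW st))).2).
move=> H; apply: (le_trans H); rewrite -[leRHS]mul1r ler_wpM2r//.
  apply: (lyap_ge0 ga0 P0).
  by apply: (tail_opA_ge0 hth1 hp hq heig); apply: w_domA; exact: Ioo_Ico.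
rewrite -expR0 ler_expR mulNr oppr_le0 mulr_ge0// ?subr_ge0 ?(ltW tt0)//.
by rewrite mulr_ge0// ltW.
Qed.

End Conclusions.

End ClosedLoopTrajectory.

(** * The nonlinearity *)

Section Nonlinearity.
Context {R : realType}.
Local Notation mu := (@lebesgue_measure R).
Context (kphi dkphi Mphi : R) (vphi : R -> R).
Context (nl : admissible_nonlinearity kphi dkphi Mphi vphi).

Lemma nl_dist x : x != 0 -> `|vphi x - kphi * x| <= dkphi * `|x|.
Proof.
move=> x0; have /andP[] := nl_sector nl x; rewrite ler_norml.
case: (ltrgt0P x) x0 => // [x0|x0] _; first by rewrite gtr0_sg//; lra.
by rewrite ltr0_sg//; lra.
Qed.

(** At x = 0 the sector condition reads 0 <= 0 <= 0, because the sign is 0 there; the value comes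
    from continuity and the condition at x != 0. *)
Lemma nl_zero : vphi 0 = 0.
Proof.
have cv : vphi x @[x --> 0^'] --> vphi 0.
  apply: cvg_trans (_ : vphi x @[x --> (0 : R)] --> vphi 0).
    by apply: cvg_app; exact: nbhs_dnbhs.
  by apply: differentiable_continuous; apply/derivable1_diffP; exact: (nl_derivable nl).
have cid : (x : R) @[x --> 0^'] --> (0 : R) by move=> A; exact: nbhs_dnbhs.
have c0 (c : R) : c * x @[x --> 0^'] --> (0 : R).
  rewrite -[X in _ --> X](mulr0 c); apply: cvgMr; exact: cid.
have c1 : dkphi * `|x : R| @[x --> 0^'] --> (0 : R).
  rewrite -[X in _ --> X](mulr0 dkphi); apply: cvgMr; rewrite -[X in _ --> X](@normr0 R R).
  exact: cvg_norm.
have H : vphi x - kphi * x @[x --> 0^'] --> (0 : R).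
  apply: le_cvg0 c1; apply: filterS (nbhs_dnbhs_neq _) => x x0.
  by rewrite subr0; apply: nl_dist.
have : vphi x @[x --> 0^'] --> (0 : R).
  rewrite -[X in _ --> X](addr0 0).
  rewrite (_ : vphi = (fun x => (vphi x - kphi * x) + kphi * x)); last first.
    by apply/funext => x; rewrite subrK.
  by apply: cvgD => //; exact: c0.
by move=> H0; apply: (cvg_unique _ cv H0).
Qed.

Lemma nl_dist_sqr x : (vphi x - kphi * x) ^+ 2 <= dkphi ^+ 2 * x ^+ 2.
Proof.
have [->|x0] := eqVneq x 0; first by rewrite nl_zero mulr0 subrr expr0n/= mulr0.
rewrite -[leLHS]real_normK ?num_real// -[x ^+ 2]real_normK ?num_real// -exprMn.
by rewrite lerXn2r ?nnegrE// ?nl_dist// (le_trans _ (nl_dist x0)).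
Qed.

Lemma mu_setT_gt0 : (0 < mu [set: R])%E.
Proof.
apply: (@lt_le_trans _ _ (mu `[0, 1])); first by rewrite lebesgue_measure_itv/= lte_fin ltr01 sube0 lte_fin.
by apply: le_measure; rewrite ?inE.
Qed.

(** An essential bound on a continuous function holds everywhere: a violation at x would persist on
    some [x, x + e / 2], which has positive measure. *)
Lemma nl_slope_sqr x : derive1 vphi x ^+ 2 <= Mphi ^+ 2.
Proof.
suff H : `|derive1 vphi x| <= Mphi.
  by rewrite -[leLHS]real_normK ?num_real// lerXn2r ?nnegrE// (le_trans _ H).
have := nl_slope nl; rewrite unlock /= mu_setT_gt0 => /ess_supP [A [mA A0 HA]].
rewrite leNgt; apply/negP => Mx.
have : \forall y \near x, Mphi < `|derive1 vphi y|.
  have c : `|derive1 vphi y| @[y --> x] --> `|derive1 vphi x| by apply: cvg_norm; exact: (nl_C1 nl).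
  exact: (cvgr_gt _ c _ Mx).
move=> /nbhs_ballP[e /= e0 He].
have sub : `[x, x + e / 2] `<=` A.
  move=> y /=; rewrite in_itv/= => /andP[xy ye]; apply: HA => /=.
  rewrite lee_fin => Hy; have : Mphi < `|derive1 vphi y|.
    by apply: He; rewrite /ball/= ler0_norm; lra.
  by rewrite ltNge Hy.
have : (mu `[x, (x + e / 2)%R]%classic <= mu A)%E by apply: le_measure; rewrite ?inE.
rewrite A0 lebesgue_measure_itv/= lte_fin ltrDl divr_gt0// -EFinB lee_fin; lra.
Qed.

End Nonlinearity.

(** * Lyapunov matrices *)

Section HurwitzLyapunov.
Context {R : realType}.

Lemma ReM (x y : R[i]) : complex.Re (x * y) =
  complex.Re x * complex.Re y - complex.Im x * complex.Im y.
Proof. by case: x y => [a b] [c d]. Qed.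

Lemma ImM (x y : R[i]) : complex.Im (x * y) =
  complex.Re x * complex.Im y + complex.Im x * complex.Re y.
Proof. by case: x y => [a b] [c d]. Qed.

Lemma Re_sum (I : Type) (r : seq I) (P : pred I) (f : I -> R[i]) :
  complex.Re (\sum_(i <- r | P i) f i) = \sum_(i <- r | P i) complex.Re (f i).
Proof. by apply: big_morph => // -[a b] [c d]. Qed.

Lemma Im_sum (I : Type) (r : seq I) (P : pred I) (f : I -> R[i]) :
  complex.Im (\sum_(i <- r | P i) f i) = \sum_(i <- r | P i) complex.Im (f i).
Proof. by apply: big_morph => // -[a b] [c d]. Qed.

Lemma eigenvalue_trig_diag n (T : 'M[R[i]]_n) k : is_trig_mx T -> eigenvalue T (T k k).
Proof.
move=> tT; rewrite eigenvalue_root_char char_poly_trig//.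
by rewrite (bigD1 k)//= rootM root_XsubC eqxx.
Qed.

Lemma eigenvalue_similar n (M T U : 'M[R[i]]_n) l : U \in unitmx -> T *m U = U *m M ->
  eigenvalue T l -> eigenvalue M l.
Proof.
move=> uU TU /eigenvalueP[v vT v0]; apply/eigenvalueP; exists (v *m U).
  by rewrite -mulmxA -TU mulmxA vT -scalemxAl.
by apply: contra_neq v0 => vU; rewrite -[v](mulmxK uU) vU mul0mx.
Qed.

(* The real form of a Schur triangularisation T U = U M, with U = a + ib and T = r + it. *)
Lemma schur_real n (M : 'M[R]_n) (delta : R) : (0 < n)%N -> hurwitz_margin M delta ->
  exists a b r t : 'M[R]_n,
  [/\ a *m M = r *m a - t *m b, b *m M = r *m b + t *m a,
    forall i j : 'I_n, (i < j)%N -> r i j = 0 /\ t i j = 0,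
    forall i, r i i < - delta &
    forall x : 'cV[R]_n, a *m x = 0 -> b *m x = 0 -> x = 0].
Proof.
move=> n0 hM; pose MC := map_mx (real_complex R) M.
have [U /unitarymx_unit uU trT] := Schur MC n0.
pose T := conjmx U MC; have {}trT : is_trig_mx T := trT.
have TU : T *m U = U *m MC by rewrite /T conjumx// mulmxKV.
clearbody T.
exists (map_mx (@complex.Re R) U), (map_mx (@complex.Im R) U),
  (map_mx (@complex.Re R) T), (map_mx (@complex.Im R) T).
have E i j : \sum_k T i k * U k j = \sum_k U i k * (real_complex R (M k j)).
  by have := congr1 (fun Z : 'M[R[i]]_n => Z i j) TU; rewrite !mxE => ->; apply: eq_bigr => k _; rewrite mxE.
split.
- apply/matrixP => i j; rewrite !mxE -sumrB.
  have := congr1 (@complex.Re R) (E i j); rewrite !Re_sum => H.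
  transitivity (\sum_k complex.Re (T i k * U k j)); last first.
    by apply: eq_bigr => k _; rewrite !mxE ReM.
  by rewrite H; apply: eq_bigr => k _; rewrite !mxE ReM /= mulr0 subr0.
- apply/matrixP => i j; rewrite !mxE -big_split/=.
  have := congr1 (@complex.Im R) (E i j); rewrite !Im_sum => H.
  transitivity (\sum_k complex.Im (T i k * U k j)); last first.
    by apply: eq_bigr => k _; rewrite !mxE ImM.
  by rewrite H; apply: eq_bigr => k _; rewrite !mxE ImM /= mulr0 add0r.
- by move=> i j ij; rewrite !mxE; have /is_trig_mxP/(_ i j ij) -> := trT.
- move=> i; rewrite mxE; apply: hM; apply: (eigenvalue_similar uU TU).
  exact: eigenvalue_trig_diag.
- move=> x ax bx; suff H : map_mx (real_complex R) x = 0.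
    apply/matrixP => i j; have := congr1 (fun Z : 'cV[R[i]]_n => complex.Re (Z i j)) H.
    by rewrite !mxE.
  rewrite -[LHS](mulKmx uU); apply/(canLR (mulKmx uU)); rewrite mulmx0.
  apply/matrixP => i j; rewrite [RHS]mxE [LHS]mxE.
  have := congr1 (fun Z : 'cV[R]_n => Z i j) ax; have := congr1 (fun Z : 'cV[R]_n => Z i j) bx.
  rewrite !mxE => bx0 ax0.
  have HR : complex.Re (\sum_k U i k * map_mx (real_complex R) x k j) = 0.
    by rewrite Re_sum -[RHS]ax0; apply: eq_bigr => k _; rewrite !mxE ReM /= mulr0 subr0.
  have HI : complex.Im (\sum_k U i k * map_mx (real_complex R) x k j) = 0.
    by rewrite Im_sum -[RHS]bx0; apply: eq_bigr => k _; rewrite !mxE ImM /= mulr0 add0r.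
  by move: HR HI; case: (\sum_k _) => c d /= -> ->.
Qed.

Lemma finite_lbound n (f : 'I_n -> R) : (forall i, 0 < f i) ->
  exists2 e : R, 0 < e & forall i, e <= f i.
Proof.
move=> f0; pose S := 1 + \sum_i (f i)^-1.
have S0 : 0 < S by rewrite ltr_pwDl// sumr_ge0// => i _; rewrite invr_ge0 ltW.
exists S^-1 => [|i]; first by rewrite invr_gt0.
rewrite -[leRHS]invrK lef_pV2 ?posrE ?invr_gt0//.
rewrite /S (bigD1 i)//= addrCA lerDl addr_ge0// sumr_ge0// => j _.
by rewrite invr_ge0 ltW.
Qed.

(* Conjugating a triangular matrix by diag(s^i) shrinks its off-diagonal part. *)
Lemma triangular_rescale n (r t : 'M[R]_n) (sg : R) : 0 < sg ->
  (forall i j : 'I_n, (i < j)%N -> r i j = 0 /\ t i j = 0) ->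
  exists2 s : R, 0 < s & forall i j : 'I_n, i != j ->
    `|s ^+ i / s ^+ j * r i j| <= sg /\ `|s ^+ i / s ^+ j * t i j| <= sg.
Proof.
move=> sg0 tri; pose B := 1 + \sum_(ij : 'I_n * 'I_n) (`|r ij.1 ij.2| + `|t ij.1 ij.2|).
have B0 : 0 < B by rewrite ltr_pwDl// sumr_ge0// => i _; rewrite addr_ge0.
have Bb i j : `|r i j| <= B /\ `|t i j| <= B.
  have H : `|r i j| + `|t i j| <= B.
    rewrite /B (bigD1 (i, j))//= addrCA lerDl addr_ge0//.
    by apply: sumr_ge0 => k _; exact: addr_ge0.
  by move: H (normr_ge0 (r i j)) (normr_ge0 (t i j)) => H r0 t0; split; lra.
have S0 : 0 < B + sg by rewrite addr_gt0.
have s0 : 0 < sg / (B + sg) by rewrite divr_gt0.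
have s1 : sg / (B + sg) <= 1 by rewrite ler_pdivrMr// mul1r lerDr ltW.
have sB : sg / (B + sg) * B <= sg by rewrite mulrAC ler_pdivrMr// ler_pM2l// lerDl ltW.
exists (sg / (B + sg)) => // i j ij; move: s0 s1 sB; set s := sg / _ => s0 s1 sB.
have [ij'|ji|/val_inj e] := ltngtP i j; last by rewrite e eqxx in ij.
  by have [-> ->] := tri _ _ ij'; rewrite !mulr0 normr0 ltW.
have sE : s ^+ i / s ^+ j = s ^+ (i - j) by rewrite expfB// ltW.
have sle : `|s ^+ i / s ^+ j| <= s.
  rewrite sE ger0_norm ?exprn_ge0// ?(ltW s0)//.
  rewrite -[leRHS]expr1 ler_wiXn2l// ?(ltW s0)//; by rewrite subn_gt0.
have [rB tB] := Bb i j.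
split; rewrite normrM; apply: le_trans sB; apply: ler_pM => //.
Qed.

(** The left-hand side is the real part of the conjugate of a + ib times (r + it)(c + id). Each of
    its four products is bounded by sg times half a sum of two squares. *)
Lemma cross_term_bound (r t sg a b c d : R) : `|r| <= sg -> `|t| <= sg ->
  a * (r * c - t * d) + b * (r * d + t * c) <= sg * (a ^+ 2 + b ^+ 2 + c ^+ 2 + d ^+ 2).
Proof.
rewrite !ler_norml => /andP[r1 r2] /andP[t1 t2].
have H (x p q : R) : - sg <= x -> x <= sg -> x * (p * q) <= sg * ((p ^+ 2 + q ^+ 2) / 2).
  move=> x1 x2; have := sqr_ge0 (p - q); have := sqr_ge0 (p + q).
  have := mulr_ge0 (etrans (subr_ge0 _ _) x2) (sqr_ge0 (p + q)).
  have := mulr_ge0 (etrans (subr_ge0 _ _) x1) (sqr_ge0 (p - q)).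
  lra.
have := H r a c r1 r2; have := H r b d r1 r2; have := H (- t) a d; have := H t b c t1 t2.
rewrite lerN2 lerNl => h1 h2 h3 h4; have := h2 t2 t1; lra.
Qed.

(** P is a multiple of the squared Hermitian norm in rescaled Schur coordinates, written with real
    matrices. In these coordinates M is almost diagonal, and its diagonal has real parts below
    -delta. *)
Lemma hurwitz_lyapunov n (M : 'M[R]_n) (delta : R) : (0 < n)%N -> hurwitz_margin M delta ->
  exists2 P : 'M[R]_n, posdefmx P &
    forall x, 2 * dotv x (P *m (M *m x)) + 2 * delta * qf P x <= - dotv x x.
Proof.
move=> n0 hM; have [a [b [r [t [aM bM tri diag inj]]]]] := schur_real n0 hM.
have [ka ka0 kaP] : exists2 e : R, 0 < e & forall i, e <= - delta - r i i.
  by apply: finite_lbound => i; rewrite subr_gt0.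
(* The n^2 pairs (i, j) contribute at most 2 n sg = ka / 2 times the squared norm, which leaves half
   of the margin ka. *)
pose sg := ka / (4 * n%:R).
have n0' : 0 < n%:R :> R by rewrite ltr0n.
have sg0 : 0 < sg by rewrite divr_gt0// mulr_gt0.
have [s s0 sP] := triangular_rescale sg0 tri.
pose A : 'M[R]_n := \matrix_(i, j) (s ^+ i * a i j).
pose B : 'M[R]_n := \matrix_(i, j) (s ^+ i * b i j).
pose r' (i j : 'I_n) : R := s ^+ i / s ^+ j * r i j; pose t' (i j : 'I_n) : R := s ^+ i / s ^+ j * t i j.
have si (i : nat) : s ^+ i != 0 by rewrite expf_neq0// lt0r_neq0.
pose P0 := A^T *m A + B^T *m B.
have P0E x : qf P0 x = dotv (A *m x) (A *m x) + dotv (B *m x) (B *m x).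
  by rewrite qfD !qf_gram.
have rowA (x : 'cV_n) i : (A *m x) i 0 = s ^+ i * (a *m x) i 0.
  by rewrite !mxE mulr_sumr; apply: eq_bigr => j _; rewrite mxE mulrA.
have rowB (x : 'cV_n) i : (B *m x) i 0 = s ^+ i * (b *m x) i 0.
  by rewrite !mxE mulr_sumr; apply: eq_bigr => j _; rewrite mxE mulrA.
have pos : posdefmx P0.
  split; first by rewrite linearD/= !trmx_mul !trmxK.
  move=> x x0; rewrite -/(qf P0 x) P0E lt0r addr_ge0 ?dotvv_ge0// andbT.
  apply: contra_neq x0 => /eqP; rewrite paddr_eq0 ?dotvv_ge0// => /andP[/eqP hA /eqP hB].
  have Z (c y : 'cV[R]_n) : dotv y y = 0 -> (forall i, y i 0 = s ^+ i * c i 0) -> c = 0.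
    move=> y0 yc; apply/matrixP => i j; rewrite ord1 mxE.
    have := dotv_ge0_sqr y i; rewrite y0 yc => le0.
    have : (s ^+ i * c i 0) ^+ 2 == 0 by rewrite eq_le le0 sqr_ge0.
    by rewrite sqrf_eq0 mulf_eq0 (negbTE (si _)) => /eqP.
  by apply: inj; [exact: Z hA (rowA _)|exact: Z hB (rowB _)].
have [c c0 cP] := posdef_coercive pos.
have main x : 2 * dotv x (P0 *m (M *m x)) + 2 * delta * qf P0 x <= - ka * qf P0 x.
  rewrite P0E mulmxDl dotvDr -!mulmxA !(dotv_mull _^T) !trmxK.
  set u := A *m x; set v := B *m x.
  have AM i : (A *m (M *m x)) i 0 = \sum_j (r' i j * u j 0 - t' i j * v j 0).
    rewrite rowA mulmxA aM mulmxBl -!mulmxA mxE [X in _ + X]mxE !mxE -sumrB mulr_sumr.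
    apply: eq_bigr => j _; rewrite /u /v rowA rowB /r' /t'; field; exact: si.
  have BM i : (B *m (M *m x)) i 0 = \sum_j (r' i j * v j 0 + t' i j * u j 0).
    rewrite rowB mulmxA bM mulmxDl -!mulmxA mxE !mxE -big_split/= mulr_sumr.
    apply: eq_bigr => j _; rewrite /u /v rowA rowB /r' /t'; field; exact: si.
  pose W i := u i 0 ^+ 2 + v i 0 ^+ 2.
  have W0 i : 0 <= W i by rewrite addr_ge0 ?sqr_ge0.
  have WE : dotv u u + dotv v v = \sum_i W i.
    by rewrite !dotvE -big_split/=; apply: eq_bigr => i _; rewrite -!expr2.
  have -> : dotv u (A *m (M *m x)) + dotv v (B *m (M *m x)) =
      \sum_i \sum_j (u i 0 * (r' i j * u j 0 - t' i j * v j 0)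
        + v i 0 * (r' i j * v j 0 + t' i j * u j 0)).
    rewrite !dotvE -big_split/=; apply: eq_bigr => i _.
    by rewrite AM BM !mulr_sumr -big_split.
  have H : \sum_i \sum_j (u i 0 * (r' i j * u j 0 - t' i j * v j 0)
        + v i 0 * (r' i j * v j 0 + t' i j * u j 0)) <=
      \sum_i \sum_j ((i == j)%:R * (r i i * W i) + sg * (W i + W j)).
    apply: ler_sum => i _; apply: ler_sum => j _; have [<-|ij] := eqVneq i j.
      (* On the diagonal the imaginary parts of the eigenvalues cancel and only [r i i] remains. *)
      rewrite mul1r /r' /t' divff// !mul1r /W.
      have := mulr_ge0 (ltW sg0) (addr_ge0 (W0 i) (W0 i)).
      rewrite /W; move: (sg * _) => S S0.
      rewrite [leLHS](_ : _ = r i i * (u i 0 ^+ 2 + v i 0 ^+ 2)); last ring.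
      by rewrite lerDl.
    have [h1 h2] := sP i j ij; rewrite mul0r add0r.
    by have := cross_term_bound (u i 0) (v i 0) (u j 0) (v j 0) h1 h2; rewrite /W !addrA.
  have H2 : \sum_i \sum_j ((i == j)%:R * (r i i * W i) + sg * (W i + W j)) <=
      (- delta - ka) * (\sum_i W i) + 2 * n%:R * sg * (\sum_i W i).
    under eq_bigr do rewrite big_split/=.
    rewrite big_split/=; apply: lerD.
      rewrite mulr_sumr; apply: ler_sum => i _; rewrite (bigD1 i)//= eqxx mul1r big1 ?addr0.
        by rewrite ler_wpM2r//; have := kaP i; lra.
      by move=> j ji; rewrite eq_sym (negbTE ji) mul0r.
    under eq_bigr do rewrite -mulr_sumr big_split/= sumr_const card_ord -mulr_natl.
    rewrite -mulr_sumr big_split/= sumr_const card_ord -mulr_sumr -mulr_natl.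
    by move: (\sum_i W i) => S; rewrite le_eqVlt; apply/orP; left; apply/eqP; ring.
  rewrite WE; have := le_trans H H2; have : 0 <= \sum_i W i by exact: sumr_ge0.
  have -> : 2 * n%:R * sg = ka / 2 by rewrite /sg; field; exact: lt0r_neq0.
  move: (\sum_i \sum_j _) (\sum_i W i) => D S S0; lra.
(* The factor c / ka turns the rate -ka [qf P0 x] into -c [qf P0 x], which is at most -|x|^2. *)
exists ((c / ka) *: P0).
  split; first by rewrite linearZ/= pos.1.
  by move=> x x0; rewrite -scalemxAr -scalemxAl mxE mulr_gt0 ?divr_gt0// pos.2.
move=> x; rewrite -scalemxAl dotvZr qfZ.
have ck : 0 < c / ka by rewrite divr_gt0.
have := ler_wpM2l (ltW ck) (main x); have := cP x.
have -> : c / ka * (- ka * qf P0 x) = - (c * qf P0 x) by field; exact: lt0r_neq0.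
move: (c / ka) (dotv x _) (dotv x x) (qf P0 x) => e D X Q; lra.
Qed.

End HurwitzLyapunov.

(** * Stability and feasibility *)

Section MainResults.
Context {R : realType} (th1 th2 : R) (p qt q : R -> R) (qc : R).
Context (lam : nat -> R) (phi : nat -> R -> R).
Context (kphi Mphi delta : R) (N0 : nat) (K : 'rV[R]_N0) (L : 'cV[R]_N0).
Context (hth1 : 0 < th1 <= pi / 2) (hth2 : 0 <= th2 <= pi / 2).
Context (hp : C2_01 p) (hp0 : forall x : R, x \in `[0, 1] -> 0 < p x).
Context (hqt : C0_01 qt) (hq : C0_01 q) (hq0 : forall x : R, x \in `[0, 1] -> 0 < q x).
Context (heig : sl_eigenbasis th1 th2 p q lam phi).
Context (hqqc : forall x : R, x \in `[0, 1] -> qt x = q x - qc) (hdelta : 0 < delta).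
Context (hkphi : 0 < kphi) (hN0 : (1 <= N0)%N).
Context (hlam : forall n, (N0 <= n)%N -> - lam n + qc < - delta).
Local Notation A0' := (A0 qc lam N0).
Local Notation B0' := (B0 th2 p qt qc lam phi N0).
Local Notation C0' := (C0 phi N0).
Local Notation Hmx := (A0' + kphi *: (B0' *m K)).
Local Notation Gmx := (A0' - L *m C0').
Context (hK : hurwitz_margin Hmx delta) (hL : hurwitz_margin Gmx delta).

(** The constant is computed from the data of (ii) alone, before the nonlinearity is introduced; (i)
    enters through T = +oo. *)
Lemma exponential_decay (dkphi : R) (N : nat) :
  (N0 <= N)%N ->
  constraints_i th2 p qt qc lam phi N kphi dkphi Mphi K L delta ->
  constraints_ii th2 p qt qc lam phi N kphi dkphi Mphi K L delta ->
  exists2 M' : R, 0 < M' &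
    forall (vphi z0 : R -> R) (zh0 : nat -> R)
           (T : \bar R) (z : R -> R -> R) (zh : nat -> R -> R),
      admissible_nonlinearity kphi dkphi Mphi vphi ->
      trajectory th1 th2 p qt q qc lam phi N K L vphi z0 zh0 T z zh ->
      T = +oo%E /\
      forall t : R, 0 <= t ->
        normL2 (z t) ^+ 2 + \sum_(n < N) zh n t ^+ 2
        <= M' * expR (- 2 * delta * t)
           * (normL2 z0 ^+ 2 + \sum_(n < N) zh0 n ^+ 2).
Proof.
move=> hN [Moo [P [al [be [ga [ta [[P0 al0 be0 ga0 ta0] [[_ TP] T2]]]]]]]].
move=> [Moo' [P' [al' [be' [ga' [ta' [[P0' al0' be0' ga0' ta0'] [[_ TP'] [T2' T3']]]]]]]]].
have [c1 c10 Pc1] := posdef_coercive P0; have [c1' c10' Pc1'] := posdef_coercive P0'.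
have [c2 c20 Pc2] := qf_bounded P'.
have Psd v := posdef_ge0 v P0; have Psd' v := posdef_ge0 v P0'.
exists (Clow th2 lam N K kphi dkphi ga' c1' * Cup th2 lam N K kphi dkphi ga' c2).
  by rewrite mulr_gt0 ?Clow_gt0 ?Cup_gt0.
move=> vphi z0 zh0 T z zh nl tr; have sol := tr_solution tr.
have Too : T = +oo%E.
  apply/eqP; rewrite -leye_eq leNgt; apply/negP => Tlt; have T0 := cs_horizon sol.
  have [t0 t0T] : exists t0, Ioo T t0.
    move: T0 Tlt; case: (T) => // r; rewrite lte_fin => r0 _.
    by exists (r / 2); split; rewrite ?lte_fin; lra.
  have [B HB] := energy_bounded hth1 hth2 hp hp0 hqt hq hqqc hq0 heig hN (nl_derivable nl) sol
    (nl_dist_sqr nl) (nl_slope_sqr nl) P0.1 be0 ga0 ta0 TP c10 Psd Pc1 al0 Moo hdelta T2 t0T.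
  by have [t tT] := tr_blowup tr Tlt B; rewrite ltNge HB.
split=> // t t0; have tT : Ico T t by split=> //; rewrite Too ltry.
have H0 := decay_L2 hth1 hth2 hp hp0 hqt hq hqqc hq0 heig hN (nl_derivable nl) sol
    (nl_dist_sqr nl) (nl_slope_sqr nl) P0'.1 be0' ga0' ta0' TP' c10' c20 Psd' Pc1' Pc2 al0'
    Moo' T2' T3' tT; move: H0.
have z0E x : x \in (`[0, 1]%classic : set R) -> z 0 x = z0 x.
  by rewrite inE => x01; apply: (tr_init_z tr).
rewrite !normL2_sqr (eq_ip z0E z0E) /zsum.
have -> : \sum_(k < N) zh k 0 ^+ 2 = \sum_(k < N) zh0 k ^+ 2.
  by apply: eq_bigr => k _; rewrite (tr_init_zh tr).
by rewrite !mulNr.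
Qed.

(** The bound N0 + (N - N0) equals N only when N0 <= N; with it, the uniform bounds below hold for
    every N. *)
Lemma sum_shift_le (u : nat -> R) N : (forall k, 0 <= u k) ->
  \sum_(k < N - N0) u (N0 + k)%N <= \sum_(k < N0 + (N - N0)) u k.
Proof. by move=> u0; rewrite big_split_ord/= lerDr sumr_ge0. Qed.

(** betan / lam = an / lam - bn + qc bn / lam, and Bessel's inequality for a and b bounds the
    squares of the three terms, the inverse of lam being at most that of lam 0. The factor 3 comes
    from squaring a sum of three terms; the final 1 makes the constant positive. *)
Lemma input_bounded : exists2 cB : R, 0 < cB &
  forall N, dotv (B1 th2 p qt qc lam phi N0 N) (B1 th2 p qt qc lam phi N0 N) <= cB.
Proof.
have La : L2 (coefa th2 p qt) by exact: coefa_L2.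
have Lb := coefb_L2 th2 : L2 (coefb th2).
have l0 := lam_gt0 heig 0; pose i2 := (lam 0)^-1 ^+ 2.
have i20 : 0 <= i2 by exact: sqr_ge0.
pose A := ip (coefa th2 p qt) (coefa th2 p qt); pose B := ip (coefb th2) (coefb th2).
exists (3 * (i2 * A + (1 + qc ^+ 2 * i2) * B) + 1).
  have q2 := sqr_ge0 qc; have A0 : 0 <= A := ip_ge0 _; have B0 : 0 <= B := ip_ge0 _.
  have H1 := mulr_ge0 i20 A0; have H2 := mulr_ge0 (mulr_ge0 q2 i20) B0.
  by clearbody A B i2; rewrite mulrDl mul1r; lra.
move=> N; pose a n := an th2 p qt phi n; pose b n := bn th2 phi n.
apply: (@le_trans _ _ (\sum_(k < N - N0) (3 * (i2 * a (N0 + k)%N ^+ 2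
    + (1 + qc ^+ 2 * i2) * b (N0 + k)%N ^+ 2)))).
  rewrite dotvE; apply: ler_sum => k _; rewrite !mxE -expr2 /betan -/(a _) -/(b _).
  have ln := lam_gt0 heig (N0 + k)%N.
  have : (lam (N0 + k)%N)^-1 ^+ 2 <= i2.
    rewrite /i2 lerXn2r ?nnegrE ?invr_ge0 ?(ltW ln) ?(ltW l0)// lef_pV2 ?posrE//.
    exact: (lam_le heig).
  rewrite (_ : _ / lam _ = a (N0 + k)%N / lam (N0 + k)%N - b (N0 + k)%N
    + qc * b (N0 + k)%N / lam (N0 + k)%N); last by field; exact: lt0r_neq0.
  move: (a _) (b _) (lam (N0 + k)%N)^-1 => x y li lii.
  have H1 := ler_wpM2r (sqr_ge0 x) lii.
  have H2 := ler_wpM2r (sqr_ge0 (qc * y)) lii.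
  have : (x * li - y + qc * y * li) ^+ 2 <= 3 * ((x * li) ^+ 2 + y ^+ 2 + (qc * y * li) ^+ 2).
    have := sqr_ge0 (x * li + y); have := sqr_ge0 (y + qc * y * li).
    have := sqr_ge0 (x * li - qc * y * li); move: (x * li) (qc * y * li) => s r; lra.
  move: H1 H2; rewrite !exprMn; lra.
have u0 k : 0 <= 3 * (i2 * a k ^+ 2 + (1 + qc ^+ 2 * i2) * b k ^+ 2).
  have H1 := mulr_ge0 i20 (sqr_ge0 (a k)).
  have H2 := mulr_ge0 (mulr_ge0 (sqr_ge0 qc) i20) (sqr_ge0 (b k)).
  have b2 := sqr_ge0 (b k).
  by move: H1 H2 b2; clearbody i2; rewrite mulrDl mul1r; lra.
apply: (le_trans (sum_shift_le N u0)).
rewrite -mulr_sumr big_split/= -!mulr_sumr.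
have bA : \sum_(k < N0 + (N - N0)) a k ^+ 2 <= A by exact: (bessel heig).
have bB : \sum_(k < N0 + (N - N0)) b k ^+ 2 <= B by exact: (bessel heig).
apply: ler_wpDr => //; rewrite ler_pM2l//; apply: lerD; apply: ler_wpM2l => //.
by rewrite addr_ge0// mulr_ge0 ?sqr_ge0.
Qed.

Lemma output_bounded : exists2 cC : R, 0 < cC &
  forall N, dotv (C1 lam phi N0 N)^T (C1 lam phi N0 N)^T <= cC.
Proof.
have [C C0 CP] := sum_trace_lam hth1 hth2 hp hp0 hq hq0 heig; exists C => // N.
apply: (le_trans _ (CP (N0 + (N - N0))%N)).
have u0 k : 0 <= `|phi k 0| ^+ 2 / lam k by rewrite divr_ge0 ?sqr_ge0// ltW// (lam_gt0 heig).
apply: (le_trans _ (sum_shift_le N u0)); rewrite dotvE; apply: ler_sum => k _.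
rewrite !mxE real_normK ?num_real// -expr2 exprMn exprVn sqr_sqrtr// ltW//.
exact: (lam_gt0 heig).
Qed.

(** P depends on N only through the size of its two scalar blocks. The gain d of the disturbances
    (ze, ps) is fixed here; beta and tau will have to exceed it. *)
Lemma nominal_uniform : exists et d cE k2 : R, [/\ 0 < et, 0 < d, 0 < cE & 0 < k2] /\
  forall N, exists2 P : 'M[R]_(dimF N0 N), posdefmx P & forall X ze ps,
  [/\ 2 * dotv X (P *m (matF th2 p qt qc lam phi N kphi K L *m X + ze *: calL N L
        + ps *: calLpsi th2 p qt qc lam phi N0 N)) + 2 * delta * qf P X
      <= - et * dotv X X + d * (ze ^+ 2 + ps ^+ 2),
    (matE th2 p qt qc lam phi N kphi K L *m ext_vec X ze ps) 0 0 ^+ 2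
      <= cE * (dotv X X + ze ^+ 2 + ps ^+ 2) &
    (Ktilde N K *m X) 0 0 ^+ 2 <= k2 * dotv X X].
Proof.
have [PK pK HK] := hurwitz_lyapunov hN0 hK; have [PL pL HL] := hurwitz_lyapunov hN0 hL.
have [cB cB0 HB] := input_bounded; have [cC cC0 HC] := output_bounded.
(* The margin of the first high mode, hence of all of them, as lam increases. *)
pose ka := lam N0 - qc - delta.
have ka0 : 0 < ka by have := hlam (leqnn N0); rewrite /ka; lra.
have [a1 a10 Ha1] := dotv_sqr_bounded (PK *m L).
have [a2 a20 Ha2] := dotv_sqr_bounded (PK *m B0').
have [a3 a30 Ha3] := row_mul_bounded C0'.
have [a4 a40 Ha4] := dotv_sqr_bounded (PL *m L).
have [k2 k20 Hk2] := row_mul_bounded K; have [h1 h10 Hh1] := row_mul_bounded (K *m Hmx).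
have [m m0 mH] : exists2 m : R, 0 < m & 8 * a1 * a3 + 1 <= m / 2.
  exists (2 * (8 * a1 * a3 + 1)); last lra.
  by have := mulr_gt0 a10 a30; rewrite -mulrA; lra.
have [mu mu0 muH] : exists2 mu : R, 0 < mu & 8 * a1 * cC + 4 * m * a4 * cC + 1 <= 2 * mu * ka.
  exists ((8 * a1 * cC + 4 * m * a4 * cC + 1) / (2 * ka)).
    have := mulr_gt0 a10 cC0; have := mulr_gt0 (mulr_gt0 m0 a40) cC0.
    by rewrite -!mulrA => *; rewrite divr_gt0 ?mulr_gt0//; lra.
  by rewrite le_eqVlt; apply/orP; left; apply/eqP; field; exact: lt0r_neq0.
have [eps eps0 eH] : exists2 eps : R, 0 < eps & eps * (2 * cB / ka * kphi ^+ 2 * k2) <= 1 / 8.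
  set c := 2 * cB / ka * _ * _.
  have c0 : 0 < c by rewrite /c mulr_gt0// mulr_gt0 ?exprn_gt0// divr_gt0// mulr_gt0.
  exists (8 * c)^-1; first by rewrite invr_gt0 mulr_gt0.
  by rewrite le_eqVlt; apply/orP; left; apply/eqP; field; exact: lt0r_neq0.
(* The blocks come out of the budget with coefficients 3/8, 1, eps ka and 1. *)
have [et et0 etP] : exists2 et : R, 0 < et & [/\ et <= 3 / 8, et <= 1 & et <= eps * ka].
  have e0 : 0 < eps * ka by rewrite mulr_gt0.
  exists (Num.min (3 / 8) (eps * ka)); first by rewrite lt_min e0 andbT divr_gt0.
  by split; rewrite ge_min ?lexx ?orbT//; apply/orP; left; lra.
pose d := 8 * a1 + 4 * m * a4 + (8 * a2 + 2 * eps * cB / ka).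
have [d1 d2] : 0 <= 8 * a1 + 4 * m * a4 /\ 0 <= 8 * a2 + 2 * eps * cB / ka.
  have := mulr_gt0 m0 a40; have := divr_gt0 (mulr_gt0 eps0 cB0) ka0.
  by rewrite -!mulrA => *; split; lra.
pose kl := (K *m L) 0 0; pose kb := (K *m B0') 0 0.
pose cE := 5 * (h1 + kl ^+ 2 * (a3 + cC + 1) + kb ^+ 2).
exists et, (d + 1), cE, k2; split.
  split=> //; first by rewrite ltr_wpDl// addr_ge0.
  have H : 0 <= kl ^+ 2 * (a3 + cC + 1) by rewrite mulr_ge0 ?sqr_ge0//; lra.
  by have := sqr_ge0 kb; move: H; rewrite /cE; move: (kl ^+ 2 * _) (kb ^+ 2) => *; lra.
move=> N; exists (blkP N PK PL m eps mu); first exact: blkP_posdef.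
have hC (g : 'cV_(N - N0)) : (C1 lam phi N0 N *m g) 0 0 ^+ 2 <= cC * dotv g g.
  have -> : (C1 lam phi N0 N *m g) 0 0 = dotv (C1 lam phi N0 N)^T g by rewrite /dotv trmxK.
  by apply: (le_trans (dotv_CS _ _)); rewrite ler_wpM2r ?dotvv_ge0.
have hB (v : 'cV_(N - N0)) : dotv v (B1 th2 p qt qc lam phi N0 N) ^+ 2 <= cB * dotv v v.
  by rewrite dotvC; apply: (le_trans (dotv_CS _ _)); rewrite ler_wpM2r ?dotvv_ge0.
have hl (i : 'I_(N - N0)) : - lam (N0 + i)%N + qc + delta <= - ka.
  by have := lam_le heig (leq_addr i N0); rewrite /ka; lra.
move=> X ze ps; have [x [e [v [g ->]]]] := blk_onto X.
have x0 := dotvv_ge0 x; have e0 := dotvv_ge0 e; have v0 := dotvv_ge0 v; have g0 := dotvv_ge0 g.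
split.
- have := nominal_form a10 a20 a30 a40 cB0 cC0 ka0 eps0 mu0 m0
    Ha1 Ha2 Ha4 Hk2 Ha3 hB hC HK HL hl
    mH muH eH x e v g ze ps.
  move=> H; apply: (le_trans H); rewrite dotv_blk.
  have [t1 t2 t3] := etP; have z0 := sqr_ge0 ze; have s0 := sqr_ge0 ps.
  have H1 := ler_wpM2r x0 t1; have H2 := ler_wpM2r e0 t2; have H3 := ler_wpM2r v0 t3.
  have H4 := ler_wpM2r g0 t2.
  have H5 := mulr_ge0 d2 z0; have H6 := mulr_ge0 d1 s0.
  move: H1 H2 H3 H4 H5 H6 z0 s0; rewrite /d.
  move: (8 * a1 + _) (8 * a2 + _) (eps * ka) => D1 D2 ek; lra.
- by apply: matE_bounded => //; exact: ltW.
- rewrite Ktilde_blk dotv_blk; apply: (le_trans (Hk2 x)).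
  by rewrite ler_pM2l// -addrA lerDl !addr_ge0.
Qed.

Lemma ext_vec_onto N (v : 'cV[R]_(dimF N0 N + 1 + 1)) : exists X z s, v = ext_vec X z s.
Proof.
exists (usubmx (usubmx v)), ((dsubmx (usubmx v)) 0 0), ((dsubmx v) 0 0).
by rewrite /ext_vec -!mx11_scalar !vsubmxK.
Qed.

(** Alpha is quantified after the other constants because (i) and (ii) will use different values of
    it with the same sector width. The threshold on N depends on alpha, through the residuals. *)
Lemma Theta1_feasible : exists dkphi be ta : R, [/\ 0 < dkphi < kphi, 0 < be, 0 < ta &
  forall al, 0 < al -> \forall N \near \oo, exists2 P : 'M[R]_(dimF N0 N), posdefmx P &
    negsemidefmx (Theta1 th2 p qt qc lam phi kphi dkphi Mphi K L delta P al be 1 ta)].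
Proof.
have [et [d [cE [k2 [[et0 d0 cE0 k20] HN]]]]] := nominal_uniform.
have La : L2 (coefa th2 p qt) by exact: coefa_L2.
have Lb := coefb_L2 th2 : L2 (coefb th2); have pL := phi_L2 heig.
have [orth cp] := (eig_orthonormal heig, eig_complete heig).
have ta0 : 0 < d + 1 by rewrite addr_gt0.
(* x solves (d + 1) x k2 = et / 2. The bound dk <= 1 gives dk^2 <= dk <= x, and dk <= kphi / 2 gives
   dk < kphi. *)
have [dk dk0 dkP] : exists2 dk : R, 0 < dk < kphi & (d + 1) * dk ^+ 2 * k2 <= et / 2.
  pose x := et / (2 * (d + 1) * k2).
  have x0 : 0 < x by rewrite divr_gt0// mulr_gt0// mulr_gt0.
  exists (Num.min (kphi / 2) (Num.min 1 x)).
    apply/andP; split; first by rewrite !lt_min divr_gt0// ltr01 x0.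
    apply: (@le_lt_trans _ _ (kphi / 2)); first by rewrite ge_min lexx.
    by rewrite ltr_pdivrMr// ltr_pMr// ltr1n.
  set y := Num.min _ _.
  have y0 : 0 <= y by rewrite /y !le_min divr_ge0 ?ler01 ?(ltW x0) ?(ltW hkphi).
  have y1 : y <= 1 by rewrite /y !ge_min lexx orbT.
  have yx : y <= x by rewrite /y !ge_min lexx !orbT.
  apply: (@le_trans _ _ ((d + 1) * x * k2)).
    rewrite ler_wpM2r ?(ltW k20)// ler_wpM2l ?(ltW ta0)//; apply: le_trans yx.
    by rewrite expr2 -[leRHS]mulr1 ler_wpM2l.
  by rewrite le_eqVlt; apply/orP; left; apply/eqP; rewrite /x; field; rewrite !lt0r_neq0.
exists dk, (d + 1), (d + 1); split=> // al al0.
pose Ra N := tail phi N (coefa th2 p qt) (coefa th2 p qt).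
pose Rb N := tail phi N (coefb th2) (coefb th2).
(* One combination of the two residuals dominates both smallness conditions of
   [feasibility_balance]. *)
pose c := al * kphi ^+ 2 * k2 + al; pose c' := al * Mphi ^+ 2 * cE.
have lim0 : c * Ra N + c' * Rb N @[N --> \oo] --> (0 : R).
  rewrite (_ : 0 = c * 0 + c' * 0); last by rewrite !mulr0 addr0.
  apply: cvgD; apply: cvgMr.
    exact: (tail_cvg0 pL cp La).
  exact: (tail_cvg0 pL cp Lb).
have e0 : 0 < Num.min (et / 2) (1 / 2) by rewrite lt_min !divr_gt0.
have nearN : \forall N \near \oo, c * Ra N + c' * Rb N < Num.min (et / 2) (1 / 2).
  exact: (cvgr_lt _ lim0 _ e0).
apply: filterS nearN => N; rewrite lt_min => /andP[/ltW s1 /ltW s2].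
have [P pP HP] := HN N; exists P => //; split; first exact: Theta1_sym pP.1.
move=> v; rewrite -/(qf _ v); have [X [z [s ->]]] := ext_vec_onto v.
have RA := normL2_resid pL orth cp N La; have RB := normL2_resid pL orth cp N Lb.
rewrite (@Theta1_quad_tail _ _ _ _ _ _ _ N0 N kphi dk Mphi K L delta P al (d + 1) 1 (d + 1) _ _
  X z s pP.1 RA RB).
have [h1 h2 h3] := HP X z s.
have Ra0 : 0 <= Ra N by exact: (tail_ge0 pL cp N La).
have Rb0 : 0 <= Rb N by exact: (tail_ge0 pL cp N Lb).
have q1 : 0 <= al * Ra N by rewrite mulr_ge0// ltW.
have q2 : 0 <= al * kphi ^+ 2 * k2 * Ra N by rewrite !mulr_ge0 ?sqr_ge0// ltW.
apply: (feasibility_balance (ltW al0) Ra0 Rb0 (dotvv_ge0 X) (ltW ta0) (ltW cE0) h1 h3 h2 dkP).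
  by apply: le_trans s1; rewrite lerD2r /c mulrDl lerDl.
by apply: le_trans s2; rewrite lerD2r /c mulrDl lerDr.
Qed.

Lemma constraints_feasible : exists2 dkphi : R, 0 < dkphi < kphi &
  exists N1 : nat, forall N : nat, (N1 <= N)%N ->
    constraints_i th2 p qt qc lam phi N kphi dkphi Mphi K L delta /\
    constraints_ii th2 p qt qc lam phi N kphi dkphi Mphi K L delta.
Proof.
have [dk [be [ta [dk0 be0 ta0 H]]]] := Theta1_feasible; exists dk => //.
have l0 n := lam_gt0 heig n.
have [C C0 CP] := sum_trace_lam hth1 hth2 hp hp0 hq hq0 heig.
have [C' C0' CP'] := sum_trace_lam34 hth1 hth2 hp hp0 hq hq0 heig.
have near_lam B : \forall N \near \oo, B <= lam N by move: (eig_unbounded heig) => /cvgryPge; exact.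
have al3 : 0 < 3 :> R by [].
(* For (i), alpha = 3 gives 1 - 3 / (2 alpha) = 1/2, and lam N must exceed 2 (qc + delta) + be C.
   For (ii), alpha = 1: once lam N >= (be C')^4, be M_phi' is at most lam N^(1/4), so its term in
   the first constraint is at most lam N, out of the available 2 lam N, and its term in the second
   is at most 1, out of 2. *)
have := filterI (filterI (H 3 al3) (H 1 ltr01))
  (filterI (near_lam (2 * (qc + delta) + be * C)) (filterI (near_lam (2 * (qc + delta) + 3))
    (near_lam ((be * C') ^+ 4)))).
case=> N1 _ HN1; exists N1 => N /HN1/= [[[P pP TP] [P' pP' TP']] [lam1 [lam2 lam3]]].
have u0 k : 0 <= `|phi k 0| ^+ 2 / lam k by rewrite divr_ge0 ?sqr_ge0// ltW.
have u0' k : 0 <= `|phi k 0| ^+ 2 / lam k `^ (3 / 4).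
  by rewrite divr_ge0 ?sqr_ge0// powR_ge0.
have [Moo /andP[M0 MC]] := nneseries_bounded N u0 CP.
have [Moo' /andP[M0' MC']] := nneseries_bounded N u0' CP'.
have beM := ler_wpM2l (ltW be0) MC; have beM' := ler_wpM2l (ltW be0) MC'.
split; split=> //.
  exists P, 3, be, 1, ta; split; [split=> //; lra|split=> //].
  by rewrite -/(M_phi lam phi N) in MC beM *; move: beM; rewrite /M_phi; lra.
exists P', 1, be, 1, ta; split; first by split.
split=> //; pose x := lam N `^ (1 / 4).
have x0 : 0 < x by exact: powR_gt0.
have [_ lE] := pow14 (l0 N); rewrite -/x in lE.
have be0x : be * C' <= x.
  rewrite leNgt; apply/negP => xC; move: lam3; rewrite lE leNgt => /negP; apply.
  by apply: ltrXn2r => //; exact: ltW.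
have bx : be * fine (M_phi' lam phi N) <= x by exact: le_trans beM' be0x.
split; last by rewrite -/x subr_ge0 mulr1 ler_pdivrMr//; lra.
rewrite pow34// -/x.
have x3 : 0 <= x ^+ 3 by rewrite exprn_ge0// ltW.
have := ler_wpM2r x3 bx; rewrite -exprS -lE; move: lam2.
move: (be * _ * _) => y; lra.
Qed.

End MainResults.

Theorem corollary1 (R : realType) (th1 th2 : R) (p qt q : R -> R) (qc : R)
    (lam : nat -> R) (phi : nat -> R -> R)
    (kphi Mphi delta : R) (N0 : nat) (K : 'rV[R]_N0) (L : 'cV[R]_N0)
    (hth1 : 0 < th1 <= pi / 2) (hth2 : 0 <= th2 <= pi / 2)
    (hp : C2_01 p) (hp0 : forall x, x \in `[0, 1] -> 0 < p x)
    (hqt : C0_01 qt) (hq : C0_01 q)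
    (hqqc : forall x, x \in `[0, 1] -> qt x = q x - qc)
    (hq0 : forall x, x \in `[0, 1] -> 0 < q x)
    (heig : sl_eigenbasis th1 th2 p q lam phi)
    (hkphi : 0 < kphi) (hMphi : 0 < Mphi) (hdelta : 0 < delta)
    (hN0 : (1 <= N0)%N)
    (hlam : forall n, (N0 <= n)%N -> - lam n + qc < - delta)
    (hK : hurwitz_margin
            (A0 qc lam N0 + kphi *: (B0 th2 p qt qc lam phi N0 *m K)) delta)
    (hL : hurwitz_margin (A0 qc lam N0 - L *m C0 phi N0) delta) :
  (forall (dkphi : R) (N : nat),
     0 < dkphi < kphi -> (N0 + 1 <= N)%N ->
     constraints_i th2 p qt qc lam phi N kphi dkphi Mphi K L delta ->
     constraints_ii th2 p qt qc lam phi N kphi dkphi Mphi K L delta ->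
     exists2 M' : R, 0 < M' &
       forall (vphi z0 : R -> R) (zh0 : nat -> R)
              (T : \bar R) (z : R -> R -> R) (zh : nat -> R -> R),
         admissible_nonlinearity kphi dkphi Mphi vphi ->
         H2 z0 ->
         bc_left th1 z0 = 0 ->
         bc_right th2 z0 = vphi (\sum_(k < N0) K 0 k * zh0 k) ->
         trajectory th1 th2 p qt q qc lam phi N K L vphi z0 zh0 T z zh ->
         T = +oo%E /\
         forall t : R, 0 <= t ->
           normL2 (z t) ^+ 2 + \sum_(n < N) zh n t ^+ 2
           <= M' * expR (- 2 * delta * t)
              * (normL2 z0 ^+ 2 + \sum_(n < N) zh0 n ^+ 2))
  /\
  (exists2 dkphi : R, 0 < dkphi < kphi &
     exists N1 : nat, forall N : nat, (N1 <= N)%N -> (N0 + 1 <= N)%N ->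
       constraints_i th2 p qt qc lam phi N kphi dkphi Mphi K L delta /\
       constraints_ii th2 p qt qc lam phi N kphi dkphi Mphi K L delta).
Proof.
split.
  move=> dkphi N _; rewrite addn1 => /ltnW hN ci cii.
  have [M' M'0 HM'] := exponential_decay hth1 hth2 hp hp0 hqt hq hq0 heig hqqc hdelta hN ci cii.
  by exists M' => // vphi z0 zh0 T z zh nl _ _ _; exact: HM'.
have [dk dk0 [N1 HN1]] := constraints_feasible Mphi hth1 hth2 hp hp0 hqt hq hq0 heig hkphi hN0 hlam hK hL.
by exists dk => //; exists N1 => N N1N _; exact: HN1.
Qed.
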